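(* Let $M$ be a finite-volume orientable hyperbolic $3$-manifold such that $\pi_1(M)$ is $9$-semifree. Then $$\operatorname{rank}\pi_1(M)<1+157.766\cdot\operatorname{vol}(M).$$
   Context: Hyperbolic manifolds are complete and connected, i.e. of the form $\mathbf H^3/\Gamma$ with $\Gamma$ a discrete torsion-free group of isometries. $\operatorname{vol}$ denotes hyperbolic volume. The rank of a finitely generated group is the minimal cardinality of a generating set. For a positive integer $k$, a group $\Pi$ is $k$-semifree if each subgroup of $\Pi$ having rank at most $k$ is a free product of free abelian groups. *)

(* Defs.v *)
From HB Require Import structures.
From mathcomp Require Import all_boot all_order all_algebra.
From mathcomp Require Import generic_quotient.
From mathcomp Require Import all_classical all_reals all_analysis.
From mathcomp Require Import homotopy lra.

Set Implicit Arguments.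
Unset Strict Implicit.
Unset Printing Implicit Defensive.

Import Order.TTheory GRing.Theory Num.Theory.
Import numFieldNormedType.Exports.

Local Open Scope classical_set_scope.
Local Open Scope quotient_scope.
Local Open Scope ring_scope.

Section GroupNotions.
Local Open Scope group_scope.
Variable G : groupType.
Implicit Types (H B X : set G).

Definition subgroup H : Prop := group_closed [in H].

Definition generated X : set G := smallest subgroup X.

(* [H] is finitely generated and [n] is the minimal cardinality of a
   generating set of [H]. *)
Definition has_rank H (n : nat) : Prop :=
  (exists2 X : set G, (X #= `I_n)%card & generated X = H) /\
  (forall (m : nat) (X : set G), (X #= `I_m)%card -> generated X = H -> (n <= m)%N).

Definition expgz (x : G) (e : int) : G :=
  match e with Posz n => x ^+ n | Negz n => x ^- n.+1 end.

Definition free_abelian B : Prop :=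
  [/\ subgroup B,
      forall x y, B x -> B y -> commute x y
    & exists2 X : set G, generated X = B &
      forall (s : seq G) (e : G -> int), uniq s -> {in s, forall x, X x} ->
        \prod_(x <- s) expgz x (e x) = 1 -> {in s, forall x, e x = Posz 0}].

Definition reduced_word (I : eqType) (A : I -> set G) (w : seq (I * G)) : Prop :=
  {in w, forall u, A u.1 u.2 /\ u.2 != 1} /\
  sorted (fun u v : I * G => u.1 != v.1) w.

(* [H] is the (internal) free product of its subgroups [A i]: every element of
   [H] is the product of exactly one reduced word. *)
Definition free_product (I : eqType) (A : I -> set G) H : Prop :=
  [/\ subgroup H,
      forall i, subgroup (A i) /\ A i `<=` H
    & forall h, H h ->
        exists! w, reduced_word A w /\ \prod_(u <- w) u.2 = h].

Definition semifree (k : nat) : Prop :=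
  forall H (n : nat), subgroup H -> has_rank H n -> (n <= k)%N ->
    exists (I : eqType) (A : I -> set G),
      (forall i, free_abelian (A i)) /\ free_product A H.

End GroupNotions.

Section UnitInterval.
Variable R : realType.

Definition unit_itv : Type := set_type (`[0, 1]%classic : set R).
HB.instance Definition _ := Topological.copy unit_itv
  (set_type (`[0, 1]%classic : set R)).

Lemma clamp_proof (t : R) :
  Num.max 0 (Num.min 1 t) \in (`[0, 1]%classic : set R).
Proof.
rewrite inE /= in_itv /=.
by rewrite le_max lexx /= ge_max ler01 /= ge_min lexx.
Qed.

Definition clamp (t : R) : unit_itv :=
  exist (fun u : R => u \in (`[0, 1]%classic : set R)) _ (clamp_proof t).

Definition uval (s : unit_itv) : R := set_val s.

Lemma uval_clamp t : uval (clamp t) = Num.max 0 (Num.min 1 t).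
Proof. by []. Qed.

Lemma uval_itv s : 0 <= uval s <= 1.
Proof. by have := set_valP s; rewrite /= in_itv. Qed.

Lemma uval_inj : injective uval.
Proof. exact: val_inj. Qed.

Lemma clamp_id t : 0 <= t <= 1 -> uval (clamp t) = t.
Proof. by move=> /andP[t0 t1]; rewrite uval_clamp min_r // max_r. Qed.

Lemma clampK s : clamp (uval s) = s.
Proof. by apply: uval_inj; rewrite clamp_id // uval_itv. Qed.

Lemma clamp_le0 t : t <= 0 -> clamp t = clamp 0.
Proof.
move=> t0; apply: uval_inj; rewrite !uval_clamp.
by rewrite !min_r ?ler01 // ?(le_trans t0) ?ler01 // max_l // maxxx.
Qed.

Lemma clamp_ge1 t : 1 <= t -> clamp t = clamp 1.
Proof. by move=> t1; apply: uval_inj; rewrite !uval_clamp minxx min_l. Qed.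

Lemma uval_continuous : continuous uval.
Proof. exact: initial_continuous. Qed.

Lemma clamp_continuous : continuous clamp.
Proof.
apply: continuous_comp_initial => t.
have c0 : {for t, continuous (fun=> 0 : R^o)} by exact: cvg_cst.
have c1 : {for t, continuous (fun=> 1 : R^o)} by exact: cvg_cst.
have ci : {for t, continuous (fun u : R => u : R^o)} by exact: cvg_id.
exact: (continuous_max c0 (continuous_min c1 ci)).
Qed.

Lemma clamp0_neq1 : clamp 0 != clamp 1.
Proof.
apply/eqP => /(congr1 uval); rewrite !clamp_id ?lexx ?ler01 //.
by move=> /esym/eqP; rewrite oner_eq0.
Qed.

HB.instance Definition _ := isBiPointed.Build unit_itv clamp0_neq1.

Lemma zeroE : zero = clamp 0 :> unit_itv. Proof. by []. Qed.
Lemma oneE : one = clamp 1 :> unit_itv. Proof. by []. Qed.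
Lemma uval0 : uval zero = 0. Proof. by rewrite clamp_id ?lexx ?ler01. Qed.
Lemma uval1 : uval one = 1. Proof. by rewrite clamp_id ?lexx ?ler01. Qed.

Lemma paste_continuous (X T : topologicalType) (h : X -> R) (a : R)
    (F G : X -> T) :
  continuous h -> continuous F -> continuous G ->
  (forall x, h x = a -> F x = G x) ->
  continuous (fun x => if h x <= a then F x else G x).
Proof.
move=> ch cF cG FG x U /= Ux.
change (nbhs x (fun y => U (if h y <= a then F y else G y))).
case: (ltgtP (h x) a) Ux => hxa Ux.
- have nh : nbhs x (fun y => h y < a) by exact: (ch x _ (lt_nbhsl hxa)).
  have nF : nbhs x (fun y => U (F y)) by exact: (cF x _ Ux).
  near=> y; have hy : h y < a by near: y.
  by rewrite (ltW hy); near: y.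
- have nh : nbhs x (fun y => a < h y) by exact: (ch x _ (lt_nbhsr hxa)).
  have nG : nbhs x (fun y => U (G y)) by exact: (cG x _ Ux).
  near=> y; have hy : a < h y by near: y.
  by rewrite leNgt hy; near: y.
- have nF : nbhs x (fun y => U (F y)) by exact: (cF x _ Ux).
  have nG : nbhs x (fun y => U (G y)) by apply: (cG x); rewrite -FG.
  by near=> y; case: ifP => _; near: y.
Unshelve. all: by end_near. Qed.

End UnitInterval.

Section FundamentalGroup.
Variables (R : realType) (T : topologicalType) (x : T).
Local Notation I := (unit_itv R).
Local Notation loop := {path I from x to x in T}.
Implicit Types f g h : loop.

Definition homotopic_prop f g : Prop :=
  exists H : I * I -> T, [/\ continuous H,
    forall s, H (zero, s) = f s, forall s, H (one, s) = g s,
    forall t, H (t, zero) = x & forall t, H (t, one) = x].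

Definition homotopic f g : bool := `[< homotopic_prop f g >].

Definition path_cat (f g : I -> T) (s : I) : T :=
  if uval s <= 2^-1 then f (clamp (2 * uval s))
  else g (clamp (2 * uval s - 1)).

Definition path_rev (f : I -> T) (s : I) : T := f (clamp (1 - uval s)).

Lemma affine_continuous (X : topologicalType) (h : X -> R) (a b : R) :
  continuous h -> continuous (fun y => clamp (a * h y + b)).
Proof.
move=> ch y; apply: (@continuous_comp _ _ _ (fun y => a * h y + b) (@clamp R));
  last exact: clamp_continuous.
apply: cvgD; last exact: cvg_cst.
by apply: cvgM; [exact: cvg_cst|exact: ch].
Qed.

Lemma path_cat_continuous (X : topologicalType) (h : X -> R)
    (F G : X -> I -> T) :
  continuous h ->
  (forall k : X -> I, continuous k -> continuous (fun y => F y (k y))) ->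
  (forall k : X -> I, continuous k -> continuous (fun y => G y (k y))) ->
  (forall y, F y one = G y zero) ->
  continuous (fun y => if h y <= 2^-1 then F y (clamp (2 * h y))
                       else G y (clamp (2 * h y - 1))).
Proof.
move=> ch cF cG FG; apply: paste_continuous => //.
- apply: cF; have := @affine_continuous X h 2 0 ch.
  by under eq_fun do rewrite addr0.
- by apply: cG; exact: affine_continuous.
- by move=> y ->; rewrite mulfV ?pnatr_eq0 // subrr FG.
Qed.

Lemma loop_comp (X : topologicalType) (f : loop) (k : X -> I) :
  continuous k -> continuous (fun y => f (k y)).
Proof. by move=> ck y; apply: continuous_comp; [exact: ck|exact: cts_fun]. Qed.

Lemma loop_cat_continuous f g : continuous (path_cat f g).
Proof.
apply: (@path_cat_continuous _ (@uval R) (fun=> f) (fun=> g)).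
- exact: uval_continuous.
- by move=> k; exact: loop_comp.
- by move=> k; exact: loop_comp.
- by move=> _; rewrite path_zero path_one.
Qed.

Lemma loop_cat0 f g : path_cat f g zero = x.
Proof.
by rewrite /path_cat uval0 invr_ge0 ler0n mulr0 -zeroE path_zero.
Qed.

Lemma loop_cat1 f g : path_cat f g one = x.
Proof.
rewrite /path_cat uval1 invf_ge1 ?ltr0n // (ler_nat _ 2 1) /=.
by rewrite (_ : 2 * 1 - 1 = 1) -?oneE ?path_one //; lra.
Qed.

Definition loop_cat f g : loop :=
  mk_path (@loop_cat_continuous f g) (loop_cat0 f g) (loop_cat1 f g).

Lemma loop_rev_continuous f : continuous (path_rev f).
Proof.
apply: loop_comp => s.
have -> : (fun y : I => clamp (1 - uval y)) = (fun y => clamp (-1 * uval y + 1)).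
  by apply/funext => y; rewrite mulN1r addrC.
exact: (affine_continuous (@uval_continuous R)).
Qed.

Lemma loop_rev0 f : path_rev f zero = x.
Proof. by rewrite /path_rev uval0 subr0 -oneE path_one. Qed.

Lemma loop_rev1 f : path_rev f one = x.
Proof. by rewrite /path_rev uval1 subrr -zeroE path_zero. Qed.

Definition loop_rev f : loop :=
  mk_path (@loop_rev_continuous f) (loop_rev0 f) (loop_rev1 f).

Lemma cst_loop_continuous : continuous (fun _ : I => x).
Proof. exact: cst_continuous. Qed.

Definition loop_cst : loop := mk_path cst_loop_continuous erefl erefl.

Lemma fst_cont : continuous (fun p : I * I => uval p.1).
Proof. by move=> p; apply: continuous_comp; [exact: cvg_fst|exact: uval_continuous]. Qed.

Lemma snd_cont : continuous (fun p : I * I => uval p.2).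
Proof. by move=> p; apply: continuous_comp; [exact: cvg_snd|exact: uval_continuous]. Qed.

Lemma homotopy_comp (X : topologicalType) (H : I * I -> T) (a b : X -> I) :
  continuous H -> continuous a -> continuous b ->
  continuous (fun y => H (a y, b y)).
Proof.
move=> cH ca cb y.
apply: (@continuous_comp _ _ _ (fun y => (a y, b y)) H); last exact: cH.
exact: (cvg_pair (ca y) (cb y)).
Qed.

Lemma fst_continuous (X Y : topologicalType) : continuous (@fst X Y).
Proof. by move=> p; exact: cvg_fst. Qed.

Lemma snd_continuous (X Y : topologicalType) : continuous (@snd X Y).
Proof. by move=> p; exact: cvg_snd. Qed.

Lemma homotopic_refl : reflexive homotopic.
Proof.
move=> f; apply/asboolP; exists (fun p => f p.2); split => //.
- exact: (loop_comp (@snd_continuous I I)).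
- by move=> t; rewrite path_zero.
- by move=> t; rewrite path_one.
Qed.

Lemma homotopic_sym1 f g : homotopic f g -> homotopic g f.
Proof.
move=> /asboolP[H [cH H0 H1 Hz Ho]]; apply/asboolP.
exists (fun p => H (clamp (-1 * uval p.1 + 1), p.2)); split => //.
- apply: homotopy_comp => //; last exact: snd_continuous.
  exact: (affine_continuous fst_cont).
- by move=> s /=; rewrite uval0 mulr0 add0r -oneE.
- by move=> s /=; rewrite uval1 mulr1 addNr -zeroE.
Qed.

Lemma homotopic_sym : symmetric homotopic.
Proof. by move=> f g; apply/idP/idP; exact: homotopic_sym1. Qed.

Lemma homotopic_trans : transitive homotopic.
Proof.
move=> g f h /asboolP[H [cH H0 H1 Hz Ho]] /asboolP[K [cK K0 K1 Kz Ko]].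
apply/asboolP.
exists (fun p => if uval p.1 <= 2^-1 then H (clamp (2 * uval p.1), p.2)
                 else K (clamp (2 * uval p.1 - 1), p.2)); split.
- apply: (@path_cat_continuous _ (fun p : I * I => uval p.1)
    (fun p u => H (u, p.2)) (fun p u => K (u, p.2))).
  + exact: fst_cont.
  + by move=> k ck; apply: homotopy_comp => //; exact: snd_continuous.
  + by move=> k ck; apply: homotopy_comp => //; exact: snd_continuous.
  + by move=> p; rewrite H1 K0.
- by move=> s /=; rewrite uval0 invr_ge0 ler0n mulr0 -zeroE.
- move=> s /=; rewrite uval1 invf_ge1 ?ltr0n // (ler_nat _ 2 1) /=.
  by rewrite (_ : 2 * 1 - 1 = 1) -?oneE //; lra.
- by move=> t /=; case: ifP.
- by move=> t /=; case: ifP.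
Qed.

Canonical homotopic_equiv :=
  EquivRel homotopic homotopic_refl homotopic_sym homotopic_trans.

Lemma homotopic_cat f f' g g' :
  homotopic f f' -> homotopic g g' -> homotopic (loop_cat f g) (loop_cat f' g').
Proof.
move=> /asboolP[H [cH H0 H1 Hz Ho]] /asboolP[K [cK K0 K1 Kz Ko]].
apply/asboolP.
exists (fun p => if uval p.2 <= 2^-1 then H (p.1, clamp (2 * uval p.2))
                 else K (p.1, clamp (2 * uval p.2 - 1))); split.
- apply: (@path_cat_continuous _ (fun p : I * I => uval p.2)
    (fun p u => H (p.1, u)) (fun p u => K (p.1, u))).
  + exact: snd_cont.
  + by move=> k ck; apply: homotopy_comp => //; exact: fst_continuous.
  + by move=> k ck; apply: homotopy_comp => //; exact: fst_continuous.
  + by move=> p; rewrite Ho Kz.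
- by move=> s /=; rewrite H0 K0.
- by move=> s /=; rewrite H1 K1.
- by move=> t /=; rewrite uval0 invr_ge0 ler0n mulr0 -zeroE.
- move=> t /=; rewrite uval1 invf_ge1 ?ltr0n // (ler_nat _ 2 1) /=.
  by rewrite (_ : 2 * 1 - 1 = 1) -?oneE //; lra.
Qed.

Lemma homotopic_rev f f' : homotopic f f' -> homotopic (loop_rev f) (loop_rev f').
Proof.
move=> /asboolP[H [cH H0 H1 Hz Ho]]; apply/asboolP.
exists (fun p => H (p.1, clamp (-1 * uval p.2 + 1))); split => //.
- apply: homotopy_comp => //; first exact: fst_continuous.
  exact: (affine_continuous snd_cont).
- by move=> s /=; rewrite H0 mulN1r addrC.
- by move=> s /=; rewrite H1 mulN1r addrC.
- by move=> t /=; rewrite uval0 mulr0 add0r -oneE.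
- by move=> t /=; rewrite uval1 mulr1 addNr -zeroE.
Qed.

(* A reparametrisation of a loop is homotopic to it: interpolate linearly
   between the two parameters. *)
Lemma homotopic_reparam (p f g : loop) (phi psi : R -> R) :
  continuous phi -> continuous psi ->
  (forall s, f s = p (clamp (phi (uval s)))) ->
  (forall s, g s = p (clamp (psi (uval s)))) ->
  phi 0 = psi 0 -> phi 1 = psi 1 -> homotopic f g.
Proof.
move=> cphi cpsi fE gE e0 e1; apply/asboolP.
exists (fun q => p (clamp ((1 - uval q.1) * phi (uval q.2)
                           + uval q.1 * psi (uval q.2)))); split.
- apply: loop_comp => q; apply: (@continuous_comp _ _ _ (fun q : I * I =>
    (1 - uval q.1) * phi (uval q.2) + uval q.1 * psi (uval q.2)) (@clamp R));
    last exact: clamp_continuous.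
  have cc (k : R -> R) : continuous k ->
      (fun q : I * I => k (uval q.2)) @ q --> k (uval q.2).
    move=> ck; apply: (@continuous_comp _ _ _ (fun q : I * I => uval q.2)).
      exact: snd_cont.
    exact: ck.
  have cf : (fun q : I * I => uval q.1) @ q --> uval q.1 by exact: fst_cont.
  apply: cvgD; apply: cvgM => //; [|exact: cc|exact: cc].
  by apply: cvgB => //; exact: cvg_cst.
- by move=> s /=; rewrite uval0 subr0 mul1r mul0r addr0 fE.
- by move=> s /=; rewrite uval1 subrr mul1r mul0r add0r gE.
- move=> t /=; rewrite uval0 -e0 -mulrDl subrK mul1r.
  by have := fE zero; rewrite uval0 => <-; rewrite path_zero.
- move=> t /=; rewrite uval1 -e1 -mulrDl subrK mul1r.
  by have := fE one; rewrite uval1 => <-; rewrite path_one.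
Qed.

Lemma affine_cont (a b : R) : continuous (fun u : R => a * u + b).
Proof.
move=> u; apply: cvgD; last exact: cvg_cst.
by apply: cvgM; [exact: cvg_cst|exact: cvg_id].
Qed.

Lemma max_cont (k l : R -> R) :
  continuous k -> continuous l -> continuous (fun u => Num.max (k u) (l u)).
Proof.
by move=> ck cl u; have := @continuous_max R R k l u (ck u) (cl u).
Qed.

Lemma id_cont : continuous (fun u : R => u).
Proof. by move=> u; exact: cvg_id. Qed.

Lemma cst_cont (a : R) : continuous (fun _ : R => a).
Proof. by move=> u; exact: cvg_cst. Qed.

Lemma loop_cat_cst_l f : homotopic (loop_cat loop_cst f) f.
Proof.
apply: (@homotopic_reparam f _ _ (fun u => Num.max 0 (2 * u - 1)) id).
- by apply: max_cont; [exact: cst_cont|exact: affine_cont].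
- exact: id_cont.
- move=> s; rewrite /= /mk_path /path_cat; case: leP => hs.
    by rewrite max_l ?subr_le0 -?zeroE ?path_zero //; lra.
  by rewrite max_r //; lra.
- by move=> s; rewrite clampK.
- by rewrite max_l //; lra.
- by rewrite max_r //; lra.
Qed.

Lemma loop_cat_cst_r f : homotopic (loop_cat f loop_cst) f.
Proof.
apply: (@homotopic_reparam f _ _ (fun u => - Num.max (- 1) (- 2 * u + 0)) id).
- move=> u; apply: cvgN; apply: (max_cont (@cst_cont _) (@affine_cont _ _)).
- exact: id_cont.
- move=> s; rewrite /= /mk_path /path_cat; case: leP => hs.
    by rewrite max_r ?addr0 ?mulNr ?opprK //; lra.
  by rewrite max_l ?opprK -?oneE ?path_one //; lra.
- by move=> s; rewrite clampK.
- by rewrite max_r //; lra.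
- by rewrite max_l //; lra.
Qed.

Lemma loop_cat_rev_r f : homotopic (loop_cat f (loop_rev f)) loop_cst.
Proof.
apply: (@homotopic_reparam f _ _
  (fun u => - Num.max (- 2 * u + 0) (2 * u - 2)) (fun=> 0)).
- move=> u; apply: cvgN; apply: (max_cont (@affine_cont _ _) (@affine_cont _ _)).
- exact: cst_cont.
- move=> s; have /andP[s0 s1] := uval_itv s.
  rewrite /= /mk_path /path_cat /path_rev; case: leP => hs.
    by rewrite max_l ?addr0 ?mulNr ?opprK //; lra.
  rewrite max_r; last by lra.
  by rewrite clamp_id; [congr (f (clamp _)); lra|apply/andP; split; lra].
- by move=> s; rewrite -zeroE path_zero.
- by rewrite max_l //; lra.
- by rewrite max_r //; lra.
Qed.

Lemma loop_cat_rev_l f : homotopic (loop_cat (loop_rev f) f) loop_cst.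
Proof.
apply: (@homotopic_reparam f _ _
  (fun u => Num.max (- 2 * u + 1) (2 * u - 1)) (fun=> 1)).
- exact: (max_cont (@affine_cont _ _) (@affine_cont _ _)).
- exact: cst_cont.
- move=> s; have /andP[s0 s1] := uval_itv s.
  rewrite /= /mk_path /path_cat /path_rev; case: leP => hs.
    rewrite max_l; last by lra.
    by rewrite clamp_id; [congr (f (clamp _)); lra|apply/andP; split; lra].
  by rewrite max_r //; lra.
- by move=> s; rewrite -oneE path_one.
- by rewrite max_l //; lra.
- by rewrite max_r //; lra.
Qed.

Lemma loop_catA f g h :
  homotopic (loop_cat f (loop_cat g h)) (loop_cat (loop_cat f g) h).
Proof.
pose phi (u : R) := Num.max (2^-1 * u + 0) (Num.max (1 * u - 4^-1) (2 * u - 1)).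
apply: (@homotopic_reparam (loop_cat (loop_cat f g) h) _ _ phi id).
- apply: (max_cont (@affine_cont _ _)).
  exact: (max_cont (@affine_cont _ _) (@affine_cont _ _)).
- exact: id_cont.
- move=> s; have /andP[s0 s1] := uval_itv s; set u := uval s in s0 s1 *.
  have phiE1 : u <= 2^-1 -> phi u = u / 2.
    by move=> hu; rewrite /phi [X in Num.max _ X]max_l ?max_l; lra.
  have phiE2 : 2^-1 <= u -> u <= 3 / 4 -> phi u = u - 4^-1.
    by move=> hu hu'; rewrite /phi [X in Num.max _ X]max_l ?max_r; lra.
  have phiE3 : 3 / 4 <= u -> phi u = 2 * u - 1.
    by move=> hu; rewrite /phi [X in Num.max _ X]max_r ?max_r; lra.
  rewrite /= /mk_path /path_cat /= /mk_path -/u; case: (leP u 2^-1) => hu.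
    have h1 : 0 <= u / 2 <= 1 by apply/andP; split; lra.
    have h2 : 0 <= 2 * (u / 2) <= 1 by apply/andP; split; lra.
    rewrite phiE1 // (clamp_id h1) ifT; last by lra.
    rewrite /path_cat (clamp_id h2) ifT; last by lra.
    by congr (f (clamp _)); lra.
  have h0 : 0 <= 2 * u - 1 <= 1 by apply/andP; split; lra.
  rewrite /path_cat (clamp_id h0); case: leP => hu'.
    have h1 : 0 <= u - 4^-1 <= 1 by apply/andP; split; lra.
    have h2 : 0 <= 2 * (u - 4^-1) <= 1 by apply/andP; split; lra.
    rewrite phiE2; [|by lra|by lra].
    rewrite (clamp_id h1) ifT; last by lra.
    rewrite (clamp_id h2) ifF; last by apply/negbTE; rewrite -ltNge; lra.
    by congr (g (clamp _)); lra.
  rewrite phiE3; last by lra.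
  rewrite (clamp_id h0) ifF; last by apply/negbTE; rewrite -ltNge; lra.
  by congr (h (clamp _)); lra.
- by move=> s; rewrite clampK.
- by rewrite /phi [X in Num.max _ X]max_l ?max_l; lra.
- by rewrite /phi [X in Num.max _ X]max_r ?max_r; lra.
Qed.

Definition fundamental_group : Type := {eq_quot homotopic_equiv}.
HB.instance Definition _ := Choice.on fundamental_group.
HB.instance Definition _ := EqQuotient.on fundamental_group.

Definition pi1_class (f : loop) : fundamental_group := \pi_fundamental_group f.

Lemma pi1_classP f g : pi1_class f = pi1_class g <-> homotopic f g.
Proof. by split => [/eqmodP|?]; last exact/eqmodP. Qed.

Lemma homotopic_repr f : homotopic (repr (pi1_class f)) f.
Proof. by apply/pi1_classP; rewrite /pi1_class reprK. Qed.

Definition pi1_one : fundamental_group := pi1_class loop_cst.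
Definition pi1_mul (a b : fundamental_group) : fundamental_group :=
  pi1_class (loop_cat (repr a) (repr b)).
Definition pi1_inv (a : fundamental_group) : fundamental_group :=
  pi1_class (loop_rev (repr a)).

Lemma pi1_classK a : pi1_class (repr a) = a.
Proof. exact: reprK. Qed.

Lemma pi1_mulE f g : pi1_mul (pi1_class f) (pi1_class g) = pi1_class (loop_cat f g).
Proof. by apply/pi1_classP/homotopic_cat; exact: homotopic_repr. Qed.

Lemma pi1_invE f : pi1_inv (pi1_class f) = pi1_class (loop_rev f).
Proof. by apply/pi1_classP/homotopic_rev; exact: homotopic_repr. Qed.

Lemma pi1_mulA : associative pi1_mul.
Proof.
move=> a b c; rewrite -(pi1_classK a) -(pi1_classK b) -(pi1_classK c).
by rewrite !pi1_mulE; apply/pi1_classP/loop_catA.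
Qed.

Lemma pi1_mul1g : left_id pi1_one pi1_mul.
Proof.
move=> a; rewrite -(pi1_classK a) pi1_mulE.
exact/pi1_classP/loop_cat_cst_l.
Qed.

Lemma pi1_mulg1 : right_id pi1_one pi1_mul.
Proof.
move=> a; rewrite -(pi1_classK a) pi1_mulE.
exact/pi1_classP/loop_cat_cst_r.
Qed.

Lemma pi1_mulVg : left_inverse pi1_one pi1_inv pi1_mul.
Proof.
move=> a; rewrite -(pi1_classK a) pi1_invE pi1_mulE.
exact/pi1_classP/loop_cat_rev_l.
Qed.

Lemma pi1_mulgV : right_inverse pi1_one pi1_inv pi1_mul.
Proof.
move=> a; rewrite -(pi1_classK a) pi1_invE pi1_mulE.
exact/pi1_classP/loop_cat_rev_r.
Qed.

HB.instance Definition _ := isGroup.Build fundamental_group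
  pi1_mulA pi1_mul1g pi1_mulg1 pi1_mulVg pi1_mulgV.

End FundamentalGroup.

Section HyperbolicSpace.
Variable R : realType.

(* The upper half-space model: points (p 0 0, p 0 1, p 0 2) with p 0 2 > 0. *)
Definition upper_half_space : set 'rV[R]_3 := [set p | 0 < p 0 2].

Definition hyp3 : Type := set_type upper_half_space.
HB.instance Definition _ := Topological.copy hyp3 (set_type upper_half_space).

Definition arcosh (u : R) : R := ln (u + Num.sqrt (u ^+ 2 - 1)).

Definition hdist (p q : hyp3) : R :=
  let x := set_val p in let y := set_val q in
  arcosh (1 + (\sum_(i < 3) (x 0 i - y 0 i) ^+ 2) / (2 * x 0 2 * y 0 2)).

Definition hisometry (g : hyp3 -> hyp3) : Prop :=
  (forall p, exists q, g q = p) /\ (forall p q, hdist (g p) (g q) = hdist p q).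

Definition coords (p : hyp3) :
    measurableTypeR R * measurableTypeR R * measurableTypeR R :=
  let x := set_val p in (x 0 0, x 0 1, x 0 2).

(* Hyperbolic volume, with density dx dy dt / t^3. *)
Definition hvol (A : set hyp3) : \bar R :=
  (\int[lebesgue_measure \x lebesgue_measure \x lebesgue_measure]_(u in coords @` A)
     (u.2 ^- 3)%:E)%E.

Definition hjacobian (g : hyp3 -> hyp3) (p : hyp3) : 'M[R]_3 :=
  jacobian (valL_ 0 (set_val \o g)) (set_val p).

(* A hyperbolic 3-manifold H^3 / Gamma, given by its deck group Gamma, a
   discrete torsion-free group of isometries of H^3. *)
Record hyperbolic_3manifold := Hyperbolic3Manifold {
  deck : set (hyp3 -> hyp3);
  deck_isometry : forall g, deck g -> hisometry g;
  deck_id : deck id;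
  deck_comp : forall g h, deck g -> deck h -> deck (g \o h);
  deck_inv : forall g, deck g ->
    exists h, [/\ deck h, cancel g h & cancel h g];
  deck_discrete : forall g, deck g ->
    @isolated {compact-open, hyp3 -> hyp3} deck g;
  deck_torsion_free : forall g n, deck g -> (0 < n)%N ->
    iter n g =1 id -> g =1 id
}.

Variable M : hyperbolic_3manifold.

Definition same_orbit (p q : hyp3) : bool :=
  `[< exists2 g, deck M g & g p = q >].

Lemma same_orbit_refl : reflexive same_orbit.
Proof. by move=> p; apply/asboolP; exists id => //; exact: deck_id. Qed.

Lemma same_orbit_sym : symmetric same_orbit.
Proof.
suff h p q : same_orbit p q -> same_orbit q p by move=> p q; apply/idP/idP; exact: h.
move=> /asboolP[g Mg <-]; apply/asboolP.
by have [h [Mh gK _]] := deck_inv Mg; exists h.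
Qed.

Lemma same_orbit_trans : transitive same_orbit.
Proof.
move=> q p r /asboolP[g Mg <-] /asboolP[h Mh <-]; apply/asboolP.
by exists (h \o g) => //; exact: deck_comp.
Qed.

Canonical same_orbit_equiv :=
  EquivRel same_orbit same_orbit_refl same_orbit_sym same_orbit_trans.

Definition points : Type := quotient_topology {eq_quot same_orbit_equiv}.
HB.instance Definition _ := Topological.on points.
HB.instance Definition _ := Quotient.on points.

(* An orientation of M is an orientation of H^3 (true meaning agreement with the
   standard one) that is continuous and preserved by the deck group. *)
Definition orientable : Prop :=
  exists2 o : hyp3 -> bool, continuous o &
    forall g p, deck M g -> (o (g p) == o p) = (0 < \det (hjacobian g p)).

(* The volume of M is the supremum of the volumes of the Borel subsets of H^3
   that project injectively to M; it is attained by any Borel fundamental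
   domain. *)
Definition vol : \bar R :=
  ereal_sup [set hvol A | A in [set A | measurable (coords @` A) /\
                                        set_inj A \pi_points]].

End HyperbolicSpace.

(* Main.v *)
(* [pi_1 M] is the group of deck transformations of [H^3], which acts freely,
   discretely and by isometries; [H^3] is a sheet of the hyperboloid in Lorentz
   space, on which [B P Q] is the hyperbolic cosine of the distance.

   - Margulis number [eps = 0.905]: if [x], [y] do not commute they freely
     generate a free group (2-semifreeness and the Hopf property).  Let [T] be
     the sum of [x], [y] and their inverses, acting on Lorentz space.  The
     operator [T] is self-adjoint, so the reverse Cauchy-Schwarz inequality
     gives [B P (P T^n) <= (B P (P T))^n] for [n] a power of 2.  Volume packing
     bounds the sum of the displacements over the sphere of radius [j] in the
     free group from below by a multiple of [q^j] for [q^2 < 27], and the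
     recursion for the spheres turns this into the growth rate [q + 3/q] for
     [T^n]; hence [q + 3/q <= 2 (cosh d(P, x P) + cosh d(P, y P))].
   - Commutation is transitive on nontrivial elements (3-semifreeness), so the
     elements moving a point by less than [eps] fix a common ideal point;
     pushing away from it retracts the complement of the axes onto the thick
     part, which is therefore chain connected.
   - A maximal [eps]-separated family of [V] points of the thick part satisfies
     [V * vol (B(eps/2)) <= vol M].  Joining points at distance at most [1.82]
     yields a connected graph on the orbits; in a connected subgraph of minimal
     total length the edges at a vertex are the shorter sides of the triangles
     they span, so their directions are far apart and at most 59 edges start at
     each point.  Their [59 V] labels generate [pi_1 M]. *)
Require Import Defs.
From HB Require Import structures.
From mathcomp Require Import all_boot all_order all_algebra.
From mathcomp Require Import fingroup perm finmap generic_quotient.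
From mathcomp Require Import all_classical all_reals all_analysis homotopy.
From mathcomp Require Import measurable_realfun ring lra zify.

Set Implicit Arguments.
Unset Strict Implicit.
Unset Printing Implicit Defensive.

Import Order.TTheory GRing.Theory Num.Theory.
Import numFieldNormedType.Exports.
Local Open Scope ring_scope.

(** * Free products and semifree groups *)

(** The form [B] makes [hcosh p (act a p)] linear in the matrix of [a], so a sum of displacements
    over words is one matrix coefficient. The rate [q] balances two growths: the sphere of radius
    [j + 1] has [4 * 3 ^ j] words, while at most a constant times [X ^ 2] orbit points satisfy
    [hcosh <= X]; so a fixed share of the words has [hcosh] at least a constant times [sqrt 3 ^ j],
    and the sum is of order [(3 * sqrt 3) ^ j]. For [q = 5.19], slightly below [3 * sqrt 3], the
    value [(q + 3 / q) / 4] is just above [1.442], which exceeds [cosh 0.905]. Pushing does not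
    change the displacement at a point of an axis, so paths must avoid the axes of short elements.
    Since these have codimension two, two points can be joined through one generic third point. The
    length [1.82] just exceeds [2 * 0.905]: close points of the thick part lie within [0.905] of
    points of the net, and these must be joined. A ball of radius [0.4525] has volume at least
    [0.376], and [59 / 0.376 < 157]. *)

Section Generation.
Local Open Scope classical_set_scope.
Local Open Scope group_scope.
Variable G : groupType.
Implicit Types (H B X : set G) (x y g h : G).

Lemma subgroupP H : subgroup H <->
  H 1 /\ forall x y, H x -> H y -> H (x * y^-1).
Proof.
rewrite /subgroup /group_closed; split=> [[/set_mem h1 hd]|[h1 hd]].
  split=> // x y hx hy; have := hd x y; rewrite !inE; exact.
by split; [rewrite inE|move=> x y; rewrite !inE; exact: hd].
Qed.

Lemma subgroup1 H : subgroup H -> H 1. Proof. by case/subgroupP. Qed.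

Lemma subgroupV H x : subgroup H -> H x -> H x^-1.
Proof. by case/subgroupP=> h1 hd hx; rewrite -[_^-1]mul1g; exact: hd. Qed.

Lemma subgroupM H x y : subgroup H -> H x -> H y -> H (x * y).
Proof.
move=> sH hx hy; rewrite -[y]invgK; case/subgroupP: (sH) => _; apply=> //.
exact: subgroupV.
Qed.

Lemma generated_subgroup X : subgroup (Defs.generated X).
Proof.
apply/subgroupP; split=> [K [/subgroup1 ? _] //|x y hx hy K [sK XK]].
by case/subgroupP: (sK) => _; apply; [exact: hx|exact: hy].
Qed.

Lemma sub_generated X : X `<=` Defs.generated X.
Proof. by move=> x Xx K [_]; apply. Qed.

Lemma generated_min X H : subgroup H -> X `<=` H -> Defs.generated X `<=` H.
Proof. by move=> sH XH x; apply. Qed.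

Lemma commute_subgroup g : subgroup [set h | commute g h].
Proof.
apply/subgroupP; split=> [|x y /= cx cy]; first exact: commute1.
by apply: commuteM => //; apply: commuteV.
Qed.

Lemma rank_exists (s : seq G) :
  exists2 n, (n <= size s)%N & has_rank (Defs.generated [set` s]) n.
Proof.
pose P n := `[< exists2 X : set G, (X #= `I_n)%card &
  Defs.generated X = Defs.generated [set` s] >].
have Pe : P (size (undup s)).
  apply/asboolP; exists [set` s] => //.
  have -> : [set` s] = [set` seq_fset tt s].
    by apply/seteqP; split=> z; rewrite /mkset seq_fsetE.
  by apply/card_eq_fsetP; exact: size_seq_fset.
have exP : exists n, P n by exists (size (undup s)).
case: (ex_minnP exP) => n /asboolP Pn nmin; exists n.
  by apply: leq_trans (nmin _ Pe) (size_undup s).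
by split=> // m X Xm eX; apply: nmin; apply/asboolP; exists X.
Qed.

Lemma semifree_generated k (s : seq G) : (size s <= k)%N -> semifree G k ->
  exists (I : eqType) (A : I -> set G),
    (forall i, free_abelian (A i)) /\ free_product A (Defs.generated [set` s]).
Proof.
move=> sk sf; have [n ns rn] := rank_exists s.
exact: (sf _ n (generated_subgroup _) rn (leq_trans ns sk)).
Qed.

Section IntegerPowers.
Variable x : G.

Lemma expgz0 : expgz x 0%R = 1. Proof. by []. Qed.

Lemma expgzS m : expgz x (m + 1)%R = x * expgz x m.
Proof.
case: m => [n|[|n]].
- by rewrite (_ : (Posz n + 1)%R = Posz n.+1) /= ?expgS //; lia.
- by rewrite /= expg1 mulgV.
rewrite (_ : (Negz n.+1 + 1)%R = Negz n) /=; last by lia.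
by rewrite -!expVgn [in RHS]expgS mulVKg.
Qed.

Lemma expgzB1 m : expgz x (m - 1)%R = x^-1 * expgz x m.
Proof. by rewrite -[in RHS](subrK 1%R m) expgzS mulKg. Qed.

Lemma expgzD m n : expgz x (m + n)%R = expgz x m * expgz x n.
Proof.
elim: m => [|m IH|m IH]; first by rewrite add0r expgz0 mul1g.
  rewrite (_ : (m.+1%:Z + n = m%:Z + n + 1)%R); last by lia.
  rewrite (_ : (m.+1%:Z = m%:Z + 1)%R); last by lia.
  by rewrite !expgzS IH mulgA.
rewrite (_ : (- (m.+1)%:Z + n = (- m%:Z + n) - 1)%R); last by lia.
rewrite (_ : (- (m.+1)%:Z = - m%:Z - 1)%R); last by lia.
by rewrite !expgzB1 IH mulgA.
Qed.

Lemma expgzN m : expgz x (- m)%R = (expgz x m)^-1.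
Proof.
by apply/esym/mulg1_eq; rewrite -expgzD subrr.
Qed.

Lemma commute_expgz y m : commute y x -> commute y (expgz x m).
Proof.
by move=> cxy; case: m => n /=; [|apply: commuteV]; apply: commuteX.
Qed.

Lemma subgroup_expgz H m : subgroup H -> H x -> H (expgz x m).
Proof.
move=> sH Hx; have HX n : H (x ^+ n).
  by elim: n => [|n IH]; [exact: subgroup1|rewrite expgS; exact: subgroupM].
by case: m => n /=; [|apply: subgroupV].
Qed.

End IntegerPowers.

Section FreeAbelianExponent.
Variables (B X : set G) (s : G).
Hypotheses (sB : subgroup B) (cB : forall x y, B x -> B y -> commute x y).
Hypothesis gX : Defs.generated X = B.
Hypothesis fX : forall (l : seq G) (e : G -> int), uniq l ->
  {in l, forall x, X x} -> \prod_(x <- l) expgz x (e x) = 1 ->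
  {in l, forall x, e x = 0%R}.

(** The exponent of the basis element [s] in some expression of [g]. It is a relation because
    uniqueness of expressions is derived only later, from additivity. *)
Definition coordinate g (n : int) := exists l c, [/\ uniq l, {in l, forall x, X x},
  g = \prod_(x <- l) expgz x (c x) & n = if s \in l then c s else 0%R].

Lemma subXB : X `<=` B. Proof. by rewrite -gX; exact: sub_generated. Qed.

Lemma coordinate_subgroup g n : coordinate g n -> B g.
Proof.
move=> [l [c [_ lX -> _]]]; elim: l lX => [|y l IH] lX.
  by rewrite big_nil; exact: subgroup1.
rewrite big_cons; apply: subgroupM => //.
  by apply: subgroup_expgz => //; apply: subXB; apply: lX; rewrite mem_head.
by apply: IH => z zl; apply: lX; rewrite in_cons zl orbT.
Qed.

Lemma prod_expgz_update l (c : G -> int) y m : uniq l -> {in l, forall x, B x} ->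
  y \in l -> \prod_(x <- l) expgz x (c x + (if x == y then m else 0))%R =
  (\prod_(x <- l) expgz x (c x)) * expgz y m.
Proof.
elim: l => // z l IH /= /andP[zl ul] lB; rewrite in_cons !big_cons; move: IH.
have lB' : {in l, forall x, B x} by move=> x xl; apply: lB; rewrite in_cons xl orbT.
have [->{y} _ _|yz IH /= yl] := eqVneq y z.
  have -> : \prod_(x <- l) expgz x (c x + (if x == z then m else 0))%R =
      \prod_(x <- l) expgz x (c x).
    apply: eq_big_seq => x xl; rewrite ifN ?addr0 //.
    by apply: contraNneq zl => <-.
  rewrite /= expgzD -!mulgA; congr (_ * _); apply/esym.
  apply: commute_sym; rewrite big_seq; apply: commute_prod => x xl.
  apply: commute_expgz; apply: commute_sym; apply: commute_expgz.
  by apply: cB; [exact: lB'|apply: lB; rewrite mem_head].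
by rewrite IH //= addr0 mulgA.
Qed.

Lemma coordinate_mul_expgz g n y m : coordinate g n -> X y ->
  coordinate (g * expgz y m) (n + (if s == y then m else 0)).
Proof.
move=> cg Xy; have Bg := coordinate_subgroup cg.
move: cg => [l [c [ul lX gE nE]]]; have [yl|yl] := boolP (y \in l).
  exists l, (fun x => c x + (if x == y then m else 0))%R; split=> //.
    rewrite prod_expgz_update ?gE // => x xl; apply: subXB; exact: lX.
  rewrite nE; case: ifP => // sl; case: eqP => [sy|_]; last by rewrite addr0.
  by rewrite sy yl in sl.
exists (y :: l), (fun x => if x == y then m else c x); split.
- by rewrite /= yl.
- by move=> x; rewrite in_cons => /orP[/eqP->//|/lX].
- rewrite big_cons eqxx (_ : g * _ = expgz y m * g); last first.
    by apply: commute_expgz; apply: cB => //; exact: subXB.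
  rewrite gE; congr (_ * _); apply: eq_big_seq => x xl.
  by rewrite ifN //; apply: contraNneq yl => <-.
rewrite nE in_cons; case: eqP => [->|_] /=; first by rewrite (negbTE yl) add0r.
by rewrite addr0.
Qed.

Lemma coordinateM g h n m : coordinate g n -> coordinate h m ->
  coordinate (g * h) (n + m).
Proof.
move=> cg [l [c [ul lX -> ->]]] {h m}; elim: l g n cg ul lX => [|y l IH] g n cg.
  by rewrite big_nil mulg1 addr0.
move=> /= /andP[yl ul] lX; rewrite big_cons mulgA.
have Xy : X y by apply: lX; rewrite mem_head.
have := IH _ _ (coordinate_mul_expgz (c y) cg Xy) ul.
have lX' : {in l, forall x, X x} by move=> x xl; apply: lX; rewrite in_cons xl orbT.
move=> /(_ lX'); congr (coordinate _ _); rewrite in_cons -addrA; congr (_ + _)%R.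
by case: eqP => [->|_] /=; rewrite ?(negbTE yl) ?addr0 ?add0r.
Qed.

Lemma coordinateV g n : coordinate g n -> coordinate g^-1 (- n).
Proof.
move=> cg; have Bg := coordinate_subgroup cg.
move: cg => [l [c [ul lX gE nE]]]; exists l, (fun x => - c x)%R; split=> //; last first.
  by rewrite nE; case: ifP => _ //; rewrite oppr0.
rewrite gE => {g gE Bg nE}; elim: l ul lX => [|y l IH] /=; first by rewrite !big_nil invg1.
move=> /andP[yl ul] lX; rewrite !big_cons invgM -IH //; last first.
  by move=> x xl; apply: lX; rewrite in_cons xl orbT.
rewrite expgzN; apply: commuteV; apply: commute_sym; apply: commuteV; apply: commute_sym.
apply: commute_sym; rewrite big_seq; apply: commute_prod => x xl.
apply: commute_expgz; apply: commute_sym; apply: commute_expgz.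
by apply: cB; apply: subXB; apply: lX; rewrite ?mem_head // in_cons xl orbT.
Qed.

Lemma coordinate_exists g : B g -> exists n, coordinate g n.
Proof.
rewrite -gX; move: g.
apply: (@generated_min _ [set g | exists n, coordinate g n]); last first.
  move=> y Xy; exists (if s == y then 1%R else 0%R), [:: y], (fun=> 1%R).
  split=> //; first by move=> x; rewrite inE => /eqP->.
    by rewrite big_seq1.
  by rewrite inE.
apply/subgroupP; split; first by exists 0%R, [::], (fun=> 0%R); split; rewrite ?big_nil.
move=> x y [n cx] [m cy]; exists (n - m)%R; apply: coordinateM => //.
exact: coordinateV.
Qed.

Lemma coordinate1 n : coordinate 1 n -> n = 0%R.
Proof.
move=> [l [c [ul lX /esym e1 ->]]]; case: ifP => // sl.
exact: (fX ul lX e1).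
Qed.

(** Coordinates add, and those of [1] vanish by independence, so the relation [coordinate] is
    single-valued on [B]. The value outside [B] is arbitrary. *)
Lemma free_abelian_exponent : exists e : G -> int,
  (forall x, X x -> e x = if s == x then 1%R else 0%R) /\
  (forall g h, B g -> B h -> e (g * h) = (e g + e h)%R).
Proof.
have uniq_c g n m : coordinate g n -> coordinate g m -> n = m.
  move=> cn cm; apply/eqP; rewrite -subr_eq0; apply/eqP/coordinate1.
  by rewrite -(mulgV g); apply: coordinateM => //; exact: coordinateV.
have [|e eP] := @choice _ _ (fun g n => B g -> coordinate g n).
  move=> g; by have [/coordinate_exists[n cn]|nB] := pselect (B g); [exists n|exists 0%R].
exists e; split=> [x Xx|g h Bg Bh].
  apply: (uniq_c x); first by apply: eP; exact: subXB.
  exists [:: x], (fun=> 1%R); split; rewrite ?big_seq1 ?inE //.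
  by move=> z; rewrite inE => /eqP->.
apply: uniq_c (eP _ _) (coordinateM (eP _ Bg) (eP _ Bh)); exact: subgroupM.
Qed.

End FreeAbelianExponent.

End Generation.

(* The letter [(b, e)] is the [b]-th generator, inverted when [e] is true. *)
Local Notation letter := (bool * bool)%type.

(** * Words in two letters and finite quotients of free groups *)

Section Words.
Local Open Scope group_scope.
Implicit Types (l : letter) (w X Y : seq letter).

Definition linv l : letter := (l.1, ~~ l.2).
Definition winv w := rev (map linv w).
Definition wreduced w := sorted (fun l m => m != linv l) w.
Definition wsubst X Y w := flatten [seq
  (let Z := if l.1 then Y else X in if l.2 then winv Z else Z) | l : letter <- w].

Lemma linvK : involutive linv.
Proof. by case=> a b; rewrite /linv /= negbK. Qed.

Section Evaluation.
Variable G : groupType.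
Variables x y : G.

Definition lval l : G :=
  let z := if l.1 then y else x in if l.2 then z^-1 else z.
Definition wval w : G := \prod_(l <- w) lval l.

Lemma lval_inv l : lval (linv l) = (lval l)^-1.
Proof. by case: l => [[] []]; rewrite /lval /= ?invgK. Qed.

Lemma wval_cons l w : wval (l :: w) = lval l * wval w.
Proof. by rewrite /wval big_cons. Qed.

Lemma wval1 l : wval [:: l] = lval l.
Proof. by rewrite /wval big_seq1. Qed.

Lemma wval_cat w1 w2 : wval (w1 ++ w2) = wval w1 * wval w2.
Proof. by rewrite /wval big_cat. Qed.

Lemma wval_inv w : wval (winv w) = (wval w)^-1.
Proof.
elim: w => [|l w IH]; first by rewrite /wval /winv big_nil invg1.
rewrite wval_cons invgM -IH /winv /= rev_cons -cats1 wval_cat; congr (_ * _).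
by rewrite /wval big_seq1 lval_inv.
Qed.

Lemma generated2P g : Defs.generated [set` [:: x; y]] g -> exists w, wval w = g.
Proof.
apply: (@generated_min _ _ [set g | exists w, wval w = g]) => [|z].
  apply/subgroupP; split=> [|_ _ [w <-] [v <-]]; first by exists [::]; exact: big_nil.
  by exists (w ++ winv v); rewrite wval_cat wval_inv.
rewrite /mkset !inE => /orP[] /eqP->; [exists [:: (false, false)]|exists [:: (true, false)]];
by rewrite /wval big_seq1.
Qed.

Lemma generated2_wval w : Defs.generated [set` [:: x; y]] (wval w).
Proof.
have sG := generated_subgroup [set` [:: x; y]].
have gx : Defs.generated [set` [:: x; y]] x.
  by apply: (@sub_generated _ [set` [:: x; y]] x); rewrite /mkset mem_head.
have gy : Defs.generated [set` [:: x; y]] y.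
  by apply: (@sub_generated _ [set` [:: x; y]] y); rewrite /mkset !inE eqxx orbT.
elim: w => [|l w IH]; first by rewrite /wval big_nil; exact: (subgroup1 sG).
rewrite wval_cons; apply: (subgroupM sG) => //.
by case: l => [[] []]; rewrite /lval /= //; apply: (subgroupV sG).
Qed.

Definition free_pair := forall w, wreduced w -> wval w = 1 -> w = [::].

End Evaluation.

Lemma wval_subst (G : groupType) (x y : G) X Y w :
  wval x y (wsubst X Y w) = wval (wval x y X) (wval x y Y) w.
Proof.
elim: w => [|l w IH]; first by rewrite /wval !big_nil.
rewrite wval_cons -IH /wsubst /= wval_cat; congr (_ * _).
by case: l => [[] []]; rewrite /lval //= wval_inv.
Qed.

(** The complements of [A] and of its image have equal size and are matched along their
    enumerations. *)
Lemma perm_extend (T : finType) (A : {set T}) (f : T -> T) :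
  {in A &, injective f} -> exists s : {perm T}, {in A, s =1 f}.
Proof.
move=> fI; pose B := f @: A.
have cAB : #|~: A| = #|~: B|.
  by apply/eqP; rewrite -(eqn_add2l #|A|) cardsC -(card_in_imset fI) cardsC.
pose h x := if x \in A then f x else nth x (enum (~: B)) (index x (enum (~: A))).
have hB x : x \notin A -> h x \in ~: B.
  move=> xA; rewrite /h (negbTE xA) -mem_enum mem_nth // -cardE -cAB cardE index_mem.
  by rewrite mem_enum inE.
have hI : injective h.
  move=> x1 x2; case: (boolP (x1 \in A)) (boolP (x2 \in A)) => x1A [] x2A hh.
  - by apply: fI => //; move: hh; rewrite /h x1A x2A.
  - by have := hB _ x2A; rewrite -hh /h x1A inE imset_f.
  - by have := hB _ x1A; rewrite hh /h x2A inE imset_f.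
  move: hh; rewrite /h (negbTE x1A) (negbTE x2A).
  have i1 : x1 \in enum (~: A) by rewrite mem_enum inE.
  have i2 : x2 \in enum (~: A) by rewrite mem_enum inE.
  have s1 : (index x1 (enum (~: A)) < size (enum (~: B)))%N.
    by rewrite -cardE -cAB cardE index_mem.
  have s2 : (index x2 (enum (~: A)) < size (enum (~: B)))%N.
    by rewrite -cardE -cAB cardE index_mem.
  rewrite (set_nth_default x1 x2 s2) => /eqP; rewrite nth_uniq ?enum_uniq // => /eqP.
  exact: index_inj.
by exists (perm hI) => x xA; rewrite permE /h xA.
Qed.

(* Free groups are residually finite: [w] labels a path with [size w + 1]
   vertices, and reducedness makes each generator act there as a partial
   injection, which extends to a permutation. *)
Lemma reduced_word_perm w : wreduced w -> w != [::] ->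
  exists n (s t : {perm 'I_n}), wval s t w != 1.
Proof.
move=> rw w0; pose l0 : letter := (false, false); pose m := size w.
have red i : (i.+1 < m)%N -> nth l0 w i.+1 != linv (nth l0 w i).
  by move=> im; have /(sortedP l0) := rw; apply.
pose A g := [set k : 'I_m.+1 | ((k < m)%N && (nth l0 w k == (g, false))) ||
  ((0 < k)%N && (nth l0 w k.-1 == (g, true)))].
pose f g (k : 'I_m.+1) : 'I_m.+1 :=
  if (k < m)%N && (nth l0 w k == (g, false)) then inord k.+1 else inord k.-1.
have fP g : exists s : {perm 'I_m.+1}, {in A g, s =1 f g}.
  apply: perm_extend => j k; rewrite !inE /f.
  case: ifP => [/andP[jm /eqP wj] _|/negbT nj /= /andP[j0 /eqP wj]].
    case: ifP => [/andP[km _] _|/negbT nk /= /andP[k0 /eqP wk]] /(congr1 val) /=;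
      rewrite !inordK; try (by move: (ltn_ord j) (ltn_ord k); lia).
      by move=> [jk]; exact: val_inj.
    move=> jk; have kE : k.-1 = j.+1 by lia.
    have := red j; rewrite -kE wk wj /linv eqxx; have := ltn_ord k.
    by move=> ? /(_ ltac:(lia)).
  case: ifP => [/andP[km /eqP wk] _|/negbT nk /= /andP[k0 /eqP wk]] /(congr1 val) /=;
      rewrite !inordK; try (by move: (ltn_ord j) (ltn_ord k); lia).
    move=> jk; have jE : j.-1 = k.+1 by lia.
    have := red k; rewrite -jE wj wk /linv eqxx; have := ltn_ord j.
    by move=> ? /(_ ltac:(lia)).
  by move=> jk; apply: val_inj => /=; lia.
have [s sP] := fP false; have [t tP] := fP true.
have step i : (i < m)%N -> lval s t (nth l0 w i) (inord i) = inord i.+1 :> 'I_m.+1.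
  move=> im; case wi: (nth l0 w i) => [g e].
  have gP : {in A g, (if g then t else s) =1 f g} by case: (g).
  case: e wi => wi; rewrite /lval /=; last first.
    rewrite gP; first by rewrite /f inordK ?wi ?im ?eqxx //; lia.
    by rewrite inE inordK ?wi ?im ?eqxx //; lia.
  apply/(canLR (permK _)); rewrite gP; last first.
    by rewrite inE inordK /= ?wi ?eqxx ?orbT //; lia.
  rewrite /f inordK /=; last by lia.
  rewrite ifN //; apply/negP => /andP[im1 /eqP wi1].
  by have := red i im1; rewrite wi wi1 /linv eqxx.
exists m.+1, s, t; apply/eqP => w1.
(* Products of permutations act from left to right, so the suffix [drop i w] leads from vertex [i]
   to the last vertex [m]. *)
suff path_w i : (i <= m)%N -> wval s t (drop i w) (inord i) = inord m :> 'I_m.+1.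
  have := path_w 0%N isT; rewrite drop0 w1 perm1 => /(congr1 val) /=.
  by rewrite !inordK // => m0; move: w0; rewrite -size_eq0 -/m -m0.
move=> im; rewrite -(subKn im); elim: (m - i)%N (leq_subr i m) => [|k IH] km.
  by rewrite subn0 drop_size /wval big_nil perm1.
have mk : (m - k.+1 < m)%N by rewrite ltn_subrL /= (leq_ltn_trans _ km).
rewrite (drop_nth l0) // wval_cons permM (step _ mk) subnSK //.
exact: (IH (ltnW km)).
Qed.

End Words.

Lemma unsorted_split (T : Type) (e : rel T) s : ~~ sorted e s ->
  exists s1 a b s2, s = s1 ++ a :: b :: s2 /\ ~~ e a b.
Proof.
elim: s => // a [|b s] IH //=; rewrite negb_and => /orP[nab|/IH].
  by exists [::], a, b, s.
by move=> [s1 [c [d [s2 [-> ncd]]]]]; exists (a :: s1), c, d, s2.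
Qed.

(** * Reduced words in free products *)

Section FreeProducts.
Local Open Scope classical_set_scope.
Local Open Scope group_scope.
Variables (G : groupType) (I : eqType) (A : I -> set G) (H : set G).
Hypothesis fp : free_product A H.

Lemma fp_subgroup i : subgroup (A i). Proof. by case: fp => _ /(_ i)[]. Qed.

Lemma fp_sub i g : A i g -> H g. Proof. by case: fp => _ /(_ i)[_ h] _; exact: h. Qed.

Lemma fp_word h : H h -> exists w, reduced_word A w /\ \prod_(u <- w) u.2 = h.
Proof. by case: fp => _ _ /[apply] -[w [ww _]]; exists w. Qed.

Lemma fp_uniq w1 w2 : reduced_word A w1 -> reduced_word A w2 ->
  \prod_(u <- w1) u.2 = \prod_(u <- w2) u.2 -> w1 = w2.
Proof.
move=> r1 r2 e12; have Hw : H (\prod_(u <- w1) u.2).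
  case: r1 => rA _ {e12}; elim: w1 rA => [|u w1 IH] rA.
    by rewrite big_nil; case: fp => /subgroup1.
  rewrite big_cons; apply: subgroupM; first by case: fp.
    by apply: (@fp_sub u.1); apply: (rA u _).1; rewrite mem_head.
  by apply: IH => v v1; apply: rA; rewrite in_cons v1 orbT.
case: fp => _ _ /(_ _ Hw)[w [_ wU]].
by rewrite -(wU w1) // -(wU w2).
Qed.

Lemma reduced_word_nil : reduced_word A [::]. Proof. by []. Qed.

(** The universal property, stated on relations so that no homomorphism on [H] has to be built.
    Trivial syllables are deleted and neighbours from the same factor are merged, both compatibly
    with [F]; a word allowing neither is reduced, hence empty. *)
Lemma syllable_relation (G' : groupType) (F : I -> G -> G') :
  (forall i g h, A i g -> A i h -> F i (g * h) = F i g * F i h) ->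
  forall w : seq (I * G), {in w, forall u, A u.1 u.2} ->
  \prod_(u <- w) u.2 = 1 -> \prod_(u <- w) F u.1 u.2 = 1.
Proof.
move=> FM w; have F1 i : F i 1 = 1.
  apply: (@mulgI _ (F i 1)); rewrite -FM ?mulg1 //; exact: subgroup1 (fp_subgroup i).
have [n] := ubnP (size w); elim: n w => // n IH w wn wA w1.
have [/hasP[u uw /eqP u1]|/hasPn nu1] := boolP (has (fun u => u.2 == 1) w).
  case/splitPr: uw wn wA w1 => w1 w2; rewrite size_cat /= addnS ltnS => wn wA.
  rewrite !big_cat !big_cons /= u1 F1 !mul1g -!big_cat /= => e1.
  apply: IH => //; first by rewrite size_cat.
  by move=> v; rewrite mem_cat => vw; apply: wA; rewrite mem_cat in_cons orbCA vw orbT.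
have [so|/unsorted_split] := boolP (sorted (fun u v : I * G => u.1 != v.1) w).
  have rw : reduced_word A w.
    by split=> // u uw; split; [exact: wA|exact: nu1].
  by rewrite (fp_uniq rw reduced_word_nil) ?big_nil.
move=> [w1' [[i g] [[j h] [w2 [we]]]]] /=; rewrite negbK => /eqP ij; subst j.
subst w; have Ag : A i g by apply: (wA (i, g)); rewrite mem_cat mem_head orbT.
have Ah : A i h by apply: (wA (i, h)); rewrite mem_cat !in_cons eqxx !orbT.
have := IH (w1' ++ (i, g * h) :: w2).
rewrite !big_cat !big_cons /= FM // -!mulgA; apply.
- by move: wn; rewrite !size_cat /=; lia.
- move=> v; rewrite mem_cat in_cons orbCA => /orP[/eqP->/=|vw].
    by apply: subgroupM => //; exact: fp_subgroup.
  by apply: wA; rewrite mem_cat !in_cons; case/orP: vw => ->; rewrite ?orbT.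
by move: w1; rewrite !big_cat !big_cons.
Qed.

Definition nontrivial i := exists2 g, A i g & g != 1.

(** With a single nontrivial factor all syllables of all elements would lie in it and commute. *)
Lemma fp_two_factors : (forall i x y, A i x -> A i y -> commute x y) ->
  (exists x y, [/\ H x, H y & ~ commute x y]) ->
  exists i j, [/\ i != j, nontrivial i & nontrivial j].
Proof.
move=> cA [x [y [Hx Hy nc]]]; apply: contrapT => n2; apply: nc.
have [wx [[xA _] xE]] := fp_word Hx; have [wy [[yA _] yE]] := fp_word Hy.
rewrite -xE -yE big_seq; apply: commute_sym; apply: commute_prod => u ux.
rewrite big_seq; apply: commute_sym; apply: commute_prod => v vy.
have [[Au u1] [Av v1]] := (xA u ux, yA v vy).
have uv : u.1 = v.1.
  apply/eqP; apply: contrapT => /negP uv; apply: n2.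
  by exists u.1, v.1; split=> //; [exists u.2|exists v.2].
by apply: (cA u.1) => //; rewrite uv.
Qed.

(** Take [h] nontrivial in a factor other than that of the first syllable of [b]. Then [h b] is
    reduced, begins with [h] and has one syllable more than [b], while [b h] either begins with the
    first syllable of [b] or, after merging or cancelling, has no more syllables than [b]. *)
Lemma fp_center_trivial b i j : i != j -> nontrivial i -> nontrivial j ->
  H b -> (forall h, H h -> commute b h) -> b = 1.
Proof.
move=> ij ni nj Hb cb; have [w [[wA ws] wE]] := fp_word Hb.
case: w => [|u w] in wA ws wE *; first by rewrite -wE big_nil.
have [k ku [h Ah h1]] : exists2 k, k != u.1 & nontrivial k.
  by have [eu|?] := eqVneq i u.1; [exists j; rewrite // -eu eq_sym|exists i].
have r1 : reduced_word A ((k, h) :: u :: w).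
  split; last by rewrite /= ku.
  by move=> v; rewrite in_cons => /orP[/eqP->//|]; exact: wA.
have Hh := fp_sub Ah; have e1 : \prod_(v <- (k, h) :: u :: w) v.2 = b * h.
  by rewrite big_cons wE; apply/esym/cb.
case/lastP ew : (u :: w) => [//|w0 [j' g]].
have wE' : \prod_(v <- w0) v.2 * g = b.
  by rewrite -wE ew -cats1 big_cat big_seq1.
have [jk|jk] := eqVneq j' k; last first.
  have r2 : reduced_word A (rcons (u :: w) (k, h)).
    split; first by move=> v; rewrite mem_rcons in_cons => /orP[/eqP->//|]; exact: wA.
    have := congr1 (last u) ew; rewrite last_rcons /= => lw.
    by rewrite rcons_path lw /= jk andbT.
  have := fp_uniq r1 r2; rewrite e1 -cats1 big_cat big_seq1 wE => /(_ erefl)[uE].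
  by rewrite -uE eqxx in ku.
subst j'; have s0 : sorted (fun u v : I * G => u.1 != v.1) w0.
  move: ws; rewrite ew -cats1; case: (w0) => //= v w1; rewrite cat_path.
  by case/andP.
have A0 : {in w0, forall v, A v.1 v.2 /\ v.2 != 1}.
  by move=> v v0; apply: wA; rewrite ew mem_rcons in_cons v0 orbT.
have sw := congr1 size ew; rewrite size_rcons /= in sw.
have Ag : A k g /\ g != 1 by apply: (wA (k, g)); rewrite ew mem_rcons mem_head.
have [gh|gh] := eqVneq (g * h) 1.
  have r2 : reduced_word A w0 by [].
  have := fp_uniq r1 r2; rewrite e1 -wE' -mulgA gh mulg1 => /(_ erefl)/(congr1 size) /=.
  by lia.
have r2 : reduced_word A (rcons w0 (k, g * h)).
  split.
    move=> v; rewrite mem_rcons in_cons => /orP[/eqP->/=|]; last exact: A0.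
    by split=> //; apply: subgroupM; [exact: fp_subgroup|case: Ag|].
  move: ws; rewrite ew; case: (w0) => //= v w1; rewrite !rcons_path.
  by case/andP=> -> /=.
have := fp_uniq r1 r2; rewrite e1 -cats1 big_cat big_seq1 /= mulgA wE'.
by move=> /(_ erefl)/(congr1 size) /=; rewrite size_cat /=; lia.
Qed.

End FreeProducts.

(* Commutation is transitive on non-trivial elements: otherwise [b] would be
   central in [<a, b, c>], a free product of at least two factors. *)
Lemma semifree_commute_trans (G : groupType) (a b c : G) : semifree G 3 ->
  b != 1%g -> commute a b -> commute b c -> commute a c.
Proof.
move=> sf b1 ab bc; apply: contrapT => nac.
have [|I [A [Afa fp]]] := @semifree_generated _ 3 [:: a; b; c] _ sf; first by [].
have mem x : x \in [:: a; b; c] -> Defs.generated [set` [:: a; b; c]]%classic x.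
  by move=> xs; apply: (@sub_generated _ [set` [:: a; b; c]]%classic x).
have [|i [j [ij ni nj]]] := fp_two_factors fp (fun i => let: And3 _ h _ := Afa i in h).
  by exists a, c; split=> //; apply: mem; rewrite !inE eqxx ?orbT.
suff b1' : b = 1%g by rewrite b1' eqxx in b1.
apply: (fp_center_trivial fp ij ni nj).
  by apply: mem; rewrite !inE eqxx ?orbT.
apply: generated_min; first exact: commute_subgroup.
by move=> z; rewrite /mkset !inE => /or3P[] /eqP-> //=.
Qed.

(** * Free products generated by two elements *)

Section TwoGenerators.
Local Open Scope classical_set_scope.
Local Open Scope group_scope.
Variables (G : groupType) (x y : G).
Local Notation H := (Defs.generated [set` [:: x; y]]).
Variables (I : eqType) (A : I -> set G).
Hypothesis fp : free_product A H.

(** [x'] and [y'] are the images of the generators under the homomorphism induced by the [F k];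
    evaluating words at them stands in for that homomorphism. *)
Lemma syllable_transfer (G' : groupType) (F : I -> G -> G') :
  (forall i g h, A i g -> A i h -> F i (g * h) = F i g * F i h) ->
  exists x' y', forall W k g, A k g -> wval x y W = g -> wval x' y' W = F k g.
Proof.
move=> FM; have F1 i : F i 1 = 1.
  apply: (@mulgI _ (F i 1)); rewrite -FM ?mulg1 //; exact: subgroup1 (fp_subgroup fp i).
have FV i g : A i g -> F i g^-1 = (F i g)^-1.
  move=> Ag; apply/esym/mulg1_eq; rewrite -FM ?mulgV ?F1 //.
  exact: subgroupV (fp_subgroup fp i) Ag.
have [wx [[xA _] xE]] := fp_word fp (@generated2_wval _ x y [:: (false, false)]).
have [wy [[yA _] yE]] := fp_word fp (@generated2_wval _ x y [:: (true, false)]).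
rewrite wval1 in xE; rewrite wval1 in yE.
exists (\prod_(u <- wx) F u.1 u.2), (\prod_(u <- wy) F u.1 u.2) => W k g Ag Wg.
pose sinv (w : seq (I * G)) := rev [seq (u.1, u.2^-1) | u <- w].
have sinvA w : {in w, forall u, A u.1 u.2} -> {in sinv w, forall u, A u.1 u.2}.
  move=> wA u; rewrite mem_rev => /mapP[v vw ->] /=.
  exact: subgroupV (fp_subgroup fp _) (wA v vw).
have sinvE w : \prod_(u <- sinv w) u.2 = (\prod_(u <- w) u.2)^-1.
  elim: w => [|u w IH]; first by rewrite !big_nil invg1.
  by rewrite big_cons invgM -IH /sinv /= rev_cons -cats1 big_cat big_seq1.
have sinvF w : {in w, forall u, A u.1 u.2} ->
    \prod_(u <- sinv w) F u.1 u.2 = (\prod_(u <- w) F u.1 u.2)^-1.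
  elim: w => [|u w IH] wA; first by rewrite !big_nil invg1.
  rewrite big_cons invgM -IH; last by move=> v vw; apply: wA; rewrite in_cons vw orbT.
  rewrite /sinv /= rev_cons -cats1 big_cat big_seq1 /= FV //.
  by apply: wA; rewrite mem_head.
pose syl (l : letter) := let z := if l.1 then wy else wx in if l.2 then sinv z else z.
have wxA : {in wx, forall u, A u.1 u.2} by move=> u /xA[].
have wyA : {in wy, forall u, A u.1 u.2} by move=> u /yA[].
have sylA l : {in syl l, forall u, A u.1 u.2}.
  by case: l => [[] []]; rewrite /syl /=; do ?apply: sinvA.
have E W' : [/\ \prod_(u <- flatten (map syl W')) u.2 = wval x y W',
   \prod_(u <- flatten (map syl W')) F u.1 u.2 =
     wval (\prod_(u <- wx) F u.1 u.2) (\prod_(u <- wy) F u.1 u.2) W' &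
   {in flatten (map syl W'), forall u, A u.1 u.2}].
  elim: W' => [|l W' [IH1 IH2 IH3]]; first by rewrite /wval !big_nil.
  split=> /=.
  - rewrite big_cat wval_cons -IH1; congr (_ * _).
    by case: l => [[] []]; rewrite /syl /lval /= ?sinvE ?xE ?yE.
  - rewrite big_cat wval_cons -IH2; congr (_ * _).
    by case: l => [[] []]; rewrite /syl /lval /= ?sinvF.
  by move=> u; rewrite mem_cat => /orP[|]; [exact: sylA|exact: IH3].
have [E1 E2 E3] := E W; rewrite -E2.
(* Spelling [W] out in syllables and appending [g^-1] produces a relation. *)
have := @syllable_relation _ _ _ _ fp _ F FM (rcons (flatten (map syl W)) (k, g^-1)).
rewrite -cats1 !big_cat !big_seq1 /= E1 Wg mulgV FV // => h.
apply: divg1_eq; apply: h => // u; rewrite mem_cat inE => /orP[|/eqP->]; first exact: E3.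
exact: subgroupV (fp_subgroup fp _) Ag.
Qed.

Variables (X : I -> set G).
Hypothesis cA : forall i g h, A i g -> A i h -> commute g h.
Hypothesis gX : forall i, Defs.generated (X i) = A i.
Variable e : I -> G -> G -> int.
Hypothesis eX : forall i s t, X i s -> X i t -> e i s t = if s == t then 1%R else 0%R.
Hypothesis eM : forall i s g h, X i s -> A i g -> A i h ->
  e i s (g * h) = (e i s g + e i s h)%R.

(* Two elements have at most [2 ^ 2] homomorphisms to [Z/2], hence no three
   basis elements. *)
Lemma no_three_basis (i : 'I_3 -> I) (s : 'I_3 -> G) :
  (forall a, X (i a) (s a)) -> injective (fun a => (i a, s a)) -> False.
Proof.
move=> Xs inj; pose sg : 'Z_2 := 1%R.
(* [F S] adds modulo 2 the exponents of the basis elements selected by [S]; its value at [s a]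
   recovers [S a]. Eight selections [S] compete for four pairs of images of [x], [y]. *)
pose F (S : {ffun 'I_3 -> bool}) k (g : G) : 'Z_2 :=
  (\sum_(a < 3 | S a && (i a == k)) ((e k (s a) g)%:~R : 'Z_2))%R.
have FM S k g h : A k g -> A k h -> F S k (g * h) = F S k g * F S k h.
  move=> Ag Ah; rewrite -[RHS]/(F S k g + F S k h)%R -big_split; apply: eq_bigr => a /andP[_ /eqP ik].
  by rewrite eM ?rmorphD // -ik.
have /choice[z zP] : forall S, exists z : 'Z_2 * 'Z_2,
    forall W k g, A k g -> wval x y W = g -> wval z.1 z.2 W = F S k g.
  by move=> S; have [x' [y' h]] := syllable_transfer (FM S); exists (x', y').
have [S [S' [SS zS]]] : exists S S', S <> S' /\ z S = z S'.
  apply: contrapT => no; have zinj : injective z.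
    by move=> S S' zz; apply: contrapT => SS; apply: no; exists S, S'.
  have := leq_card z zinj; rewrite card_ffun card_prod card_ord card_bool.
  by rewrite !card_ord.
apply: SS; apply/ffunP => a.
have As b : A (i b) (s b) by rewrite -gX; exact: sub_generated.
have [W Ws] := generated2P (fp_sub fp (As a)).
have FE T : F T (i a) (s a) = (T a)%:R :> 'Z_2.
  rewrite /F big_mkcond (bigD1 a) //= big1 => [|b ba].
    by rewrite eqxx andbT eX ?eqxx // addr0; case: (T a).
  case: ifP => // /andP[_ /eqP ib]; rewrite eX ?Xs //; last by rewrite -ib.
  rewrite ifN //.
  by apply: contraNneq ba => sb; apply/eqP/inj; rewrite /= sb ib.
have := zP S W _ _ (As a) Ws; rewrite zS (zP S' W _ _ (As a) Ws) !FE.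
by case: (S a); case: (S' a).
Qed.

(* Hopfian property by counting homomorphisms to symmetric groups: if [X] and
   [Y] are words in [a], [b] for the generators [x], [y], then substituting
   [X], [Y] is an injective, hence surjective, self-map of pairs of
   permutations. *)
Lemma two_factor_free (i j : I) (a b : G) : i != j -> X i a -> X j b ->
  (forall k c, X k c -> (k, c) = (i, a) \/ (k, c) = (j, b)) -> free_pair x y.
Proof.
move=> ij Xa Xb Xab.
have Aa : A i a by rewrite -gX; exact: sub_generated.
have Ab : A j b by rewrite -gX; exact: sub_generated.
have gen_pow k s : X k s -> (forall c, X k c -> c = s) -> forall g, A k g ->
    exists m, g = expgz s m.
  move=> Xs Xc; rewrite -gX; apply: (@generated_min _ _ [set g | exists m, g = expgz s m]).
    apply/subgroupP; split=> [|_ _ [m ->] [n ->]]; first by exists 0%R.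
    by exists (m - n)%R; rewrite expgzD expgzN.
  by move=> c /Xc ->; exists 1%R.
have Ai g : A i g -> exists m, g = expgz a m.
  by apply: gen_pow => // c /Xab[[//]|[ei]]; rewrite ei eqxx in ij.
have Aj g : A j g -> exists m, g = expgz b m.
  by apply: gen_pow => // c /Xab[[ei]|[//]]; rewrite ei eqxx in ij.
have Ak k g : k != i -> k != j -> A k g -> g = 1.
  move=> ki kj; rewrite -gX => /(_ [set 1]); apply; split.
    by apply/subgroupP; split=> // _ _ -> ->; rewrite /= invg1 mulg1.
  by move=> c /Xab[][ek]; rewrite ek eqxx in ki kj.
have sab := generated_subgroup [set` [:: a; b]].
have ga : Defs.generated [set` [:: a; b]] a.
  by apply: (@sub_generated _ [set` [:: a; b]] a); rewrite /mkset mem_head.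
have gb : Defs.generated [set` [:: a; b]] b.
  by apply: (@sub_generated _ [set` [:: a; b]] b); rewrite /mkset !inE eqxx orbT.
have Hab h : H h -> exists W, wval a b W = h.
  move=> Hh; apply: generated2P; have [w [[wA _] <-]] := fp_word fp Hh.
  elim: w wA => [|u w IH] wA; first by rewrite big_nil; exact: (subgroup1 sab).
  rewrite big_cons; apply: (subgroupM sab); last first.
    by apply: IH => v vw; apply: wA; rewrite in_cons vw orbT.
  have [Au _] := wA u (mem_head _ _).
  have [ui|ui] := eqVneq u.1 i.
    by move: Au; rewrite ui => /Ai[m ->]; exact: (subgroup_expgz m sab ga).
  have [uj|uj] := eqVneq u.1 j.
    by move: Au; rewrite uj => /Aj[m ->]; exact: (subgroup_expgz m sab gb).
  by rewrite (Ak _ _ ui uj Au); exact: (subgroup1 sab).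
(* A relation between [a] and [b] holds for arbitrary [s], [t]: the factors of [a] and [b] are
   infinite cyclic, so the exponents define homomorphisms to which [syllable_relation] applies. *)
have rel (G' : groupType) (s t : G') W : wval a b W = 1 -> wval s t W = 1.
  pose F k g : G' := if k == i then expgz s (e i a g) else
    if k == j then expgz t (e j b g) else 1.
  have FM k g h : A k g -> A k h -> F k (g * h) = F k g * F k h.
    rewrite /F; have [->|_] := eqVneq k i; first by move=> Ag Ah; rewrite eM // expgzD.
    have [->|_] := eqVneq k j; first by move=> Ag Ah; rewrite eM // expgzD.
    by rewrite mulg1.
  pose syl (l : letter) : I * G := (if l.1 then j else i, lval a b l).
  have F1 k : F k 1 = 1.
    apply: (@mulgI _ (F k 1)); rewrite -FM ?mulg1 //; exact: subgroup1 (fp_subgroup fp k).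
  have FV k g : A k g -> F k g^-1 = (F k g)^-1.
    move=> Ag; apply/esym/mulg1_eq; rewrite -FM ?mulgV ?F1 //.
    exact: subgroupV (fp_subgroup fp k) Ag.
  have Fa : F i a = s by rewrite /F eqxx eX // eqxx.
  have Fb : F j b = t by rewrite /F eq_sym (negbTE ij) eqxx eX // eqxx.
  have := @syllable_relation _ _ _ _ fp _ F FM (map syl W).
  rewrite !big_map => h W1; rewrite -[RHS]h //.
    by apply: eq_bigr => -[[] []] _; rewrite /lval /= ?FV ?Fa ?Fb.
  move=> u /mapP[[[] []] _ ->] /=; rewrite /lval //=.
    exact: subgroupV (fp_subgroup fp _) Ab.
  exact: subgroupV (fp_subgroup fp _) Aa.
have [X1 X1E] := Hab _ (@generated2_wval _ x y [:: (false, false)]).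
have [Y1 Y1E] := Hab _ (@generated2_wval _ x y [:: (true, false)]).
rewrite wval1 in X1E; rewrite wval1 in Y1E.
have [Wa WaE] := generated2P (fp_sub fp Aa).
have [Wb WbE] := generated2P (fp_sub fp Ab).
have wsub (G' : groupType) (s t : G') Wc (l : letter) :
    wval x y Wc = lval a b l -> wval (wval s t X1) (wval s t Y1) Wc = lval s t l.
  move=> WcE; have := rel _ s t (wsubst X1 Y1 Wc ++ [:: linv l]).
  rewrite !wval_cat !wval_subst X1E Y1E [wval (lval _ _ _) _ _]WcE !wval1 !lval_inv mulgV.
  by move=> /(_ erefl)/divg1_eq.
move=> W rW W1; apply/eqP; apply: contrapT => /negP W0.
have [n [s [t st]]] := reduced_word_perm rW W0.
pose Phi (p : {perm 'I_n} * {perm 'I_n}) := (wval p.1 p.2 X1, wval p.1 p.2 Y1).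
(* The words [Wa], [Wb] for [a], [b] in terms of [x], [y], evaluated at [Phi p], give back [p]. *)
have PhiI : injective Phi.
  move=> [p1 p2] [q1 q2] [e1 e2].
  have := wsub _ p1 p2 Wa (false, false) WaE; rewrite e1 e2.
  rewrite (wsub _ q1 q2 Wa (false, false) WaE) /lval /= => ->.
  have := wsub _ p1 p2 Wb (true, false) WbE; rewrite e1 e2.
  by rewrite (wsub _ q1 q2 Wb (true, false) WbE) /lval /= => ->.
have [Psi _ PhiK] := injF_bij PhiI.
(* Being a relation between [x] and [y], [W] holds for every pair in the image of [Phi], hence for
   [s], [t], contrary to their choice. *)
have := rel _ (Psi (s, t)).1 (Psi (s, t)).2 (wsubst X1 Y1 W).
rewrite !wval_subst X1E Y1E [wval (lval _ _ _) _ _]W1 => /(_ erefl).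
have := PhiK (s, t); rewrite /Phi => -[-> ->] st1.
by rewrite st1 eqxx in st.
Qed.

End TwoGenerators.

(** Noncommutation gives two nontrivial factors, [no_three_basis] leaves one basis element in each
    and none elsewhere, and the Hopf argument passes from this basis to [x], [y]. *)
Lemma semifree_free_pair (G : groupType) (x y : G) : semifree G 2 ->
  ~ commute x y -> free_pair x y.
Proof.
move=> sf nxy; have [|I [A [Afa fp]]] := @semifree_generated _ 2 [:: x; y] _ sf.
  by [].
have cA i g h : A i g -> A i h -> commute g h by have [_ c _] := Afa i; exact: c.
have [X XP] := @choice _ _ (fun i X => Defs.generated X = A i /\
  forall (l : seq G) (c : G -> int), uniq l -> {in l, forall z, X z} ->
  (\prod_(z <- l) expgz z (c z))%g = 1%g -> {in l, forall z, c z = 0%R})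
  (fun i => let: And3 _ _ (ex_intro2 X g f) := Afa i in ex_intro _ X (conj g f)).
have gX i : Defs.generated (X i) = A i by have [] := XP i.
have /choice[e eP] : forall u : I * G, exists e : G -> int, X u.1 u.2 ->
    (forall z, X u.1 z -> e z = if u.2 == z then 1%R else 0%R) /\
    (forall g h, A u.1 g -> A u.1 h -> e (g * h)%g = (e g + e h)%R).
  move=> [i s] /=; have [Xs|nX] := pselect (X i s); last by exists (fun=> 0%R).
  have [e eP] := free_abelian_exponent s (fp_subgroup fp i) (@cA i) (gX i) (XP i).2.
  by exists e.
have eX i s t : X i s -> X i t -> e (i, s) t = if s == t then 1%R else 0%R.
  by move=> Xs; exact: (eP (i, s) Xs).1.
have eM i s g h : X i s -> A i g -> A i h -> e (i, s) (g * h)%g = (e (i, s) g + e (i, s) h)%R.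
  by move=> Xs; exact: (eP (i, s) Xs).2.
have mem z : z \in [:: x; y] -> Defs.generated [set` [:: x; y]]%classic z.
  by move=> zs; apply: (@sub_generated _ [set` [:: x; y]]%classic z).
have [|i [j [ij [g Ag g1] [h Ah h1]]]] := fp_two_factors fp cA.
  by exists x, y; split=> //; apply: mem; rewrite !inE eqxx ?orbT.
have ne k z : A k z -> z != 1%g -> exists s, X k s.
  move=> Az z1; apply: contrapT => nX; move: Az; rewrite -gX => /(_ [set 1%g]%classic).
  move=> zz; move: z1; rewrite zz ?eqxx //; split.
    by apply/subgroupP; split=> // _ _ -> ->; rewrite /= invg1 mulg1.
  by move=> s Xs; case: nX; exists s.
have [[a Xa] [b Xb]] := (ne _ _ Ag g1, ne _ _ Ah h1).
apply: (two_factor_free fp gX eX eM ij Xa Xb) => k c Xc.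
apply: contrapT => /not_orP[ca cb].
(* The default of [nth] serves as the third basis element. *)
pose f (o : 'I_3) := nth (k, c) [:: (i, a); (j, b)] o.
apply: (no_three_basis fp gX eX eM (i := fst \o f) (s := snd \o f)).
  by case=> [[|[|[|//]]] ?].
move=> [[|[|[|//]]] p] [[|[|[|//]]] q] /=; rewrite /f /= => ee;
  try exact: val_inj; exfalso; case: ee => e1 e2; subst;
  by [rewrite eqxx in ij|apply: ca|apply: cb].
Qed.

(** * The hyperboloid model *)

Section HyperbolicFunctions.
Variable R : realType.
Implicit Types x y u : R.

Definition coshR x : R := (expR x + expR (- x)) / 2.
Definition sinhR x : R := (expR x - expR (- x)) / 2.

Lemma coshR0 : coshR 0 = 1.
Proof. by rewrite /coshR oppr0 expR0; lra. Qed.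

Lemma coshR2B x : coshR x ^+ 2 - sinhR x ^+ 2 = 1.
Proof.
by have := expRxMexpNx_1 x; rewrite /coshR /sinhR; lra.
Qed.

Lemma coshRD x y : coshR (x + y) = coshR x * coshR y + sinhR x * sinhR y.
Proof. by rewrite /coshR /sinhR opprD !expRD; field. Qed.

Lemma coshR_double x : coshR (2 * x) = 1 + 2 * sinhR x ^+ 2.
Proof.
rewrite mulr_natl mulr2n coshRD -!expr2; have := coshR2B x; lra.
Qed.

Lemma sinhR_ge0 x : 0 <= x -> 0 <= sinhR x.
Proof.
by move=> x0; rewrite /sinhR divr_ge0 // subr_ge0 ler_expR; lra.
Qed.

Lemma coshR_ge1 x : 1 <= coshR x.
Proof.
have := coshR2B x; have := sqr_ge0 (sinhR x).
have : 0 < coshR x by rewrite /coshR divr_gt0 // addr_gt0 ?expR_gt0.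
nra.
Qed.

Lemma coshR_gt0 x : 0 < coshR x.
Proof. exact: lt_le_trans ltr01 (coshR_ge1 x). Qed.

Lemma sinhR_sqrt x : 0 <= x -> sinhR x = Num.sqrt (coshR x ^+ 2 - 1).
Proof.
move=> x0; have -> : coshR x ^+ 2 - 1 = sinhR x ^+ 2 by have := coshR2B x; lra.
by rewrite sqrtr_sqr ger0_norm // sinhR_ge0.
Qed.

Lemma expR_coshDsinh x : expR x = coshR x + sinhR x.
Proof. by rewrite /coshR /sinhR; lra. Qed.

Lemma arcosh_cosh x : 0 <= x -> arcosh (coshR x) = x.
Proof.
by move=> x0; rewrite /arcosh -sinhR_sqrt // -expR_coshDsinh expRK.
Qed.

Lemma cosh_arcosh u : 1 <= u -> coshR (arcosh u) = u.
Proof.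
move=> u1; rewrite /arcosh; set s := Num.sqrt _.
have s0 : 0 <= s by exact: sqrtr_ge0.
have s2 : s ^+ 2 = u ^+ 2 - 1 by rewrite sqr_sqrtr //; nra.
have us : 0 < u + s by lra.
rewrite /coshR expRN lnK ?posrE //.
have -> : (u + s)^-1 = u - s.
  apply: (mulfI (lt0r_neq0 us)); rewrite divff ?lt0r_neq0 //; nra.
lra.
Qed.

Lemma arcosh_ge0 u : 1 <= u -> 0 <= arcosh u.
Proof.
move=> u1; rewrite /arcosh ln_ge0 //.
by have := sqrtr_ge0 (u ^+ 2 - 1); lra.
Qed.

Lemma ltr_coshR : {in Num.nneg &, {mono coshR : x y / x < y}}.
Proof.
apply: leW_mono_in; apply: le_mono_in => x y; rewrite !nnegrE => x0 y0 xy.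
have [sx sy] := (sinhR_ge0 x0, sinhR_ge0 y0).
have d0 : 0 < y - x by rewrite subr_gt0.
have sd : 0 < sinhR (y - x) by rewrite /sinhR divr_gt0 // subr_gt0 ltr_expR; lra.
have c1 : 1 < coshR (y - x).
  have := coshR2B (y - x); have := coshR_ge1 (y - x).
  have := exprn_gt0 2 sd; nra.
have := coshR_ge1 x; rewrite -[in X in _ < X](subrK x y) coshRD; nra.
Qed.

Lemma ler_coshR : {in Num.nneg &, {mono coshR : x y / x <= y}}.
Proof.
by move=> x y x0 y0; rewrite leNgt ltr_coshR // -leNgt.
Qed.

End HyperbolicFunctions.

(** * Lorentz space and the hyperboloid *)

Section Lorentz.
Variable R : realType.
Local Notation V := 'rV[R]_4.
Implicit Types (x y z : V) (p q r : hyp3 R).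

Definition vec4 (a b c d : R) : V := \row_(i < 4) nth 0 [:: a; b; c; d] i.

Lemma vec4E a b c d : (vec4 a b c d 0 0 = a) * (vec4 a b c d 0 1 = b) *
  (vec4 a b c d 0 2 = c) * (vec4 a b c d 0 3 = d).
Proof. by rewrite /vec4 !mxE. Qed.

Lemma vec4P x y : x 0 0 = y 0 0 -> x 0 1 = y 0 1 -> x 0 2 = y 0 2 ->
  x 0 3 = y 0 3 -> x = y.
Proof.
move=> e0 e1 e2 e3; apply/rowP => -[[|[|[|[|//]]]] i4].
- by rewrite (_ : Ordinal i4 = 0) //; exact: val_inj.
- by rewrite (_ : Ordinal i4 = 1) //; exact: val_inj.
- by rewrite (_ : Ordinal i4 = 2) //; exact: val_inj.
- by rewrite (_ : Ordinal i4 = 3) //; exact: val_inj.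
Qed.

(* The Lorentz form of signature (1,3), in the null coordinates [2] and [3]. *)
Definition lorentz x y : R :=
  (x 0 2 * y 0 3 + x 0 3 * y 0 2) / 2 - x 0 0 * y 0 0 - x 0 1 * y 0 1.
Local Notation B := lorentz.

Lemma lorentzC x y : B x y = B y x.
Proof. by rewrite /B; lra. Qed.

Lemma lorentzDl x y z : B (x + y) z = B x z + B y z.
Proof. by rewrite /B !mxE; lra. Qed.

Lemma lorentzZl a x y : B (a *: x) y = a * B x y.
Proof. by rewrite /B !mxE; lra. Qed.

Lemma lorentzNl x y : B (- x) y = - B x y.
Proof. by rewrite /B !mxE; lra. Qed.

Lemma lorentzDr x y z : B x (y + z) = B x y + B x z.
Proof. by rewrite !(lorentzC x) lorentzDl. Qed.

Lemma lorentzZr a x y : B x (a *: y) = a * B x y.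
Proof. by rewrite !(lorentzC x) lorentzZl. Qed.

Lemma lorentzNr x y : B x (- y) = - B x y.
Proof. by rewrite !(lorentzC x) lorentzNl. Qed.

Lemma lorentz0l x : B 0 x = 0.
Proof. by rewrite /B !mxE; lra. Qed.

Definition lorentzE := (lorentzDl, lorentzDr, lorentzNl, lorentzNr, lorentzZl, lorentzZr).

Lemma lorentz_suml I (r : seq I) (P : pred I) (F : I -> V) y :
  B (\sum_(i <- r | P i) F i) y = \sum_(i <- r | P i) B (F i) y.
Proof.
by apply: (big_morph (fun x => B x y)) => [u v|]; [exact: lorentzDl|exact: lorentz0l].
Qed.

Definition sheet : set V := [set x | B x x = 1 /\ 0 < x 0 2].

(* Reverse Cauchy-Schwarz; after clearing [P 0 2] the difference is a sum of
   three squares. *)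
Lemma reverse_CS x y : sheet x -> B y y <= B x y ^+ 2.
Proof.
rewrite /sheet /= /B => -[xx v0].
set X := x 0 0 in xx *; set Y := x 0 1 in xx *; set v := x 0 2 in xx v0 *.
set u := x 0 3 in xx *.
have uE : u = (1 + X ^+ 2 + Y ^+ 2) / v.
  by apply: (mulfI (lt0r_neq0 v0)); rewrite mulrC [RHS]mulrC mulfVK ?lt0r_neq0 //; lra.
set a := y 0 0; set b := y 0 1; set c := y 0 2; set d := y 0 3.
rewrite -subr_ge0 -(pmulr_rge0 _ (exprn_gt0 2 v0)).
pose e := v ^+ 2 * d - 2 * X * a * v - 2 * Y * b * v + (X ^+ 2 + Y ^+ 2) * c.
suff -> : v ^+ 2 * (((v * d + u * c) / 2 - X * a - Y * b) ^+ 2 -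
    ((c * d + d * c) / 2 - a * a - b * b)) =
    ((e - c) / 2) ^+ 2 + (a * v - X * c) ^+ 2 + (b * v - Y * c) ^+ 2.
  by rewrite !addr_ge0 ?sqr_ge0.
by rewrite uE /e; field; rewrite lt0r_neq0.
Qed.

Definition height p : R := set_val p 0 2.

Lemma height_gt0 p : 0 < height p.
Proof. exact: (set_valP p). Qed.

(** The standard identification of the half-space with the sheet. Coordinate [2] is the inverse
    height, so the ideal point at infinity is the null direction of coordinate [3]. *)
Definition iota3 p : V := let x := set_val p in
  vec4 (x 0 0 / x 0 2) (x 0 1 / x 0 2) (x 0 2)^-1
       ((x 0 0 ^+ 2 + x 0 1 ^+ 2 + x 0 2 ^+ 2) / x 0 2).

Lemma iota3_sheet p : sheet (iota3 p).
Proof.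
have h := height_gt0 p; rewrite /sheet /= /B /iota3 !vec4E invr_gt0; split => //.
by rewrite /height in h; field; rewrite lt0r_neq0.
Qed.

Definition mk3 (x : V) : 'rV[R]_3 :=
  \row_(i < 3) nth 0 [:: x 0 0 / x 0 2; x 0 1 / x 0 2; (x 0 2)^-1] i.

Lemma sheet_iota3 x : sheet x -> exists p, iota3 p = x.
Proof.
move=> [xx v0]; have m2 : mk3 x \in @upper_half_space R.
  by rewrite inE /upper_half_space /= mxE /= invr_gt0.
pose p0 : hyp3 R := exist _ (mk3 x) m2; exists p0.
rewrite /iota3 (_ : set_val p0 = mk3 x) // !mxE /= invrK; have v0' := lt0r_neq0 v0.
apply: vec4P; rewrite !vec4E ?mulfVK //.
move: xx; rewrite /B => xx; apply: (mulfI v0'); move: xx.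
set a := x 0 0; set b := x 0 1; set c := x 0 2; set d := x 0 3 => xx.
have -> : c * (((a / c) ^+ 2 + (b / c) ^+ 2 + c^-1 ^+ 2) * c) = a ^+ 2 + b ^+ 2 + 1.
  by field.
lra.
Qed.

Lemma iota3_inj : injective iota3.
Proof.
move=> p q e; apply: val_inj; have hp := height_gt0 p; have hq := height_gt0 q.
rewrite /height in hp hq.
have e0 := congr1 (fun x : V => x 0 0) e; have e1 := congr1 (fun x : V => x 0 1) e.
have e2 := congr1 (fun x : V => x 0 2) e; rewrite /iota3 /= !vec4E in e0 e1 e2.
have t : set_val p 0 2 = set_val q 0 2 by apply: invr_inj.
rewrite t in e0 e1 *; apply/rowP => -[[|[|[|//]]] i3].
- rewrite (_ : Ordinal i3 = 0); last exact: val_inj.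
  by apply: (mulIf _ e0); rewrite invr_eq0 lt0r_neq0.
- rewrite (_ : Ordinal i3 = 1); last exact: val_inj.
  by apply: (mulIf _ e1); rewrite invr_eq0 lt0r_neq0.
- by rewrite (_ : Ordinal i3 = 2) //; exact: val_inj.
Qed.

Definition hcosh p q : R := B (iota3 p) (iota3 q).

Lemma hcoshC p q : hcosh p q = hcosh q p.
Proof. exact: lorentzC. Qed.

Lemma sum3 (F : 'I_3 -> R) : \sum_(i < 3) F i = F 0 + F 1 + F 2.
Proof.
rewrite !big_ord_recl big_ord0 addr0 addrA.
by congr (F _ + F _ + F _); apply: val_inj.
Qed.

Lemma hcoshE p q : hcosh p q = 1 + (\sum_(i < 3) (set_val p 0 i - set_val q 0 i) ^+ 2)
  / (2 * set_val p 0 2 * set_val q 0 2).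
Proof.
have hp := height_gt0 p; have hq := height_gt0 q; rewrite /height in hp hq.
by rewrite sum3 /hcosh /B /iota3 !vec4E; field; rewrite !lt0r_neq0.
Qed.

Lemma hdistE p q : hdist p q = arcosh (hcosh p q).
Proof. by rewrite hcoshE. Qed.

Lemma hcosh_ge1 p q : 1 <= hcosh p q.
Proof.
rewrite hcoshE lerDl divr_ge0 ?sumr_ge0 // => [i _|]; first exact: sqr_ge0.
have hp := height_gt0 p; have hq := height_gt0 q; rewrite /height in hp hq.
by rewrite !mulr_ge0 // ltW.
Qed.

Lemma hcoshxx p : hcosh p p = 1. Proof. by case: (iota3_sheet p). Qed.

Lemma coshR_hdist p q : coshR (hdist p q) = hcosh p q.
Proof. by rewrite hdistE cosh_arcosh // hcosh_ge1. Qed.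

Lemma hdist_ge0 p q : 0 <= hdist p q.
Proof. by rewrite hdistE arcosh_ge0 // hcosh_ge1. Qed.

Lemma hdistC p q : hdist p q = hdist q p.
Proof. by rewrite !hdistE hcoshC. Qed.

Lemma hdistxx p : hdist p p = 0.
Proof. by rewrite hdistE hcoshxx -(@coshR0 R) arcosh_cosh. Qed.

Lemma hcosh_eq1 p q : hcosh p q = 1 -> p = q.
Proof.
have hp := height_gt0 p; have hq := height_gt0 q; rewrite /height in hp hq.
have d0 : 0 < 2 * set_val p 0 2 * set_val q 0 2 by rewrite !mulr_gt0.
rewrite hcoshE => /eqP; rewrite -subr_eq0 addrC addKr mulf_eq0 invr_eq0.
rewrite (negbTE (lt0r_neq0 d0)) orbF psumr_eq0 => [/allP e|i _]; last exact: sqr_ge0.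
apply: val_inj; apply/rowP => i; apply/eqP; rewrite -subr_eq0.
by have := e i (mem_index_enum _); rewrite sqrf_eq0.
Qed.

Lemma hdist_eq0 p q : hdist p q = 0 -> p = q.
Proof. by move=> e; apply: hcosh_eq1; rewrite -coshR_hdist e coshR0. Qed.

Lemma hdist_ltP p q (r : R) : 0 <= r -> (hdist p q < r) = (hcosh p q < coshR r).
Proof. by move=> r0; rewrite -coshR_hdist ltr_coshR ?nnegrE ?hdist_ge0. Qed.

Lemma hdist_leP p q (r : R) : 0 <= r -> (hdist p q <= r) = (hcosh p q <= coshR r).
Proof. by move=> r0; rewrite -coshR_hdist ler_coshR ?nnegrE ?hdist_ge0. Qed.

(** Reverse Cauchy-Schwarz at [q] makes the form negative semidefinite on the orthogonal complement
    of [q]. There [x] and [y], the components of [p] and [r], have lengths [s1] and [s2], and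
    [key s2 s1] is their Cauchy-Schwarz inequality. If a length vanishes, two of the points
    coincide. *)
Lemma hdist_triangle q p r : hdist p r <= hdist p q + hdist q r.
Proof.
rewrite hdist_leP ?addr_ge0 ?hdist_ge0 // coshRD !coshR_hdist.
set s1 := sinhR _; set s2 := sinhR _; set c1 := hcosh p q; set c2 := hcosh q r.
have s10 : 0 <= s1 by rewrite sinhR_ge0 ?hdist_ge0.
have s20 : 0 <= s2 by rewrite sinhR_ge0 ?hdist_ge0.
have s1E : s1 ^+ 2 = c1 ^+ 2 - 1.
  by have := coshR2B (hdist p q); rewrite coshR_hdist -/s1 -/c1; lra.
have s2E : s2 ^+ 2 = c2 ^+ 2 - 1.
  by have := coshR2B (hdist q r); rewrite coshR_hdist -/s2 -/c2; lra.
pose x := iota3 p - c1 *: iota3 q; pose y := iota3 r - c2 *: iota3 q.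
have key (a b : R) : 0 <= a ^+ 2 * s1 ^+ 2 + b ^+ 2 * s2 ^+ 2
    - 2 * (a * b) * (hcosh p r - c1 * c2).
  have := reverse_CS (a *: x + b *: y) (iota3_sheet q).
  have [[qq _] [pp _]] := (iota3_sheet q, iota3_sheet p); have [rr _] := iota3_sheet r.
  rewrite /x /y !lorentzE qq pp rr (lorentzC (iota3 r) (iota3 p)).
  rewrite (lorentzC (iota3 q) (iota3 p)) (lorentzC (iota3 r) (iota3 q)).
  rewrite -/(hcosh p r) -/(hcosh p q) -/(hcosh q r) -/c1 -/c2 s1E s2E; lra.
have := key s2 s1; have := key 1 1; have := key s2 0; have := key 0 s1.
have [s120|s12] := eqVneq (s1 * s2) 0; last first.
  have s12' : 0 < s1 * s2 by rewrite lt_def s12 mulr_ge0.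
  move=> _ _ _ k; have : 0 <= (s1 * s2) * (s1 * s2 - (hcosh p r - c1 * c2)) by lra.
  by rewrite pmulr_rge0 //; lra.
move=> _ _ _ _; rewrite s120 addr0; move/eqP: s120; rewrite mulf_eq0 => /orP[]/eqP s0.
  have pq : p = q.
    apply: hcosh_eq1; have := hcosh_ge1 p q; rewrite -/c1; rewrite s0 in s1E; nra.
  by rewrite /c1 /c2 pq hcoshxx mul1r.
have qr : q = r.
  apply: hcosh_eq1; have := hcosh_ge1 q r; rewrite -/c2; rewrite s0 in s2E; nra.
by rewrite /c1 /c2 qr hcoshxx mulr1.
Qed.

End Lorentz.

(** * Isometries as Lorentz matrices *)

Section LinearExtension.
Variable R : realType.
Local Notation V := 'rV[R]_4.
Local Notation B := (@lorentz R).
Implicit Types (x y z : V) (p q r : hyp3 R).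

Lemma lorentz_nondegenerate x : (forall y, B x y = 0) -> x = 0.
Proof.
move=> x0; have := (x0 (vec4 1 0 0 0), x0 (vec4 0 1 0 0), x0 (vec4 0 0 1 0), x0 (vec4 0 0 0 1)).
rewrite /lorentz !vec4E => -[[[e0 e1] e2] e3].
by apply: vec4P; rewrite !mxE; lra.
Qed.

(** A basis of Lorentz space consisting of points of the sheet, so that a map of points prescribes a
    linear map; [base_coord] gives the coordinates in it. *)
Definition base_vec (i : 'I_4) : V := nth 0 [:: vec4 0 0 1 1; vec4 1 0 1 2;
  vec4 0 1 1 2; vec4 0 0 2^-1 2] i.

Lemma base_vec_sheet i : sheet (base_vec i).
Proof.
case: i => -[|[|[|[|//]]]] i4; rewrite /base_vec /sheet /= /lorentz !vec4E; split; lra.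
Qed.

Definition base_coord x (i : 'I_4) : R :=
  let s := x 0 2 - x 0 0 - x 0 1 in let r := x 0 3 - 2 * x 0 0 - 2 * x 0 1 in
  nth 0 [:: (4 * s - r) / 3; x 0 0; x 0 1; (2 * r - 2 * s) / 3] i.

Lemma sum4 (U : zmodType) (F : 'I_4 -> U) : \sum_(i < 4) F i = F 0 + F 1 + F 2 + F 3.
Proof.
rewrite !big_ord_recl big_ord0 addr0 !addrA.
by congr (F _ + F _ + F _ + F _); apply: val_inj.
Qed.

Lemma base_coordP x : x = \sum_(i < 4) base_coord x i *: base_vec i.
Proof.
rewrite sum4 /base_coord /base_vec /=; set s := x 0 2 - _ - _; set r := x 0 3 - _ - _.
by apply: vec4P; rewrite !mxE /= /s /r; lra.
Qed.

Definition base_pt i : hyp3 R := sval (cid (sheet_iota3 (base_vec_sheet i))).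

Lemma base_ptE i : iota3 (base_pt i) = base_vec i.
Proof. exact: svalP (cid (sheet_iota3 (base_vec_sheet i))). Qed.

Lemma iota3_span (f g : 'M[R]_4) : (forall p, iota3 p *m f = iota3 p *m g) -> f = g.
Proof.
move=> fg; apply/row_matrixP => i; rewrite !rowE (base_coordP (delta_mx _ _)).
rewrite !mulmx_suml; apply: eq_bigr => j _.
by rewrite -!scalemxAl -base_ptE fg.
Qed.

Section Isometry.
Variable g : hyp3 R -> hyp3 R.
Hypothesis gI : hisometry g.

Lemma hisometry_hcosh p q : hcosh (g p) (g q) = hcosh p q.
Proof. by rewrite -!coshR_hdist; case: gI => _ ->. Qed.

Definition isometry_mx : 'M[R]_4 :=
  \matrix_(j < 4) \sum_(i < 4) base_coord (delta_mx 0 j) i *: iota3 (g (base_pt i)).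

Lemma isometry_mxE x : x *m isometry_mx =
  \sum_(i < 4) base_coord x i *: iota3 (g (base_pt i)).
Proof.
rewrite mulmx_sum_row; under eq_bigr do rewrite rowK scaler_sumr.
rewrite exchange_big /=; apply: eq_bigr => i _.
rewrite -[in RHS](_ : \sum_(j < 4) x 0 j * base_coord (delta_mx 0 j) i = base_coord x i).
  by rewrite scaler_suml; apply: eq_bigr => j _; rewrite scalerA.
rewrite sum4 /base_coord !mxE /=.
by case: i => -[|[|[|[|//]]]] i4 /=; lra.
Qed.

Lemma isometry_mx_lorentz x y : B (x *m isometry_mx) (y *m isometry_mx) = B x y.
Proof.
rewrite !isometry_mxE [in RHS](base_coordP x) [in RHS](base_coordP y).
rewrite !lorentz_suml; apply: eq_bigr => i _.
rewrite [LHS]lorentzC [RHS]lorentzC !lorentz_suml; apply: eq_bigr => j _.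
rewrite !lorentzE -!base_ptE; congr (_ * (_ * _)).
exact: hisometry_hcosh.
Qed.

Lemma isometry_mx_unit : isometry_mx \in unitmx.
Proof.
rewrite -row_free_unit -kermx_eq0; apply/eqP/row_matrixP => i; rewrite row0.
apply: lorentz_nondegenerate => y; rewrite -isometry_mx_lorentz.
have -> : row i (kermx isometry_mx) *m isometry_mx = 0.
  by rewrite -row_mul mulmx_ker row0.
by rewrite lorentz0l.
Qed.

(** Both sides have the same products with the images of the base points, because [g] preserves
    [hcosh]. These images span, as the matrix is invertible, and the form is nondegenerate. *)
Lemma isometry_mx_iota p : iota3 p *m isometry_mx = iota3 (g p).
Proof.
apply/eqP; rewrite -subr_eq0; apply/eqP/lorentz_nondegenerate => y.
rewrite -(mulmxKV isometry_mx_unit y); set z := y *m _.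
have eL : B (iota3 (g p)) (z *m isometry_mx) =
    \sum_(i < 4) base_coord z i * hcosh (g (base_pt i)) (g p).
  rewrite isometry_mxE lorentzC lorentz_suml; apply: eq_bigr => i _.
  by rewrite lorentzE.
have eR : B (iota3 p) z = \sum_(i < 4) base_coord z i * hcosh (base_pt i) p.
  rewrite {1}(base_coordP z) lorentzC lorentz_suml; apply: eq_bigr => i _.
  by rewrite lorentzE -base_ptE.
rewrite lorentzDl lorentzNl isometry_mx_lorentz eL eR.
apply/eqP; rewrite subr_eq0; apply/eqP/eq_bigr => i _.
by rewrite hisometry_hcosh.
Qed.

End Isometry.

End LinearExtension.

Section PointwiseContinuity.
Variables (R : realType) (T : topologicalType) (x : T).
Implicit Types f g : T -> R.

Lemma continuous_at_cst (a : R) : continuous_at x (fun _ : T => a).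
Proof. exact: cvg_cst. Qed.

Lemma continuous_at_add f g : continuous_at x f -> continuous_at x g ->
  continuous_at x (fun y => f y + g y).
Proof. exact: cvgD. Qed.

Lemma continuous_at_sub f g : continuous_at x f -> continuous_at x g ->
  continuous_at x (fun y => f y - g y).
Proof. exact: cvgB. Qed.

Lemma continuous_at_mul f g : continuous_at x f -> continuous_at x g ->
  continuous_at x (fun y => f y * g y).
Proof. exact: cvgM. Qed.

Lemma continuous_at_inv f : f x != 0 -> continuous_at x f ->
  continuous_at x (fun y => (f y)^-1).
Proof. exact: cvgV. Qed.

Lemma continuous_at_max f g : continuous_at x f -> continuous_at x g ->
  continuous_at x (fun y => Num.max (f y) (g y)).
Proof. by move=> cf cg; exact: (@continuous_max R T f g x cf cg). Qed.

Lemma continuous_at_sqrt f : continuous_at x f ->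
  continuous_at x (fun y => Num.sqrt (f y)).
Proof.
move=> cf; apply: (@continuous_comp _ _ _ f Num.sqrt) => //; exact: sqrt_continuous.
Qed.

End PointwiseContinuity.

(** * Metric and subspace topology of hyperbolic space *)

Section HyperbolicTopology.
Local Open Scope classical_set_scope.
Variable R : realType.
Local Notation V := 'rV[R]_4.
Local Notation B := (@lorentz R).
Implicit Types (x y z : V) (p q : hyp3 R) (r : R).

Definition hball p r : set (hyp3 R) := [set q | hdist p q < r].

Lemma set_val_continuous : continuous (fun p => set_val p : 'rV[R]_3).
Proof. exact: initial_continuous. Qed.

Lemma hcosh_continuous p : continuous (hcosh p).
Proof.
move=> q; pose a := set_val p : 'rV[R]_3.
pose d i := fun v : 'rV[R]_3 => a 0 i - v 0 i.
pose Phi (v : 'rV[R]_3) : R :=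
  1 + (d 0 v * d 0 v + d 1 v * d 1 v + d 2 v * d 2 v) * (2 * a 0 2 * v 0 2)^-1.
rewrite (_ : hcosh p = Phi \o (fun q => set_val q : 'rV[R]_3)); last first.
  by apply/funext => ?; rewrite hcoshE sum3 !expr2.
apply: continuous_comp; first exact: set_val_continuous.
have hp := height_gt0 p; have hq := height_gt0 q; rewrite /height in hp hq.
move: (set_val q : 'rV[R]_3) hq => w hw.
have c i : continuous_at w (fun v : 'rV[R]_3 => v 0 i) by exact: coord_continuous.
have cd i : continuous_at w (d i) by apply: continuous_at_sub; [exact: continuous_at_cst|].
have cd2 i : continuous_at w (fun v => d i v * d i v) by exact: continuous_at_mul.
apply: continuous_at_add; first exact: continuous_at_cst.
apply: continuous_at_mul; first by do !apply: continuous_at_add.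
apply: continuous_at_inv; first by rewrite !mulf_neq0 // lt0r_neq0.
by apply: continuous_at_mul; [exact: continuous_at_cst|].
Qed.

Lemma nbhs_hball_sub p (U : set (hyp3 R)) : nbhs p U ->
  exists2 r, 0 < r & hball p r `<=` U.
Proof.
move=> -[_ [[W oW <-] Wp WU]].
have [e /= e0 eW] : exists2 e : R, 0 < e & forall v : 'rV[R]_3,
    (forall i, `|set_val p 0 i - v 0 i| < e) -> W v.
  have /nbhs_ballP[e /= e0 eW] : nbhs (set_val p) W by apply: open_nbhs_nbhs.
  exists e => // v pv; apply: eW; split=> // i j; rewrite ord1; exact: pv.
have hp := height_gt0 p; rewrite /height in hp; set t := set_val p 0 2 in hp.
(* The bound [1] keeps the height [s] of [q] below [4 * t]; the squared Euclidean distance, less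
   than [eta * (2 * t * s)], is then below [eta * (8 * t ^+ 2)], hence below [e ^+ 2]. *)
pose eta := Num.min 1 (e ^+ 2 / (8 * t ^+ 2)).
have eta0 : 0 < eta by rewrite lt_min ltr01 divr_gt0 // ?mulr_gt0 ?exprn_gt0.
exists (arcosh (1 + eta)).
  rewrite lt_def arcosh_ge0 ?andbT; last by lra.
  apply/eqP => ar0; have := @cosh_arcosh R (1 + eta); rewrite ar0 coshR0; lra.
move=> q /=; rewrite /hball /= hdist_ltP ?arcosh_ge0 ?cosh_arcosh; try lra.
rewrite hcoshE ltrD2l -/t; set s := set_val q 0 2.
have hs := height_gt0 q; rewrite /height -/s in hs.
rewrite ltr_pdivrMr ?mulr_gt0 // => sum_lt.
have term i : (set_val p 0 i - set_val q 0 i) ^+ 2 < eta * (2 * t * s).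
  apply: le_lt_trans sum_lt; rewrite (bigD1 i) //= lerDl sumr_ge0 // => j _.
  exact: sqr_ge0.
have eta1 : eta <= 1 by rewrite ge_min lexx.
have eta2 : eta * (8 * t ^+ 2) <= e ^+ 2.
  by rewrite -ler_pdivlMr ?mulr_gt0 ?exprn_gt0 // ge_min lexx orbT.
have s4 : s <= 4 * t.
  have := term 2; rewrite -/t -/s => h2; rewrite leNgt; apply/negP => st.
  have : (t - s) ^+ 2 < 2 * t * s by apply: lt_le_trans h2 _; rewrite ler_piMl // !mulr_ge0 // ltW.
  nra.
apply/WU/eW => i; rewrite -(@ltr_pXn2r _ 2) ?nnegrE // ?ltW //.
rewrite real_normK ?num_real //; apply: lt_le_trans (term i) _.
apply: le_trans eta2; rewrite ler_pM2l //; nra.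
Qed.

Lemma nbhs_hball p r : 0 < r -> nbhs p (hball p r).
Proof.
move=> r0; have h : \forall q \near p, hcosh p q < coshR r.
  have lt1 : hcosh p p < coshR r.
    by rewrite hcoshxx -(coshR0 R) ltr_coshR ?nnegrE //; exact: ltW.
  exact: (@hcosh_continuous p p _ (lt_nbhsl lt1)).
near=> q; rewrite /hball /= hdist_ltP ?ltW //; near: q; exact: h.
Unshelve. all: by end_near. Qed.

Lemma hyp3_continuousP (T : topologicalType) (f : T -> hyp3 R) (x : T) :
  {for x, continuous f} <-> forall r, 0 < r -> \forall y \near x, hdist (f x) (f y) < r.
Proof.
split=> [cf r r0|h U /nbhs_hball_sub[r r0 rU]]; first exact: (cf _ (nbhs_hball _ r0)).
by have := h r r0; apply: filterS => y; exact: rU.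
Qed.

Lemma hisometry_continuous (g : hyp3 R -> hyp3 R) : hisometry g -> continuous g.
Proof.
move=> [_ gI] p; apply/hyp3_continuousP => r r0; near=> q; rewrite gI.
by near: q; exact: nbhs_hball.
Unshelve. all: by end_near. Qed.

End HyperbolicTopology.

(** * The deck group and the fundamental group *)

Section Discreteness.
Local Open Scope classical_set_scope.
Variable R : realType.
Local Notation V := 'rV[R]_4.
Local Notation B := (@lorentz R).
Local Notation H3 := (hyp3 R).
Implicit Types (x y z : V) (p q : H3) (r : R).

Lemma finite_set_inj (T : Type) (U : finType) (S : set T) (f : T -> U) :
  {in S &, injective f} -> finite_set S.
Proof. by move=> /inj_card_eq/eq_finite_set <-. Qed.

(** Rounding the coordinates down to multiples of [d] leaves finitely many cells, each containing at
    most one element of [S]. *)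
Lemma bounded_pigeonhole (T : Type) (I : finType) (S : set T) (F : T -> I -> R)
    (m d : R) : 0 < d -> (forall h i, S h -> `|F h i| <= m) ->
  (forall h h', S h -> S h' -> (forall i, `|F h i - F h' i| < d) -> h = h') ->
  finite_set S.
Proof.
move=> d0 Fm FS; pose c h i := Num.truncn ((F h i + m) / d).
pose N := Num.truncn ((m + m) / d).
pose f h := [ffun i => inord (c h i) : 'I_N.+1].
have cN h i : S h -> (c h i < N.+1)%N.
  move=> /(Fm _ i); rewrite ler_norml => /andP[F1 F2]; rewrite ltnS.
  by apply: Num.Theory.le_truncn; rewrite ler_pM2r ?invr_gt0 // lerD2r.
apply: (@finite_set_inj _ _ S f) => h h' /set_mem Sh /set_mem Sh' fh.
apply: FS => // i; have := congr1 (fun k : {ffun I -> 'I_N.+1} => nat_of_ord (k i)) fh.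
rewrite /f !ffunE /= !inordK ?cN // => ce.
have nn h0 : S h0 -> 0 <= (F h0 i + m) / d.
  move=> /(Fm _ i); rewrite ler_norml => /andP[F1 F2].
  by apply: divr_ge0; [lra|exact: ltW].
have /andP[a1 a2] := Num.Theory.truncn_itv (nn _ Sh).
have /andP[b1 b2] := Num.Theory.truncn_itv (nn _ Sh').
rewrite -/(c h i) in a1 a2; rewrite -/(c h' i) -ce in b1 b2.
rewrite ler_pdivlMr // in a1; rewrite ltr_pdivrMr // in a2.
rewrite ler_pdivlMr // in b1; rewrite ltr_pdivrMr // in b2.
rewrite -natr1 mulrDl mul1r in a2 b2.
by rewrite ltr_norml; lra.
Qed.

(** By linearity of isometries, [hcosh p (h p)] is the combination of the values [hcosh p (h b)] at
    the four base points [b], with the base coordinates of [p] as coefficients. *)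
Lemma isometry_near_id p r : 0 < r -> exists2 eta : R, 0 < eta &
  forall h : H3 -> H3, hisometry h ->
  (forall i, hdist (base_pt R i) (h (base_pt R i)) < eta) -> hdist p (h p) < r.
Proof.
move=> r0; have e0 : 0 < coshR r - 1.
  by rewrite subr_gt0 -(coshR0 R) ltr_coshR ?nnegrE // ltW.
pose c i := base_coord (iota3 p) i.
pose e i := (coshR r - 1) / (4 * (1 + `|c i|)).
have c1 i : 0 < 1 + `|c i| by rewrite ltr_wpDr.
have ei i : 0 < e i by rewrite divr_gt0 ?mulr_gt0.
have /choice[eta etaP] : forall i, exists eta : R, 0 < eta /\ forall q,
    hdist (base_pt R i) q < eta -> `|hcosh p (base_pt R i) - hcosh p q| < e i.
  move=> i; have /nbhs_hball_sub[eta eta0 etaU] :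
      nbhs (base_pt R i) [set q | `|hcosh p (base_pt R i) - hcosh p q| < e i].
    have [] := @cvgrPdist_lt _ _ _ (nbhs (base_pt R i)) _ (hcosh p) (hcosh p (base_pt R i)).
    by move=> h _; apply: h => //; exact: hcosh_continuous.
  by exists eta; split.
exists (\big[Num.min/1]_(i < 4) eta i).
  by apply: lt_bigmin => // i _; have [] := etaP i.
move=> h hI hb; rewrite hdist_ltP ?ltW //.
have -> : hcosh p (h p) = \sum_(i < 4) c i * hcosh p (h (base_pt R i)).
  rewrite /hcosh -isometry_mx_iota // isometry_mxE lorentzC lorentz_suml.
  by apply: eq_bigr => i _; rewrite lorentzE lorentzC.
have e1 : \sum_(i < 4) c i * hcosh p (base_pt R i) = 1.
  have [<- _] := iota3_sheet p; rewrite {2}(base_coordP (iota3 p)) lorentzC lorentz_suml.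
  by apply: eq_bigr => i _; rewrite lorentzE lorentzC /hcosh base_ptE.
suff : \sum_(i < 4) c i * hcosh p (h (base_pt R i)) -
    \sum_(i < 4) c i * hcosh p (base_pt R i) < coshR r - 1 by rewrite e1 ltrD2r.
rewrite -sumrB.
have -> : coshR r - 1 = \sum_(i < 4) (coshR r - 1) / 4 by rewrite sum4; lra.
apply: ltr_sum => [|i _]; first by apply/hasP; exists 0 => //; exact: mem_index_enum.
rewrite -mulrBr; apply: le_lt_trans (ler_norm _) _; rewrite normrM distrC.
have /(etaP i).2 hi : hdist (base_pt R i) (h (base_pt R i)) < eta i.
  by apply: lt_le_trans (hb i) _; exact: bigmin_le_cond.
have ci : `|c i| * e i < (coshR r - 1) / 4.
  have -> : `|c i| * e i = (coshR r - 1) / 4 * (`|c i| / (1 + `|c i|)).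
    by rewrite /e; field; rewrite lt0r_neq0.
  by rewrite gtr_pMr ?divr_gt0 // ltr_pdivrMr // mul1r; lra.
by apply: le_lt_trans ci; rewrite ler_wpM2l // ltW.
Qed.

Lemma iota3_bound p (m : R) : hcosh (base_pt R 0) p <= m ->
  forall j, `|iota3 p 0 j| <= 2 * m.
Proof.
have [pp v0] := iota3_sheet p; rewrite /hcosh base_ptE.
move: (iota3 p) pp v0 => x; rewrite /lorentz /base_vec /= !vec4E => pp v0 hm.
have [a2 b2'] := (sqr_ge0 (x 0 0), sqr_ge0 (x 0 1)).
have u0 : 0 < x 0 3 by rewrite -(pmulr_rgt0 _ v0); lra.
have s2 := sqr_ge0 (x 0 2 - x 0 3); have m0 : 0 <= m by lra.
have sm : ((x 0 2 + x 0 3) / 2) ^+ 2 <= m ^+ 2 by rewrite ler_pXn2r ?nnegrE //; lra.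
have sq (a : R) : a ^+ 2 <= m ^+ 2 -> `|a| <= 2 * m.
  move=> am; have : `|a| <= m by rewrite -(@ler_pXn2r _ 2) ?nnegrE // real_normK ?num_real.
  by lra.
have b2 : `|x 0 2| <= 2 * m by rewrite gtr0_norm //; lra.
have b3 : `|x 0 3| <= 2 * m by rewrite gtr0_norm //; lra.
have b0 : `|x 0 0| <= 2 * m by apply: sq; lra.
have b1 : `|x 0 1| <= 2 * m by apply: sq; lra.
case=> -[|[|[|[|//]]]] i4.
- by rewrite (_ : Ordinal i4 = 0) //; exact: val_inj.
- by rewrite (_ : Ordinal i4 = 1) //; exact: val_inj.
- by rewrite (_ : Ordinal i4 = 2) //; exact: val_inj.
- by rewrite (_ : Ordinal i4 = 3) //; exact: val_inj.
Qed.

Lemma iota3_close p q (d : R) : 0 < d ->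
  (forall j, `|iota3 p 0 j - iota3 q 0 j| < d) -> hcosh p q <= 1 + 2 * d ^+ 2.
Proof.
move=> d0 pq; have [[pp _] [qq _]] := (iota3_sheet p, iota3_sheet q).
have e : hcosh p q = 1 - B (iota3 p - iota3 q) (iota3 p - iota3 q) / 2.
  rewrite !lorentzE pp qq (lorentzC (iota3 q)) -/(hcosh p q); lra.
have BB (x y : V) : B (x - y) (x - y) = (x 0 2 - y 0 2) * (x 0 3 - y 0 3) -
    (x 0 0 - y 0 0) * (x 0 0 - y 0 0) - (x 0 1 - y 0 1) * (x 0 1 - y 0 1).
  by rewrite /lorentz !mxE; lra.
rewrite e BB; have := (pq 0, pq 1, pq 2, pq 3).
set a := iota3 p 0 0 - _; set b := iota3 p 0 1 - _; set c := iota3 p 0 2 - _.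
set f := iota3 p 0 3 - _.
rewrite !ltr_norml => -[[[/andP[a1 a2] /andP[b1 b2]] /andP[c1 c2]] /andP[f1 f2]].
have : a * a < d ^+ 2 by nra.
have : b * b < d ^+ 2 by nra.
have : - (c * f) <= d ^+ 2 by nra.
have := sqr_ge0 d; lra.
Qed.

Variable M : hyperbolic_3manifold R.

(** The sets [A eta] generate a filter that converges to the identity in the compact-open topology,
    by [isometry_near_id] and compactness; discreteness isolates the identity in the deck group. *)
Lemma deck_near_id : exists2 eta : R, 0 < eta & forall h, deck M h ->
  (forall i, hdist (base_pt R i) (h (base_pt R i)) < eta) -> h = id.
Proof.
pose A (eta : R) : set (H3 -> H3) := [set h | hisometry h /\
  forall i, hdist (base_pt R i) (h (base_pt R i)) < eta].
pose F : set_system {compact-open, H3 -> H3} := filter_from [set eta : R | 0 < eta] A.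
have FF : Filter F.
  apply: filter_from_filter; first by exists 1 => /=.
  move=> a b /= a0 b0; exists (Num.min a b); first by rewrite /= lt_min a0.
  by move=> h [hI hab]; split; split=> // i; have := hab i; rewrite lt_min => /andP[].
have Fid : F --> (id : {compact-open, H3 -> H3}).
  apply/compact_open_cvgP => K O cK oO KO.
  have := (compact_near_coveringP K).1 cK _ F (fun (h : H3 -> H3) (u : H3) => O (h u)) FF.
  case=> [x Kx|eta /= eta0 etaP]; last first.
    by exists eta => // h Ah _ [z Kz <-]; exact: (etaP h Ah z Kz).
  have /nbhs_hball_sub[r r0 rO] : nbhs x O.
    by apply: open_nbhs_nbhs; split=> //; apply: KO; exists x.
  have r2 : 0 < r / 2 by rewrite divr_gt0.
  have [eta eta0 etaP] := isometry_near_id x r2.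
  exists (hball x (r / 2), A eta); first by split; [exact: nbhs_hball|exists eta].
  move=> [x' h] /= [xx' [hI /(etaP _ hI) xh]]; apply: rO.
  rewrite /hball /= in xx' *; apply: le_lt_trans (hdist_triangle (h x) _ _) _.
  case: hI => _ ->; lra.
have [_ [W Wid WM]] := deck_discrete (deck_id M).
have [eta /= eta0 etaW] := Fid _ Wid.
exists eta => // h Mh hb; suff : [set id] h by [].
by rewrite -WM; split=> //; apply: etaW; split=> //; exact: (deck_isometry Mh).
Qed.

(** The sixteen coordinates of the images of the base points are bounded for these [h]. If they
    nearly agree for [h] and [h'], then [h^-1 h'] almost fixes the base points and is the
    identity. *)
Lemma deck_proper p r : finite_set [set h | deck M h /\ hdist p (h p) <= r].
Proof.
have [eta eta0 etaP] := deck_near_id.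
pose r' i := hdist (base_pt R 0) p + r + hdist p (base_pt R i).
pose m := 2 * \sum_(i < 4) coshR (Num.max 0 (r' i)).
pose d := Num.sqrt ((coshR eta - 1) / 4).
have ce : 0 < coshR eta - 1.
  by rewrite subr_gt0 -(coshR0 R) ltr_coshR ?nnegrE // ltW.
have d0 : 0 < d by rewrite sqrtr_gt0 divr_gt0.
have dE : d ^+ 2 = (coshR eta - 1) / 4 by rewrite sqr_sqrtr // ltW // divr_gt0.
apply: (@bounded_pigeonhole _ ('I_4 * 'I_4)%type _
   (fun h ij => iota3 (h (base_pt R ij.1)) 0 ij.2) m d) => //.
  move=> h [i j] [Mh hp] /=; apply: le_trans (@iota3_bound _ (coshR (Num.max 0 (r' i))) _ _) _.
    have hI := deck_isometry Mh; rewrite -hdist_leP ?le_max ?lexx //; apply/orP; right.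
    apply: le_trans (hdist_triangle p _ _) _; rewrite /r' -addrA lerD2l.
    apply: le_trans (hdist_triangle (h p) _ _) _; case: hI => _ ->; lra.
  rewrite /m ler_pM2l // (bigD1 i) //= lerDl sumr_ge0 // => k _.
  by rewrite ltW // coshR_gt0.
move=> h h' [Mh hp] [Mh' hp'] hh'.
have [g [Mg gK Kg]] := deck_inv Mh.
suff gh : g \o h' = id by apply/funext => z; rewrite -[RHS]Kg -/((g \o h') z) gh.
apply: etaP => [|i]; first exact: deck_comp.
have [_ hD] := deck_isometry Mh; rewrite -hD /= Kg hdist_ltP ?(ltW eta0) //.
have := @iota3_close (h (base_pt R i)) (h' (base_pt R i)) _ d0 (fun j => hh' (i, j)); rewrite dE /=; lra.
Qed.

Lemma deck_iter h n : deck M h -> deck M (iter n h).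
Proof.
move=> Mh; elim: n => [|n IH]; first exact: deck_id.
exact: (deck_comp Mh IH).
Qed.

(** All iterates of [h] fix [p], so by properness two of them coincide and [h] would have finite
    order. *)
Lemma deck_free h p : deck M h -> h p = p -> h = id.
Proof.
move=> Mh hp; have fs := deck_proper p 0.
have hn n : iter n h p = p by elim: n => //= n ->.
have hinj : injective h by have [g [_ /can_inj]] := deck_inv Mh.
have [a [b [ab hab]]] : exists a b, (a < b)%N /\ iter a h = iter b h.
  apply: contrapT => no; apply: (infinite_nat : ~ finite_set [set: nat]).
  have inj : {in [set: nat] &, injective (fun n => iter n h)}.
    move=> a b _ _ e; apply/eqP; apply: contrapT => /negP; rewrite neq_ltn => /orP[] ab.
      by apply: no; exists a, b.
    by apply: no; exists b, a.
  rewrite -(eq_finite_set (inj_card_eq inj)); apply: sub_finite_set fs => _ [n _ <-] /=.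
  by split; [exact: deck_iter|rewrite hn hdistxx].
apply/funext => z; apply: (deck_torsion_free Mh (n := (b - a)%N)); first by rewrite subn_gt0.
move=> y; have iinj : injective (iter a h).
  by elim: (a) => //= n IH u v /hinj/IH.
apply: iinj; rewrite -iterD subnKC; last exact: ltnW.
by rewrite hab.
Qed.

End Discreteness.

(** * Covering space theory of the quotient map *)

Section Covering.
Local Open Scope classical_set_scope.
Variables (R : realType) (M : hyperbolic_3manifold R).
Local Notation H3 := (hyp3 R).
Local Notation I := (unit_itv R).
Implicit Types (p q : H3) (r : R).

Definition prj p : points M := (\pi_(points M) p)%qT.

Lemma prjP p q : prj p = prj q <-> exists2 g, deck M g & g p = q.
Proof.
have e := @eqmodP _ (same_orbit_equiv M) p q.
by split=> [/e/asboolP//|h]; apply/e/asboolP.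
Qed.

Lemma finite_pos_lower (T : Type) (S : set T) (f : T -> R) : finite_set S ->
  (forall s, S s -> 0 < f s) -> exists2 r, 0 < r & forall s, S s -> r <= f s.
Proof.
move=> /(finite_image f)/finite_seqP[l lE] f0.
have [r r0 rl] : exists2 r, 0 < r & {in l, forall u, r <= u}.
- have l0 : {in l, forall u, 0 < u}.
    by move=> u ul; have : [set` l] u by []; rewrite -lE => -[s Ss <-]; exact: f0.
  elim: (l) l0 => [|u l' IH] l0; first by exists 1.
  have [|r r0 rl] := IH; first by move=> v vl; apply: l0; rewrite in_cons vl orbT.
  exists (Num.min u r); first by rewrite lt_min r0 l0 // mem_head.
  move=> v; rewrite in_cons ge_min => /orP[/eqP->|/rl->]; by rewrite ?lexx ?orbT.
by exists r => // s Ss; apply: rl; have : [set` l] (f s) by rewrite -lE; exists s.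
Qed.

Lemma prj_deck g p : deck M g -> prj (g p) = prj p.
Proof. by move=> Mg; apply/esym/prjP; exists g. Qed.

Lemma prj_repr (z : points M) : exists p, prj p = z.
Proof. by exists (repr z); rewrite /prj reprK. Qed.

Lemma prj_continuous : continuous prj.
Proof. exact: pi_continuous. Qed.

Lemma prj_open p (U : set H3) : nbhs p U -> nbhs (prj p) (prj @` U).
Proof.
move=> Up; have oW : open (prj @` U^°).
  rewrite /open /= /quotient_open openE => q [q' Uq' qq'].
  have /prjP[g Mg gq] := qq'; have [h [Mh gh hg]] := deck_inv Mg.
  have Uh : nbhs q (h @^-1` U^°).
    apply: (hisometry_continuous (deck_isometry Mh)).
    rewrite -gq gh; exact: open_nbhs_nbhs (conj (open_interior U) Uq').
  have [r r0 rU] := nbhs_hball_sub Uh.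
  have := nbhs_hball q r0; apply: filterS => z /rU Uhz.
  by exists (h z) => //; exact: prj_deck.
have Wp : (prj @` U^°) (prj p) by exists p => //; exact: Up.
have : nbhs (prj p) (prj @` U^°) by apply: open_nbhs_nbhs.
by apply: filterS; apply: image_subset; exact: interior_subset.
Qed.

Lemma deck_radius p : exists2 r, 0 < r & forall g, deck M g -> g <> id -> r <= hdist p (g p).
Proof.
have fin : finite_set [set g | (deck M g /\ hdist p (g p) <= 1) /\ g <> id].
  by apply: sub_finite_set (deck_proper M p 1) => g [].
have [|r r0 rP] := @finite_pos_lower _ _ (fun g => hdist p (g p)) fin.
  move=> g [[Mg _] gid]; rewrite lt_def hdist_ge0 andbT; apply/eqP => e.
  by apply: gid; apply: (deck_free (p := p) Mg); rewrite -(hdist_eq0 e).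
exists (Num.min 1 r) => [|g Mg gid]; first by rewrite lt_min ltr01.
rewrite ge_min; have [g1|g1] := leP 1 (hdist p (g p)) => //=.
by apply: rP; split=> //; split=> //; exact: ltW.
Qed.

(** Two short steps from [p] with endpoints in one orbit have the same endpoint; the factor [4]
    leaves room for [p] and the endpoint to vary, as [step_continuous] requires. *)
Definition short p q := exists2 r, hdist p q < r &
  forall g, deck M g -> g <> id -> 4 * r <= hdist p (g p).

Definition near_pts (y z : points M) := exists p q, [/\ prj p = y, prj q = z & short p q].

Lemma short_deck g p q : deck M g -> short p q -> short (g p) (g q).
Proof.
move=> Mg [r pq rP]; have [_ gI] := deck_isometry Mg; exists r; first by rewrite gI.
move=> h Mh hid; have [g' [Mg' gK g'K]] := deck_inv Mg.
have -> : hdist (g p) (h (g p)) = hdist p ((g' \o (h \o g)) p).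
  by rewrite -(gI p) /= g'K.
apply: rP; first exact: (deck_comp Mg' (deck_comp Mh Mg)).
move=> e; apply: hid; apply/funext => z.
have := congr1 (fun f => g (f (g' z))) e; by rewrite /= !g'K.
Qed.

Lemma near_pts_lift p z : near_pts (prj p) z -> exists q, prj q = z /\ short p q.
Proof.
move=> [p1 [q1 [/prjP[g Mg <-] <- s]]]; exists (g q1).
by split; [exact: prj_deck|exact: short_deck].
Qed.

Definition step p z : H3 := xget p [set q | prj q = z /\ short p q].

Lemma stepP p z : near_pts (prj p) z -> prj (step p z) = z /\ short p (step p z).
Proof.
by move=> /near_pts_lift[q hq]; have := @xgetI _ p [set q | prj q = z /\ short p q] _ hq.
Qed.

Lemma step_continuous (T : topologicalType) (k : T -> H3) (f : T -> points M) (y0 : T) :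
  continuous_at y0 k -> continuous_at y0 f -> (forall y, near_pts (prj (k y)) (f y)) ->
  continuous_at y0 (fun y => step (k y) (f y)).
Proof.
move=> ck cf kf; apply/hyp3_continuousP => e e0.
have [fq0 [r qr rP]] := stepP (kf y0); set q0 := step _ _ in fq0 qr *.
have r0 : 0 < r by apply: le_lt_trans qr; exact: hdist_ge0.
pose d := Num.min e (r / 2); have d0 : 0 < d by rewrite lt_min e0 divr_gt0.
have de : d <= e by rewrite ge_min lexx.
have dr : d <= r / 2 by rewrite ge_min lexx orbT.
near=> y.
have ky : hdist (k y0) (k y) < d by near: y; exact: (hyp3_continuousP _ _).1.
have [q qq0 qf] : (prj @` hball q0 d) (f y).
  by near: y; apply: cf; rewrite -fq0; apply: prj_open; exact: nbhs_hball.
have [fq1 [r1 qr1 rP1]] := stepP (kf y); set q1 := step _ _ in fq1 qr1 *.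
have /prjP[g Mg gq] : prj q = prj q1 by rewrite qf.
have [gid|gid] := pselect (g = id); first by rewrite -gq gid; exact: lt_le_trans qq0 de.
exfalso; have [_ gI] := deck_isometry Mg.
have := rP g Mg gid; have := rP1 g Mg gid.
have T1 := hdist_triangle (g (k y0)) (k y) (g (k y)); rewrite gI in T1.
have T2 := hdist_triangle (k y0) (k y) (g (k y0)).
have T3 := hdist_triangle (k y) (k y0) (g (k y0)).
have T4 := hdist_triangle q1 (k y) (g (k y0)); rewrite -{2}gq gI in T4.
have T5 := hdist_triangle q0 q (k y0).
rewrite /hball /= in qq0; rewrite (hdistC q q0) (hdistC q0 (k y0)) in T5.
rewrite (hdistC (k y) (k y0)) in T2.
move: qr qr1 ky qq0 r0 dr T1 T2 T3 T4 T5.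
by do !move: (hdist _ _) => ?; lra.
Unshelve. all: by end_near. Qed.

Lemma near_pts_local (T : topologicalType) (f : T -> points M) (x : T) :
  continuous_at x f -> exists2 A, nbhs x A & forall y y', A y -> A y' -> near_pts (f y) (f y').
Proof.
move=> cf; have [p pf] := prj_repr (f x); have [r r0 rP] := deck_radius p.
pose u := r / 10; have u0 : 0 < u by rewrite divr_gt0.
exists (f @^-1` (prj @` hball p u)).
  by apply: cf; rewrite -pf; apply: prj_open; exact: nbhs_hball.
move=> y y' [q pq qf] [q' pq' qf']; exists q, q'; split=> //.
rewrite /hball /= in pq pq'; exists (2 * u).
  have := hdist_triangle p q q'; rewrite (hdistC q p); lra.
move=> g Mg gid; have := rP g Mg gid; have [_ gI] := deck_isometry Mg.
have T1 := hdist_triangle q p (g p).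
have T2 := hdist_triangle (g q) q (g p); rewrite gI (hdistC q p) in T2.
by move: pq T1 T2; rewrite /u; do !move: (hdist _ _) => ?; lra.
Qed.

(** Compactness of [Y] times the interval makes one subdivision serve all [y], so that families of
    paths can be lifted at once. *)
Lemma uniform_subdivision (Y : topologicalType) (f : Y * R -> points M) :
  compact [set: Y] -> continuous f -> exists2 N, (0 < N)%N &
  forall y k, (k < N)%N -> near_pts (f (y, k%:R / N%:R)) (f (y, k.+1%:R / N%:R)).
Proof.
move=> cY cf; pose K := [set: Y] `*` `[0, 1] : set (Y * R).
have cK : compact K by apply: compact_setX => //; exact: segment_compact.
have := (compact_near_coveringP K).1 cK nat (nbhs \oo)
  (fun n z => near_pts (f z) (f (z.1, z.2 + n.+1%:R^-1))) _.
case=> [[y t] _|N _ NP].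
  have [A [[A1 A2] /= [A1y /nbhs_ballP[e /= e0 eA]] AP] fA] := near_pts_local (cf (y, t)).
  have e2 : 0 < e / 2 by rewrite divr_gt0.
  have [N _ NP] := near_infty_natSinv_lt (PosNum e2).
  exists (A1 `*` ball t (e / 2), [set n | (N <= n)%N]).
    split; last by exists N.
    by exists (A1, ball t (e / 2)) => //; split=> //; exact: nbhsx_ballx.
  move=> [[y' t'] n] /= [[A1y' tt'] Nn]; rewrite /ball /= in tt'.
  have n2 : (0 : R) < n.+1%:R^-1 < e / 2 by rewrite invr_gt0 ltr0n /=; exact: NP.
  move: n2; set v := n.+1%:R^-1 => /andP[n0 n2]; apply: fA; apply: AP; split=> //=; apply: eA; rewrite /ball /=.
    by apply: lt_trans tt' _; lra.
  rewrite -/v opprD addrA; apply: le_lt_trans (ler_normB _ _) _.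
  by rewrite (gtr0_norm n0); move: v n0 n2 => v; lra.
exists N.+1 => // y k kN; have := NP N (leqnn N) (y, k%:R / N.+1%:R).
rewrite /= -[X in _ + X]mul1r -mulrDl natr1; apply; split=> //=.
rewrite in_itv /= divr_ge0 //= ler_pdivrMr ?ltr0n // mul1r ler_nat; exact: ltnW.
Qed.

(** The lift proceeds in [N] short steps for all [y] simultaneously; only the endpoint at time [1]
    is kept, which is the form needed for paths and for homotopies. *)
Lemma lift_exists (Y : topologicalType) (f : Y * R -> points M) (y0 : Y) p0 :
  compact [set: Y] -> continuous f -> (forall y, f (y, 0) = prj p0) ->
  exists L : Y -> H3, continuous L /\ forall y, prj (L y) = f (y, 1).
Proof.
move=> cY cf f0; have [N N0 NP] := uniform_subdivision cY cf.
pose L := fix L k : Y -> H3 := if k is k'.+1 then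
  fun y => step (L k' y) (f (y, k'.+1%:R / N%:R)) else fun=> p0.
have LP k : (k <= N)%N -> continuous (L k) /\ forall y, prj (L k y) = f (y, k%:R / N%:R).
  elim: k => [_|k IH kN].
    by split=> [|y]; [exact: cst_continuous|rewrite mul0r f0].
  have [cL pL] := IH (ltnW kN).
  have cfk (c : R) : continuous (fun y => f (y, c)).
    have ci : continuous (fun y : Y => y) by move=> y; exact: cvg_id.
    have cc : continuous (fun y : Y => c) by move=> y; exact: cvg_cst.
    move=> y; apply: (@continuous_comp _ _ _ (fun y => (y, c)) f); last exact: cf.
    exact: (cvg_pair (ci y) (cc y)).
  split=> [y|y] /=.
    by apply: step_continuous => [||y']; [exact: cL|exact: cfk|rewrite pL; exact: NP].
  by have [] := stepP (p := L k y) (z := f (y, k.+1%:R / N%:R)) _; rewrite // pL; exact: NP.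
have [cL pL] := LP N (leqnn N); exists (L N); split=> // y.
by rewrite pL divff // pnatr_eq0 -lt0n.
Qed.

Lemma based_lift_exists (Y : topologicalType) (f : Y * R -> points M) (y0 : Y) p0 :
  compact [set: Y] -> continuous f -> (forall y, f (y, 0) = prj p0) ->
  f (y0, 1) = prj p0 ->
  exists L : Y -> H3, [/\ continuous L, forall y, prj (L y) = f (y, 1) & L y0 = p0].
Proof.
move=> cY cf f0 f1; have [L [cL pL]] := lift_exists y0 cY cf f0.
have /prjP[g Mg gL] : prj (L y0) = prj p0 by rewrite pL.
exists (g \o L); split=> // [y|y].
  by apply: continuous_comp; [exact: cL|exact: hisometry_continuous (deck_isometry Mg) _].
by rewrite /= prj_deck.
Qed.

(** The set where the lifts agree is open, because nontrivial deck transformations have displacement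
    bounded below at a point, and it is closed by continuity. *)
Lemma lift_unique (Y : topologicalType) (L L' : Y -> H3) (y0 : Y) :
  connected [set: Y] -> continuous L -> continuous L' ->
  (forall y, prj (L y) = prj (L' y)) -> L y0 = L' y0 -> L =1 L'.
Proof.
move=> conY cL cL' pL LL0; pose A := [set y | L y = L' y].
suff AT : A = [set: Y] by move=> y; have : A y by rewrite AT.
have nearL y e : 0 < e -> \forall z \near y, hdist (L y) (L z) < e.
  by move=> e0; exact: (hyp3_continuousP _ _).1 (cL y) _ e0.
have nearL' y e : 0 < e -> \forall z \near y, hdist (L' y) (L' z) < e.
  by move=> e0; exact: (hyp3_continuousP _ _).1 (cL' y) _ e0.
apply: conY; first by exists y0.
  exists A; rewrite ?setTI // openE => y Ay.
  have [r r0 rP] := deck_radius (L y); have r2 : 0 < r / 4 by rewrite divr_gt0.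
  near=> z.
  have z1 : hdist (L y) (L z) < r / 4 by near: z; exact: nearL.
  have z2 : hdist (L' y) (L' z) < r / 4 by near: z; exact: nearL'.
  have /prjP[g Mg gL] := pL z; have [gid|gid] := pselect (g = id).
    by rewrite /A /= -gL gid.
  exfalso; have [_ gI] := deck_isometry Mg; have := rP g Mg gid.
  have := hdist_triangle (L' z) (L y) (g (L y)).
  rewrite -[in hdist (L' z) _]gL gI (hdistC (L z)); rewrite -Ay in z2.
  by move: z1 z2; do !move: (hdist _ _) => ?; lra.
exists A; rewrite ?setTI // -[A]setCK; apply: open_closedC; rewrite openE => y nAy.
have d0 : 0 < hdist (L y) (L' y).
  by rewrite lt_def hdist_ge0 andbT; apply/eqP => /hdist_eq0.
have d2 : 0 < hdist (L y) (L' y) / 2 by rewrite divr_gt0.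
near=> z => Az.
have z1 : hdist (L y) (L z) < hdist (L y) (L' y) / 2 by near: z; exact: nearL.
have z2 : hdist (L' y) (L' z) < hdist (L y) (L' y) / 2 by near: z; exact: nearL'.
have := hdist_triangle (L z) (L y) (L' y).
rewrite [in X in _ <= _ + X]Az (hdistC (L' z)).
by move: z1 z2; do !move: (hdist _ _) => ?; lra.
Unshelve. all: by end_near. Qed.

End Covering.

(** * Loop classes and deck transformations *)

Section DeckAction.
Local Open Scope classical_set_scope.
Variables (R : realType).
Local Notation H3 := (hyp3 R).
Local Notation I := (unit_itv R).
Implicit Types (p q : H3) (s t : I).

Lemma unit_itv_image : clamp (R := R) @` `[0, 1] = [set: I].
Proof.
apply/seteqP; split=> // s _; exists (uval s); last exact: clampK.
by rewrite /= in_itv /= uval_itv.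
Qed.

Lemma unit_itv_compact : compact [set: I].
Proof.
rewrite -unit_itv_image; apply: continuous_compact; last exact: segment_compact.
exact/continuous_subspaceT/clamp_continuous.
Qed.

Lemma unit_itv_connected : connected [set: I].
Proof.
rewrite -unit_itv_image; apply: connected_continuous_connected; first exact: segment_connected.
exact/continuous_subspaceT/clamp_continuous.
Qed.

Lemma hconv_proof p q t :
  ((1 - uval t) *: set_val p + uval t *: set_val q : 'rV[R]_3) \in @upper_half_space R.
Proof.
have [hp hq] := (height_gt0 p, height_gt0 q); rewrite /height in hp hq.
have /andP[t0 t1] := uval_itv t; rewrite inE /upper_half_space /= !mxE.
have [t0'|t0'] := eqVneq (uval t) 0; first by rewrite t0' subr0 mul1r mul0r addr0.
apply: ltr_wpDl; last by rewrite mulr_gt0 // lt_def t0'.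
by rewrite mulr_ge0 ?subr_ge0 // ltW.
Qed.

(** A Euclidean segment of the half-space, not a geodesic: its role is to contract differences of
    paths with common endpoints. *)
Definition hconv p q t : H3 :=
  exist (fun v : 'rV[R]_3 => v \in @upper_half_space R) _ (hconv_proof p q t).

Lemma hconv_zero p q : hconv p q zero = p.
Proof.
by apply: val_inj; rewrite /= uval0 subr0 scale1r scale0r addr0.
Qed.

Lemma hconv_one p q : hconv p q one = q.
Proof.
by apply: val_inj; rewrite /= uval1 subrr scale1r scale0r add0r.
Qed.

Lemma hconvxx p t : hconv p p t = p.
Proof. by apply: val_inj; rewrite /= -scalerDl subrK scale1r. Qed.

Lemma hconv_continuous (T : topologicalType) (k l : T -> H3) (u : T -> I) :
  continuous k -> continuous l -> continuous u ->
  continuous (fun y => hconv (k y) (l y) (u y)).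
Proof.
move=> ck cl cu; apply: continuous_comp_initial => y.
have cuv : continuous_at y (fun y => uval (u y)).
  by apply: continuous_comp; [exact: cu|exact: uval_continuous].
have cv (m : T -> H3) : continuous m -> continuous_at y (fun y => set_val (m y) : 'rV[R]_3).
  by move=> cm; apply: (@continuous_comp _ _ _ m); [exact: cm|exact: set_val_continuous].
have c1 : continuous_at y (fun y => 1 - uval (u y)).
  by apply: continuous_at_sub => //; exact: continuous_at_cst.
exact: (cvgD (cvgZ c1 (cv _ ck)) (cvgZ cuv (cv _ cl))).
Qed.

Variables (M : hyperbolic_3manifold R) (x : points M) (p0 : H3).
Hypothesis p0x : prj M p0 = x.
Local Notation P := (prj M).
Local Notation loop := {path I from x to x in points M}.
Local Notation G := (fundamental_group R x).

(* [a] is the class of the projection of a path from [p0] to [g p0]. *)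
Definition class_deck (a : G) (g : H3 -> H3) := deck M g /\
  exists (f : loop) (k : I -> H3), [/\ pi1_class f = a, continuous k,
    forall s, P (k s) = f s, k zero = p0 & k one = g p0].

Lemma lift_homotopic (f f' : loop) (k k' : I -> H3) : continuous k -> continuous k' ->
  (forall s, P (k s) = f s) -> (forall s, P (k' s) = f' s) ->
  k zero = k' zero -> k one = k' one -> homotopic f f'.
Proof.
move=> ck ck' kf kf' e0 e1; apply/asboolP.
exists (fun z => P (hconv (k z.2) (k' z.2) z.1)); split.
- move=> z; apply: (@continuous_comp _ _ _ (fun z : I * I => hconv (k z.2) (k' z.2) z.1)).
    apply: hconv_continuous; last exact: fst_continuous.
    + by move=> u; apply: continuous_comp; [exact: snd_continuous|exact: ck].
    + by move=> u; apply: continuous_comp; [exact: snd_continuous|exact: ck'].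
  exact: prj_continuous.
- by move=> s; rewrite /= hconv_zero.
- by move=> s; rewrite /= hconv_one.
- by move=> t; rewrite /= -e0 hconvxx kf path_zero.
- by move=> t; rewrite /= -e1 hconvxx kf path_one.
Qed.

Lemma class_deck_unique a a' g : class_deck a g -> class_deck a' g -> a = a'.
Proof.
move=> [_ [f [k [<- ck kf k0 k1]]]] [_ [f' [k' [<- ck' kf' k0' k1']]]].
by apply/pi1_classP/(lift_homotopic ck ck') => //; rewrite ?k0 ?k1.
Qed.

Lemma class_deck_loop g : deck M g -> exists a, class_deck a g.
Proof.
move=> Mg; pose k s := hconv p0 (g p0) s.
have ck : continuous k.
  by apply: hconv_continuous; [exact: cst_continuous|exact: cst_continuous|move=> ?; exact: cvg_id].
have cf : continuous (P \o k).
  by move=> s; apply: continuous_comp; [exact: ck|exact: prj_continuous].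
have f0 : (P \o k) zero = x by rewrite /= /k hconv_zero.
have f1 : (P \o k) one = x by rewrite /= /k hconv_one prj_deck.
exists (pi1_class (mk_path cf f0 f1)); split=> //; exists (mk_path cf f0 f1), k.
by split=> //; [exact: hconv_zero|exact: hconv_one].
Qed.

Lemma scaled_clamp_continuous (T : topologicalType) (h : T -> R) : continuous h ->
  continuous (fun z : T * R => clamp (z.2 * h z.1)).
Proof.
move=> ch z; apply: (@continuous_comp _ _ _ (fun z : T * R => z.2 * h z.1));
  last exact: clamp_continuous.
apply: continuous_at_mul; first exact: snd_continuous.
by apply: (@continuous_comp _ _ _ fst h); [exact: fst_continuous|exact: ch].
Qed.

Lemma class_deck_exists a : exists g, class_deck a g.
Proof.
(* Shrinking the parameter turns the loop into a family that is constant at time [0] and equal to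
   [f] at time [1]. *)
pose f : loop := repr a; pose F (z : I * R) := f (clamp (z.2 * uval z.1)).
have cF : continuous F.
  apply: loop_comp; apply: scaled_clamp_continuous; exact: uval_continuous.
have F0 s : F (s, 0) = P p0 by rewrite /F /= mul0r -zeroE path_zero p0x.
have F1 s : F (s, 1) = f s by rewrite /F /= mul1r clampK.
have [|k [ck kf k0]] := @based_lift_exists _ _ _ F zero p0 unit_itv_compact cF F0.
  by rewrite F1 path_zero p0x.
have /prjP[g Mg gk] : P p0 = P (k one) by rewrite kf F1 path_one p0x.
exists g; split=> //; exists f, k; split=> //; first exact: pi1_classK.
by move=> s; rewrite kf F1.
Qed.

Lemma class_deckM a b g h : class_deck a g -> class_deck b h ->
  class_deck (a * b)%g (g \o h).
Proof.
move=> [Mg [f [k [<- ck kf k0 k1]]]] [Mh [f' [k' [<- ck' kf' k0' k1']]]].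
split; first exact: deck_comp.
have cg := hisometry_continuous (deck_isometry Mg).
pose l s := if uval s <= 2^-1 then k (clamp (2 * uval s))
            else g (k' (clamp (2 * uval s - 1))).
exists (loop_cat f f'), l; split.
- exact/esym/pi1_mulE.
- apply: (@path_cat_continuous _ _ _ (@uval R) (fun=> k) (fun=> g \o k')).
  + exact: uval_continuous.
  + by move=> m cm y; apply: continuous_comp; [exact: cm|exact: ck].
  + move=> m cm y; apply: (@continuous_comp _ _ _ (k' \o m)); last exact: cg.
    by apply: continuous_comp; [exact: cm|exact: ck'].
  + by move=> _; rewrite /= k1 k0'.
- move=> s; rewrite /= /mk_path /path_cat /l; case: ifP => _ //.
  by rewrite prj_deck.
- by rewrite /l uval0 invr_ge0 ler0n mulr0 -zeroE.
rewrite /l uval1 invf_ge1 ?ltr0n // (ler_nat _ 2 1) /=.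
by rewrite (_ : 2 * 1 - 1 = 1) -?oneE ?k1' //; lra.
Qed.

Lemma class_deck1 : class_deck 1%g id.
Proof.
split; first exact: deck_id.
exists (loop_cst R x), (fun=> p0); split=> //.
exact: cst_continuous.
Qed.

Lemma class_deck_trivial g : class_deck 1%g g -> g = id.
Proof.
move=> [Mg [f [k [/pi1_classP/asboolP[H [cH H0 H1 Hz Ho]] ck kf k0 k1]]]].
pose F (z : (I * I) * R) := H (clamp (z.2 * uval z.1.1), clamp (z.2 * uval z.1.2)).
have cF : continuous F.
  apply: homotopy_comp => //.
    exact: (scaled_clamp_continuous (@fst_cont R)).
  exact: (scaled_clamp_continuous (@snd_cont R)).
have cII : compact [set: I * I].
  by have := compact_setX unit_itv_compact unit_itv_compact; rewrite setXTT.
have F0 z : F (z, 0) = P p0 by rewrite /F /= !mul0r -zeroE Hz p0x.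
have F1 z : F (z, 1) = H z by rewrite /F /= !mul1r !clampK; case: z.
have [|L [cL LF L0]] := @based_lift_exists _ _ _ F (zero, zero) p0 cII cF F0.
  by rewrite F1 Hz p0x.
have LH z : P (L z) = H z by rewrite LF F1.
have cLl t : continuous (fun s => L (t, s)).
  by apply: homotopy_comp => //; [exact: cst_continuous|move=> ?; exact: cvg_id].
have cLr s : continuous (fun t => L (t, s)).
  by apply: homotopy_comp => //; [move=> ?; exact: cvg_id|exact: cst_continuous].
have cst_lift (l : I -> H3) s0 : continuous l -> (forall s, P (l s) = x) ->
    forall s, l s = l s0.
  move=> cl lx; apply: (lift_unique (M := M) (y0 := s0) unit_itv_connected cl) => //.
    exact: cst_continuous.
  by move=> y; rewrite !lx.
have Lk s : L (zero, s) = k s.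
  apply: (lift_unique (M := M) (y0 := zero) unit_itv_connected (cLl zero) ck) => [y|].
    by rewrite LH H0 kf.
  by rewrite L0 k0.
(* [k one] is moved along three sides of the square, all projecting to [x], whose lifts are
   constant; hence it equals [p0]. *)
apply: (deck_free (p := p0) Mg); rewrite -k1 -Lk.
rewrite (cst_lift _ one (cLr one)); last by move=> t; rewrite LH Ho.
rewrite (cst_lift _ zero (cLl one)); last by move=> s; rewrite LH H1.
by rewrite (cst_lift _ zero (cLr zero)) // => t; rewrite LH Hz.
Qed.

End DeckAction.

(** The relation [class_deck] is multiplicative and pairs only the identity with the trivial class,
    so it is the graph of a homomorphism; uniqueness of the class makes it injective. *)
Lemma pi1_action (R : realType) (M : hyperbolic_3manifold R) (x : points M) :
  exists act : fundamental_group R x -> hyp3 R -> hyp3 R, [/\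
    forall a, deck M (act a),
    forall g, deck M g -> exists a, act a = g,
    forall a b, act (a * b)%g = act a \o act b &
    forall a, act a = id -> a = 1%g].
Proof.
have [p0 p0x] := prj_repr x; have [act actP] := choice (class_deck_exists p0x).
have cu (a : fundamental_group R x) g h : class_deck p0 a g -> class_deck p0 a h -> g = h.
  move=> ag ah; have [k Vk] := class_deck_exists p0x a^-1%g.
  have := class_deckM Vk ag; rewrite mulVg => /(class_deck_trivial p0x) kg.
  have := class_deckM Vk ah; rewrite mulVg => /(class_deck_trivial p0x) kh.
  have [l [_ kl _]] := deck_inv Vk.1; apply/funext => z.
  by rewrite -(kl (g z)) -(kl (h z)) -/((k \o g) z) -/((k \o h) z) kg kh.
exists act; split.
- by move=> a; have [] := actP a.
- move=> g /(class_deck_loop p0x)[a ag]; exists a; exact: cu (actP a) ag.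
- by move=> a b; apply: cu (actP _) _; apply: class_deckM.
- move=> a a1; apply: (class_deck_unique _ (class_deck1 p0x)).
  by rewrite -a1; exact: actP.
Qed.

(** * Volume of hyperbolic balls *)

Section BallVolume.
Local Open Scope classical_set_scope.
Variable R : realType.
Local Notation RM := (measurableTypeR R).
Local Notation leb := (@lebesgue_measure R).
Local Notation H3 := (hyp3 R).
Implicit Types (p q : H3) (r a b G x y t : R).

Lemma measurable_lt_set d (T : measurableType d) (f g : T -> R) :
  measurable_fun setT f -> measurable_fun setT g -> measurable [set z | f z < g z].
Proof.
move=> mf mg; have mt : measurable [set true] by [].
have := measurable_fun_ltr mf mg measurableT mt.
rewrite setTI; congr measurable; apply/seteqP; split=> z //=.
Qed.

Lemma lebesgue_sqr_lt b s :
  leb ([set y : RM | (y - b) ^+ 2 < s]) = (2 * Num.sqrt s)%:E.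
Proof.
have [s0|s0] := leP s 0.
  rewrite (ler0_sqrtr s0) mulr0 (_ : [set y : RM | _] = set0) ?measure0 //.
  by apply/seteqP; split=> y //=; rewrite ltNge (le_trans s0) ?sqr_ge0.
rewrite (_ : [set y : RM | _] = ball (b : R) (Num.sqrt s)).
  by rewrite lebesgue_measure_ball ?sqrtr_ge0 // mulr2n mulrDl mul1r.
apply/seteqP; split=> y /=; rewrite /ball /= distrC.
  by rewrite -sqrtr_sqr ltr_sqrt.
by rewrite -[X in X < _ -> _]sqrtr_sqr ltr_sqrt.
Qed.

Definition disc a b G : set (RM * RM) :=
  [set z | (z.1 - a) ^+ 2 + (z.2 - b) ^+ 2 < G].

Lemma measurable_disc a b G : measurable (disc a b G).
Proof.
apply: (@measurable_lt_set _ (RM * RM)%type); last exact: measurable_cst.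
apply: measurable_funD; apply: measurable_funX; apply: measurable_funB => //.
Qed.

Definition chord_integral G : \bar R := (\int[leb]_x (2 * Num.sqrt (G - x ^+ 2))%:E)%E.

Lemma chord_continuous G (f : R -> R) : continuous f ->
  continuous (fun x : R => 2 * Num.sqrt (G - f x ^+ 2)).
Proof.
move=> cf x; apply: continuous_at_mul; first exact: continuous_at_cst.
apply: continuous_at_sqrt; apply: continuous_at_sub; first exact: continuous_at_cst.
exact: (continuous_at_mul (cf x) (cf x)).
Qed.

Lemma affine_is_derive (k c x : R) : is_derive x 1 (fun u : R => c + k * u) k.
Proof.
by apply: is_derive_eq; rewrite add0r mul1r /GRing.scale /= mulr1.
Qed.

Lemma affine_substitution (k c : R) (f : R -> R) : 0 < k -> continuous f ->
  (forall x, 0 <= f x) ->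
  (\int[leb]_x (f x)%:E = \int[leb]_x (f (c + k * x) * k)%:E)%E.
Proof.
move=> k0 cf f0; pose F (u : R) : R := c + k * u.
have dF : F^`() = cst k.
  by apply/funext => u; rewrite derive1E; apply: derive_val; exact: affine_is_derive.
rewrite (@increasing_ge0_integration_by_substitutionT R F f) //.
- by apply: eq_integral => x _; rewrite dF.
- by move=> x y xy; rewrite /F ltrD2l ltr_pM2l.
- by rewrite dF; exact: cst_continuous.
- by rewrite dF; exact: is_cvg_cst.
- by rewrite dF; exact: is_cvg_cst.
- apply/cvgrNyPle => A; exists ((A - c) / k); split=> [|x /=]; first exact: num_real.
  by rewrite ltr_pdivlMr // /F => h; rewrite addrC -lerBrDr mulrC ltW.
- apply/cvgryPge => A; exists ((A - c) / k); split=> [|x /=]; first exact: num_real.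
  by rewrite ltr_pdivrMr // /F => h; rewrite addrC -lerBlDr mulrC ltW.
Qed.

(** Slicing gives chords of half-length [sqrt (G - (x - a)^2)], and the substitution
    [x = a + sqrt G * u] reduces their integral to the unit disc. *)
Lemma disc_area a b G : 0 <= G ->
  (leb \x leb)%E (disc a b G) = (G%:E * chord_integral 1)%E.
Proof.
move=> G0; rewrite /product_measure1.
have -> : (\int[leb]_x (leb \o xsection (disc a b G)) x =
    \int[leb]_x (2 * Num.sqrt (G - (x - a) ^+ 2))%:E)%E.
  apply: eq_integral => x _ /=; rewrite -(lebesgue_sqr_lt b); congr (leb _).
  by apply/seteqP; split=> y; rewrite /xsection /disc /= inE /=; rewrite ltrBrDl.
have [->|G1] := eqVneq G 0.
  rewrite mul0e integral0_eq // => x _.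
  by rewrite ler0_sqrtr ?mulr0 // sub0r oppr_le0 sqr_ge0.
have {G1}G0' : 0 < G by rewrite lt_def G1.
have sG : 0 < Num.sqrt G by rewrite sqrtr_gt0.
rewrite (@affine_substitution (Num.sqrt G) a) //; last first.
  apply: (@chord_continuous G (fun x => x - a)) => x.
  by apply: continuous_at_sub; [exact: cvg_id|exact: continuous_at_cst].
rewrite /chord_integral -ge0_integralZl_EFin //; last first.
  apply/measurable_EFinP; apply: continuous_measurable_fun; apply: (@chord_continuous 1 id).
  by move=> x; exact: cvg_id.
apply: eq_integral => x _; rewrite -EFinM; congr (_%:E).
have s2 : Num.sqrt G ^+ 2 = G by rewrite sqr_sqrtr.
have -> : G - (a + Num.sqrt G * x - a) ^+ 2 = G * (1 - x ^+ 2).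
  by rewrite -[in RHS]s2; rewrite -[X in X - _ = _]s2; ring.
by rewrite sqrtrM // -[in RHS]s2; ring.
Qed.

(** The area of the unit disc, that is, pi. *)
Definition disc_cst : R := fine (chord_integral 1).

Lemma chord_integralE : chord_integral 1 =
  (\int[leb]_(x in `[(-1)%R, 1%R]) (2 * Num.sqrt (1 - x ^+ 2))%:E)%E.
Proof.
rewrite [RHS]integral_mkcond; apply: eq_integral => x _; rewrite patchE.
case: ifPn => // /negP xI; rewrite ler0_sqrtr ?mulr0 //.
have : ~ (-1 <= x <= 1) by move=> h; apply: xI; rewrite inE /= in_itv.
move=> /negP; rewrite negb_and -!ltNge => /orP[]; nra.
Qed.

Lemma integral_segment_le (f g : R -> R) a b : continuous f -> continuous g ->
  (forall x, a <= x <= b -> 0 <= f x <= g x) ->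
  (\int[leb]_(x in `[a, b]) (f x)%:E <= \int[leb]_(x in `[a, b]) (g x)%:E)%E.
Proof.
move=> cf cg fg; apply: ge0_le_integral => // [x| | |x].
- by rewrite /= in_itv /= lee_fin => /fg/andP[].
- apply/measurable_EFinP; apply: measurable_funTS; exact: continuous_measurable_fun.
- apply/measurable_EFinP; apply: measurable_funTS; exact: continuous_measurable_fun.
- by rewrite /= in_itv /= lee_fin => /fg/andP[].
Qed.

(* From [sqrt (1 - x^2) >= (1 - x^2) (1 + x^2 / 2)]. *)
Lemma disc_cst_bounds : chord_integral 1 = disc_cst%:E /\ 44 / 15 <= disc_cst.
Proof.
have c1 : continuous (fun x : R => 2 * Num.sqrt (1 - x ^+ 2)).
  by apply: (@chord_continuous 1 id) => x; exact: cvg_id.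
have up : (chord_integral 1 <= 4%:E)%E.
  rewrite chord_integralE; apply: (@le_trans _ _ (\int[leb]_(x in `[(-1)%R, 1%R]) 2%:E)%E).
    apply: (@integral_segment_le _ (fun=> 2)) => // [|x _]; first exact: cst_continuous.
    rewrite mulr_ge0 ?sqrtr_ge0 //= -[leRHS]mulr1 ler_pM2l // -[leRHS]sqrtr1 ler_sqrt //.
    by rewrite lerBlDr lerDl sqr_ge0.
  rewrite integral_cst //= lebesgue_measure_itv /= lte_fin gtrN //= -EFinD -EFinM lee_fin.
  lra.
have lo : ((44 / 15)%:E <= chord_integral 1)%E.
  (* [F] is an antiderivative of the lower bound [f], whose integral over [[-1, 1]] is
     [4 - 2/3 - 2/5 = 44/15]. *)
  pose F (x : R) := 2 * x - x ^+ 3 / 3 - x ^+ 5 / 5.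
  pose f (x : R) := 2 - x ^+ 2 - x ^+ 4.
  have dF (x : R) : is_derive x 1 F (f x).
    by apply: is_derive_eq; rewrite /f /GRing.scale /=; field.
  have cf : continuous f.
    move=> x; apply: differentiable_continuous; apply/derivable1_diffP.
    by apply: ex_derive.
  have cF : continuous F.
    move=> x; apply: differentiable_continuous; apply/derivable1_diffP.
    by have [] := dF x.
  have ftc : (\int[leb]_(x in `[(-1)%R, 1%R]) (f x)%:E = (F 1)%:E - (F (-1))%:E)%E.
    apply: continuous_FTC2 => [||| x _].
    - by lra.
    - exact: continuous_subspaceT.
    - split=> [x _||]; first by have [] := dF x.
        by apply: cvg_at_right_filter; exact: cF.
      by apply: cvg_at_left_filter; exact: cF.
    by rewrite derive1E; apply: derive_val.
  have -> : (44 / 15)%:E = (\int[leb]_(x in `[(-1)%R, 1%R]) (f x)%:E)%E.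
    by rewrite ftc -EFinB; congr (_%:E); rewrite /F; field.
  rewrite chord_integralE; apply: integral_segment_le => // x /andP[x0 x1].
  have u0 := sqr_ge0 x; have u1 : x ^+ 2 <= 1 by nra.
  have -> : f x = 2 * ((1 - x ^+ 2) * (1 + x ^+ 2 / 2)) by rewrite /f; field.
  move: u0 u1; set u := x ^+ 2 => u0 u1.
  have f0 : 0 <= (1 - u) * (1 + u / 2) by apply: mulr_ge0; lra.
  rewrite mulr_ge0 //= ler_pM2l // -[leLHS](ger0_norm f0) -sqrtr_sqr ler_sqrt; last by lra.
  have -> : ((1 - u) * (1 + u / 2)) ^+ 2 = (1 - u) * (1 - (3 * u ^+ 2 + u ^+ 3) / 4).
    by field.
  rewrite -[leRHS]mulr1 ler_wpM2l ?subr_ge0 // gerBl divr_ge0 // addr_ge0 //.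
    by rewrite mulr_ge0 // sqr_ge0.
  exact: exprn_ge0.
have fin : chord_integral 1 = disc_cst%:E.
  rewrite /disc_cst fineK // ge0_fin_numE; first exact: le_lt_trans up (ltry _).
  by apply: integral_ge0 => x _; rewrite lee_fin mulr_ge0 // sqrtr_ge0.
by split=> //; rewrite -lee_fin -fin.
Qed.

End BallVolume.

(** The product of the first two measures is repackaged together with its sigma-finiteness, so that
    Tonelli applies with the last coordinate outermost. *)
Lemma fubini_tonelli_last d1 d2 d3 (T1 : measurableType d1)
    (T2 : measurableType d2) (T3 : measurableType d3) (R : realType)
    (m1 : {sigma_finite_measure set T1 -> \bar R})
    (m2 : {sigma_finite_measure set T2 -> \bar R})
    (m3 : {sigma_finite_measure set T3 -> \bar R}) (f : T1 * T2 * T3 -> \bar R) :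
  measurable_fun setT f -> (forall u, 0 <= f u)%E ->
  (\int[m1 \x m2 \x m3]_u f u = \int[m3]_t \int[m1 \x m2]_x f (x, t))%E.
Proof.
move=> mf f0; have sf : sigma_finite setT (m1 \x m2)%E.
  by have [] := lebesgue_integral_fubini.measure_function_Measure_isSigmaFinite__to__measure_function_isSigmaFinite m1 m2.
pose m := HB.pack_for {sigma_finite_measure set (T1 * T2)%type -> \bar R}
  (m1 \x m2)%E (Measure_isSigmaFinite.Build _ _ _ (m1 \x m2)%E sf).
exact: (@fubini_tonelli2 _ _ _ _ R m m3 f mf f0).
Qed.

(** * Volume and packing of hyperbolic balls *)

Section HyperbolicBall.
Local Open Scope classical_set_scope.
Variable R : realType.
Local Notation RM := (measurableTypeR R).
Local Notation leb := (@lebesgue_measure R).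
Local Notation H3 := (hyp3 R).
Local Notation kappa := (disc_cst R).
Implicit Types (p q : H3) (r t : R).

(** Squared radius of the Euclidean disc in which the plane at height [t] meets the hyperbolic ball
    with centre at height [h] and radius of hyperbolic cosine [C]. *)
Definition ball_section (h C t : R) : R := 2 * h * C * t - t ^+ 2 - h ^+ 2.

Definition coord_ball (a b h C : R) : set (RM * RM * RM) :=
  [set u | (u.1.1 - a) ^+ 2 + (u.1.2 - b) ^+ 2 < ball_section h C u.2].

Lemma coords_hball p r : 0 < r -> @coords R @` hball p r =
  coord_ball (set_val p 0 0) (set_val p 0 1) (set_val p 0 2) (coshR r).
Proof.
move=> r0; have hp := height_gt0 p; rewrite /height in hp.
have key q : hball p r q <-> coord_ball (set_val p 0 0) (set_val p 0 1)
    (set_val p 0 2) (coshR r) (@coords R q).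
  have hq := height_gt0 q; rewrite /height in hq.
  rewrite /hball /coord_ball /ball_section /coords /= hdist_ltP ?(ltW r0) //.
  rewrite hcoshE sum3 -ltrBrDl ltr_pdivrMr ?mulr_gt0 //.
  split=> h; lra.
apply/seteqP; split=> [_ [q pq <-]|[[x y] t] xyt]; first exact/key.
have t0 : 0 < t.
  move: xyt; rewrite /coord_ball /ball_section /= => xyt.
  have C0 := coshR_gt0 r; set h := set_val p 0 2 in hp xyt.
  have : 0 < 2 * h * coshR r * t.
    have := sqr_ge0 (x - set_val p 0 0); have := sqr_ge0 (y - set_val p 0 1).
    have := sqr_ge0 t; have := exprn_gt0 2 hp; lra.
  rewrite pmulr_rgt0 //; apply: mulr_gt0 => //; exact: mulr_gt0.
have m : (\row_(i < 3) nth 0 [:: x; y; t] i : 'rV[R]_3) \in @upper_half_space R.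
  by rewrite inE /upper_half_space /= mxE.
pose q : H3 := exist (fun v : 'rV[R]_3 => v \in @upper_half_space R) _ m.
have qE : @coords R q = (x, y, t) by rewrite /coords /= !mxE.
by exists q => //; apply/key; rewrite qE.
Qed.

Lemma ball_section_continuous h C : continuous (ball_section h C).
Proof.
move=> t; apply: continuous_at_sub; last exact: continuous_at_cst.
apply: continuous_at_sub.
  by apply: continuous_at_mul; [exact: continuous_at_cst|exact: cvg_id].
by apply: continuous_at_mul; exact: cvg_id.
Qed.

Lemma measurable_coord_ball a b h C : measurable (coord_ball a b h C).
Proof.
apply: (@measurable_lt_set _ _ (RM * RM * RM)%type).
  apply: measurable_funD; apply: measurable_funX; apply: measurable_funB => //.
    exact: (measurableT_comp measurable_fst measurable_fst).
  exact: (measurableT_comp measurable_snd measurable_fst).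
apply: (measurableT_comp _ measurable_snd).
apply: continuous_measurable_fun; exact: ball_section_continuous.
Qed.

Section Volume.
Variables (a b h r al be : R).
Hypotheses (h0 : 0 < h) (r0 : 0 < r).
Hypotheses (alE : al = h * expR (- r)) (beE : be = h * expR r).
Local Notation C := (coshR r).

(** The roots [al] and [be] are the lowest and the highest height of the ball. *)
Lemma ball_sectionE t : ball_section h C t = (t - al) * (be - t).
Proof.
rewrite /ball_section alE beE /coshR; have := expRxMexpNx_1 r; set x := expR r.
set y := expR (- r) => xy; have -> : h ^+ 2 = (x * y) * h ^+ 2 by rewrite xy mul1r.
by field.
Qed.

Let al0 : 0 < al. Proof. by rewrite alE mulr_gt0 ?expR_gt0. Qed.
Let albe : al < be. Proof. by rewrite alE beE ltr_pM2l // ltr_expR gtrN. Qed.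

(** Agrees with the density [t ^- 3] from [al] on, and is continuous on the whole line. *)
Let w t : R := (Num.max t al) ^- 3.

Let w_continuous : continuous w.
Proof.
move=> t; have cm : continuous_at t (fun t : R => Num.max t al).
  by apply: continuous_at_max; [exact: cvg_id|exact: continuous_at_cst].
have m0 : 0 < Num.max t al by rewrite lt_max al0 orbT.
apply: continuous_at_inv; first by rewrite expf_neq0 // lt0r_neq0.
by apply: continuous_at_mul => //; apply: continuous_at_mul.
Qed.

Let w_ge0 t : 0 <= w t.
Proof. by rewrite invr_ge0 exprn_ge0 // le_max (ltW al0) orbT. Qed.

Lemma coord_ball_slices : (\int[leb \x leb \x leb]_(u in coord_ball a b h C) (u.2 ^- 3)%:E =
  \int[leb]_(t in `[al, be]) (kappa * (ball_section h C t * w t))%:E)%E.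
Proof.
rewrite [LHS]integral_mkcond.
pose F (u : RM * RM * RM) : \bar R := (EFin \o (w \o snd)) \_ (coord_ball a b h C) u.
have mB := measurable_coord_ball a b h C.
rewrite (_ : (fun u => _) = F); last first.
  apply/funext => u; rewrite /F !patchE; case: ifPn => //; rewrite inE => uB.
  congr (_%:E); rewrite /= /w max_l //.
  have : 0 < ball_section h C u.2.
    by apply: le_lt_trans uB; rewrite addr_ge0 // sqr_ge0.
  rewrite ball_sectionE => g0; rewrite leNgt; apply/negP => ta.
  by move: g0; rewrite nmulr_rgt0 ?subr_lt0 // => tb; move: (lt_trans (lt_trans tb ta) albe); rewrite ltxx.
rewrite fubini_tonelli_last; last 2 first.
- apply/(measurable_restrictT _ mB)/measurable_funTS/measurable_EFinP.
  apply: measurableT_comp; last exact: measurable_snd.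
  exact: continuous_measurable_fun.
- by move=> u; rewrite /F patchE; case: ifPn => // _; rewrite lee_fin w_ge0.
rewrite [RHS]integral_mkcond; apply: eq_integral => t _.
have -> : (\int[leb \x leb]_x F (x, t) = \int[leb \x leb]_(x in disc a b (ball_section h C t)) (w t)%:E)%E.
  by rewrite [RHS]integral_mkcond; apply: eq_integral => z _; rewrite /F !patchE.
rewrite integral_cst; last exact: measurable_disc.
have [kE _] := disc_cst_bounds R.
rewrite patchE; case: ifPn => [|/negP]; rewrite inE /= in_itv /=.
  move=> /andP[t1 t2]; rewrite disc_area; last by rewrite ball_sectionE mulr_ge0 ?subr_ge0.
  by rewrite kE -!EFinM; congr (_%:E); ring.
move=> /negP; rewrite negb_and -!ltNge => tI.
have g0 : ball_section h C t < 0.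
  rewrite ball_sectionE; case/orP: tI => tI.
    by rewrite nmulr_rlt0 ?subr_lt0 // subr_gt0; exact: lt_trans albe.
  by rewrite pmulr_rlt0 ?subr_lt0 // subr_gt0; exact: lt_trans tI.
rewrite (_ : disc _ _ _ = set0) ?measure0 ?mule0 //.
by apply/seteqP; split=> z //=; rewrite /disc /= ltNge (le_trans (ltW g0)) // addr_ge0 // sqr_ge0.
Qed.

Lemma ball_section_integral :
  (\int[leb]_(t in `[al, be]) (kappa * (ball_section h C t * w t))%:E =
   (kappa * (sinhR (2 * r) - 2 * r))%:E)%E.
Proof.
pose F (t : R) := kappa * (h ^+ 2 / 2 * (t^-1 * t^-1) - ln t - 2 * h * C * t^-1).
have dF (t : R) : 0 < t ->
    is_derive t 1 F (kappa * (ball_section h C t * (t ^- 3))).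
  move=> t0; have tn := lt0r_neq0 t0.
  have dl := is_derive1_ln t0.
  have dv : is_derive t 1 (fun t : R => t^-1) (- t ^- 2).
    by have := @is_deriveV R id t 1 1 tn (is_derive_id t 1); rewrite /GRing.scale /= mulr1.
  apply: is_derive_eq; rewrite /ball_section /GRing.scale /=; field.
  by rewrite tn.
have cf : continuous (fun t => kappa * (ball_section h C t * w t)).
  move=> t; apply: continuous_at_mul; first exact: continuous_at_cst.
  by apply: continuous_at_mul => //; exact: ball_section_continuous.
have cF t : 0 < t -> {for t, continuous F}.
  move=> t0; apply: differentiable_continuous; apply/derivable1_diffP.
  by have [] := dF t t0.
have be0 : 0 < be by exact: lt_trans albe.
rewrite (@continuous_FTC2 _ _ F) //.
- rewrite -EFinB; congr (_%:E); rewrite /F alE beE !lnM ?posrE ?expR_gt0 // !expRK.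
  rewrite /coshR /sinhR (_ : 2 * r = r + r) ?opprD ?expRD; last by ring.
   have := expRxMexpNx_1 r.
  rewrite !invfM -!expRN opprK.
  move: (expR r) (expR (- r)) => x y xy; have hn := lt0r_neq0 h0; field.
  by rewrite hn.
- exact: continuous_subspaceT.
- split=> [t||].
  + rewrite in_itv /= => /andP[t0 _]; by have [] := dF t (lt_trans al0 t0).
  + by apply: cvg_at_right_filter; exact: cF.
  + by apply: cvg_at_left_filter; exact: cF.
- move=> t; rewrite in_itv /= => /andP[t0 _]; rewrite derive1E.
  have := dF t (lt_trans al0 t0) => dFt; rewrite derive_val /w max_l //; exact: ltW.
Qed.

End Volume.

Lemma hvol_hball p r : 0 < r ->
  hvol (hball p r) = (kappa * (sinhR (2 * r) - 2 * r))%:E.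
Proof.
move=> r0; have hp := height_gt0 p; rewrite /height in hp.
rewrite /hvol coords_hball // (coord_ball_slices _ _ hp r0 erefl erefl).
by rewrite (ball_section_integral hp r0 erefl erefl).
Qed.

Lemma measurable_coords_hball p r : 0 < r -> measurable (@coords R @` hball p r).
Proof. by move=> r0; rewrite coords_hball //; exact: measurable_coord_ball. Qed.

Lemma coords_inj : injective (@coords R).
Proof.
move=> p q [] e0 e1 e2; apply: val_inj; apply/rowP => i.
have : (i : nat) \in [:: 0; 1; 2]%N by case: i => -[|[|[|]]].
rewrite !inE => /or3P[] /eqP iE.
- by rewrite (_ : i = 0) //; apply/val_inj.
- by rewrite (_ : i = 1) //; apply/val_inj.
- by rewrite (_ : i = 2) //; apply/val_inj.
Qed.

Lemma density_measurable (A : set H3) : measurable (@coords R @` A) ->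
  measurable_fun (@coords R @` A) (fun u : RM * RM * RM => (u.2 ^- 3)%:E).
Proof.
move=> mA; apply/measurable_EFinP.
have mP : measurable (`]0%R, +oo[%classic : set RM) by exact: measurable_itv.
have mS : measurable_fun (@coords R @` A) (fun u : RM * RM * RM => u.2).
  by apply: measurable_funTS; exact: measurable_snd.
apply: (measurable_comp mP _ _ mS (f := fun t : RM => t ^- 3)) => //.
- move=> _ [u [p _ <-] <-] /=; rewrite in_itv /= andbT.
  exact: height_gt0.
- apply: subspace_continuous_measurable_fun => //.
  apply: continuous_in_subspaceT => t; rewrite inE /= in_itv /= andbT => t0.
  apply: continuous_at_inv; first by rewrite expf_neq0 // lt0r_neq0.
  have ci : continuous_at (t : R) (fun u : R => u) by exact: cvg_id.
  exact: (continuous_at_mul ci (continuous_at_mul ci ci)).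
Qed.

Lemma density_ge0 (A : set H3) u : (@coords R @` A) u -> (0 <= (u.2 ^- 3)%:E :> \bar R)%E.
Proof.
by move=> [p _ <-]; rewrite lee_fin invr_ge0 exprn_ge0 // ltW //; exact: height_gt0.
Qed.

Lemma hvol_le (A B : set H3) : measurable (@coords R @` A) ->
  measurable (@coords R @` B) -> A `<=` B -> (hvol A <= hvol B)%E.
Proof.
move=> mA mB AB; apply: ge0_subset_integral => //.
- exact: density_measurable.
- exact: density_ge0.
- exact: image_subset.
Qed.

Definition ball_vol r : R := kappa * (sinhR (2 * r) - 2 * r).

Lemma hballs_vol (I : choiceType) (s : seq I) (c : I -> H3) r : 0 < r -> uniq s ->
  {in s &, forall i j, i != j -> 2 * r <= hdist (c i) (c j)} ->
  measurable (@coords R @` (\bigcup_(i in [set` s]) hball (c i) r)) /\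
  hvol (\bigcup_(i in [set` s]) hball (c i) r) = ((size s)%:R * ball_vol r)%:E.
Proof.
move=> r0 us sep; pose F i := @coords R @` hball (c i) r.
have mF i : measurable (F i) by exact: measurable_coords_hball.
have DE : @coords R @` (\bigcup_(i in [set` s]) hball (c i) r) =
    \big[setU/set0]_(i <- s) F i by rewrite image_bigcup bigcup_seq.
have mD : measurable (\big[setU/set0]_(i <- s) F i).
  by apply: bigsetU_measurable => i _.
rewrite DE; split=> //; rewrite /hvol DE ge0_integral_bigsetU //.
- transitivity (\sum_(i <- s) (ball_vol r)%:E)%E.
    by apply: eq_bigr => i _; exact: hvol_hball.
  by rewrite sumEFin big_const_seq count_predT iter_addr_0 mulr_natl.
- move=> i j /= si sj [u [[p pi pu] [q qj qu]]]; apply/eqP; apply/negPn/negP => ij.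
  have pq : p = q by apply: coords_inj; rewrite pu.
  have := sep _ _ si sj ij; have := hdist_triangle p (c i) (c j).
  move: qj pi; rewrite /hball /= -pq (hdistC p); do !move: (hdist _ _) => ?; lra.
- by rewrite -DE; apply: density_measurable; rewrite DE.
- by rewrite -DE; exact: density_ge0.
Qed.

Lemma disc_cst_gt0 : 0 < kappa.
Proof. by apply: lt_le_trans (proj2 (disc_cst_bounds R)); lra. Qed.

(** The disjoint balls of radius [r] lie in the ball of radius [t + r] about [p]; the disc constant
    cancels from the comparison of volumes. *)
Lemma hball_packing (I : choiceType) (s : seq I) (c : I -> H3) p r t : 0 < r -> 0 <= t ->
  uniq s -> {in s &, forall i j, i != j -> 2 * r <= hdist (c i) (c j)} ->
  {in s, forall i, hdist p (c i) <= t} ->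
  (size s)%:R * (sinhR (2 * r) - 2 * r) <= sinhR (2 * (t + r)) - 2 * (t + r).
Proof.
move=> r0 t0 us sep near; have [mD volD] := hballs_vol r0 us sep.
have rt : 0 < t + r by lra.
rewrite -(ler_pM2l disc_cst_gt0) mulrCA -lee_fin.
rewrite -[leLHS]volD -(hvol_hball p rt); apply: hvol_le => //.
  exact: measurable_coords_hball.
move=> q [i si iq]; move: iq (near i si) (hdist_triangle (c i) p q).
rewrite /hball /=; do !move: (hdist _ _) => ?; lra.
Qed.

End HyperbolicBall.

(** * Growth of free groups and displacements *)

Section ReducedWords.
Implicit Types (l : letter) (w s t : seq letter).

Definition letters : seq letter :=
  [:: (false, false); (false, true); (true, false); (true, true)].

Lemma mem_letters l : l \in letters.
Proof. by case: l => [[] []]. Qed.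

Fixpoint rwords (j : nat) : seq (seq letter) :=
  if j is j'.+1 then [seq w <- [seq l :: w | l <- letters, w <- rwords j'] | wreduced w]
  else [:: [::]].

Lemma rwordsP j w : w \in rwords j -> wreduced w /\ size w = j.
Proof.
elim: j w => [|j IH] w; first by rewrite inE => /eqP->.
rewrite mem_filter => /andP[rw /allpairsP[[l v] [_ /= vj wE]]].
by split=> //; rewrite wE /= (proj2 (IH _ vj)).
Qed.

Lemma rwords_uniq j : uniq (rwords j).
Proof.
elim: j => // j IH; apply/filter_uniq/allpairs_uniq => // -[a b] [c d] _ _ /=.
by move=> [-> ->].
Qed.

Lemma wreduced_cons l w : wreduced w ->
  wreduced (l :: w) = (ohead w != Some (linv l)).
Proof. by case: w => [|m w] //; rewrite /wreduced /= => ->; rewrite andbT. Qed.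

(** [catrev (map linv s) t] is the word [s^-1 t]; written this way, the induction carries one letter
    across at a time. *)
Lemma wreduced_catrev s t : wreduced s -> wreduced t ->
  (ohead s == ohead t) ==> (s == [::]) -> wreduced (catrev (map linv s) t).
Proof.
elim: s t => [|a s IH] t //= rs rt at_; apply: IH.
- by move: rs; rewrite /wreduced /=; exact: path_sorted.
- rewrite wreduced_cons // linvK; case: t at_ {rt} => //= b t.
  by rewrite implybF eq_sym.
- by case: s rs {at_} => //= b s; rewrite /wreduced /= => /andP[ba _]; rewrite implybF.
Qed.

(** From the first difference on, [w^-1 w'] is a nonempty reduced word with value [1]. *)
Lemma wval_reduced_inj (G : groupType) (x y : G) w w' : free_pair x y ->
  size w = size w' -> wreduced w -> wreduced w' -> wval x y w = wval x y w' -> w = w'.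
Proof.
move=> fp; elim: w w' => [|a w IH] [|b w'] //= [sw] ra rb e.
have [ab|ab] := eqVneq a b.
  rewrite ab; congr (_ :: _); apply: IH; [by []|exact: path_sorted ra|exact: path_sorted rb|].
  by move: e; rewrite !wval_cons ab => /mulgI.
have r := @wreduced_catrev (a :: w) (b :: w') ra rb.
have /r/fp : (ohead (a :: w) == ohead (b :: w')) ==> ((a :: w) == [::]).
  by rewrite implybF.
rewrite catrevE wval_cat (_ : rev _ = winv (a :: w)) // wval_inv e mulVg.
by move=> /(_ erefl) /(congr1 size); rewrite size_cat /= addnS.
Qed.

Section Sums.
Variables (A : nzRingType) (c : letter -> A).
Hypothesis cV : forall l, c l * c (linv l) = 1.

Definition sphere_sum j : A := \sum_(w <- rwords j) \prod_(l <- w) c l.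
Definition cone_sum j l : A :=
  \sum_(w <- rwords j | ohead w == Some l) \prod_(l <- w) c l.
Local Notation P := sphere_sum.
Local Notation Q := cone_sum.

(** The part of the sphere of radius [j + 1] formed by the words beginning with [l]. *)
Let slice j l : A := \sum_(w <- rwords j | wreduced (l :: w)) \prod_(m <- l :: w) c m.

Let slice_sub j l : slice j l = c l * (P j - Q j (linv l)).
Proof.
have -> : P j = Q j (linv l) +
    \sum_(w <- rwords j | ohead w != Some (linv l)) \prod_(l <- w) c l.
  by rewrite /sphere_sum (bigID (fun w => ohead w == Some (linv l))).
rewrite addrAC subrr add0r mulr_sumr /slice.
rewrite big_seq_cond [RHS]big_seq_cond.
apply: eq_big => w; last by move=> _; rewrite big_cons.
by case: (boolP (w \in _)) => // /rwordsP[rw _]; rewrite wreduced_cons.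
Qed.

Let sphere_slice j : P j.+1 = \sum_(l <- letters) slice j l.
Proof.
rewrite /P big_filter big_mkcond big_allpairs_dep; apply: eq_bigr => l _.
by rewrite /slice [RHS]big_mkcond.
Qed.

Let cone_slice j l : Q j.+1 l = slice j l.
Proof.
rewrite /Q big_filter_cond big_mkcond big_allpairs_dep (bigD1_seq l) ?mem_letters //=.
rewrite [X in _ + X]big1 ?addr0 => [|m ml].
  by rewrite /slice [RHS]big_mkcond; apply: eq_bigr => w _; rewrite eqxx andbT.
apply: big1 => w _; case: ifP => // /andP[_ /eqP[lm]].
by rewrite lm eqxx in ml.
Qed.

Lemma sphere_sum0 : P 0 = 1.
Proof. by rewrite /P big_seq1 big_nil. Qed.

Lemma sphere_sum1 : P 1 = \sum_(l <- letters) c l.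
Proof.
rewrite sphere_slice; apply: eq_bigr => l _; rewrite slice_sub sphere_sum0 /Q.
by rewrite big_mkcond big_seq1 subr0 mulr1.
Qed.

(** A letter either lengthens a word or cancels its first letter. Cancellation by [l] leaves the
    words of length [j] not beginning with [l]; summed over [l] this is three times the sphere of
    radius [j > 0], but four times that of radius [0]. *)
Let letters_sphere j : (\sum_(l <- letters) c l) * P j.+1 =
  P j.+2 + (4%:R * P j - \sum_(l <- letters) Q j l).
Proof.
have -> : 4%:R * P j - \sum_(l <- letters) Q j l = \sum_(l <- letters) (P j - Q j l).
  by rewrite sumrB big_const_seq count_predT iter_addr_0 mulr_natl.
rewrite (sphere_slice j.+1) -big_split mulr_suml; apply: eq_bigr => l _ /=.
rewrite slice_sub mulrBr cone_slice slice_sub mulrA cV mul1r linvK.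
by rewrite subrK.
Qed.

Lemma letters_sphere1 : (\sum_(l <- letters) c l) * P 1 = P 2 + 4%:R * P 0.
Proof.
rewrite letters_sphere [X in _ - X]big1 ?subr0 // => l _.
by rewrite /Q big_mkcond big_seq1.
Qed.

Lemma letters_sphereS j :
  (\sum_(l <- letters) c l) * P j.+2 = P j.+3 + 3%:R * P j.+1.
Proof.
rewrite letters_sphere; congr (_ + _).
have -> : \sum_(l <- letters) Q j.+1 l = P j.+1.
  by rewrite sphere_slice; apply: eq_bigr => l _; rewrite cone_slice.
by rewrite -[X in _ - X]mul1r -mulrBl; congr (_ * _); apply/eqP; rewrite subr_eq natr1.
Qed.

End Sums.

(** With every letter sent to the integer [1], [sphere_sum] counts words and its recursion
    determines the count. *)
Lemma size_rwords j : size (rwords j.+1) = (4 * 3 ^ j)%N.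
Proof.
pose P := sphere_sum (fun _ : letter => 1 : int).
have PE i : P i = (size (rwords i))%:R.
  rewrite /P /sphere_sum; under eq_bigr do rewrite big1_eq.
  by rewrite big_const_seq count_predT iter_addr_0.
have cV (l : letter) : (1 : int) * 1 = 1 by rewrite mulr1.
have e0 := @sphere_sum0 int (fun=> 1); have e1 := @sphere_sum1 int (fun=> 1).
have e2 := @letters_sphere1 int (fun=> 1) cV; have e3 := @letters_sphereS int (fun=> 1) cV.
have T4 : \sum_(l <- letters) (1 : int) = 4%:R by rewrite big_const_seq count_predT iter_addr_0.
rewrite -!/P T4 in e0 e1 e2 e3.
suff : P j.+1 = (4 * 3 ^ j)%:R /\ P j.+2 = 3%:R * P j.+1.
  by move=> [+ _]; rewrite PE => /eqP; rewrite eqr_nat => /eqP.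
elim: j => [|j [IH IH']]; first by rewrite -/P in e0 e1 e2 *; split; lia.
have := e3 j; rewrite -/P => e; split; last by lia.
by rewrite IH' IH -natrM expnS mulnCA.
Qed.

End ReducedWords.

(** * Numerical bounds for exponential and hyperbolic functions *)

Section ExponentialBounds.
Variable R : realType.
Implicit Types (x c S U : R) (n m : nat).

Definition exp_sum n x : R := \sum_(k < n) x ^+ k / k`!%:R.

Let exp_sumE n x : exp_sum n x = series (exp_coeff x) n.
Proof. by rewrite /series /= big_mkord; apply: eq_bigr => i _; rewrite /exp_coeff. Qed.

Lemma exp_sum_le n x : 0 <= x -> exp_sum n x <= expR x.
Proof.
move=> x0; rewrite exp_sumE; apply: nondecreasing_cvgn_le.
  by apply: nondecreasing_series => k _ _; rewrite /exp_coeff /= divr_ge0 // exprn_ge0.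
exact: is_cvg_series_exp_coeff.
Qed.

(* The upper bound is nonincreasing in [n]. *)
Lemma le_exp_sum n c x : 0 <= x -> 0 <= c -> 1 + c * x / n.+1%:R <= c ->
  expR x <= exp_sum n x + c * x ^+ n / n`!%:R.
Proof.
move=> x0 c0 hc; pose U m := exp_sum m x + c * x ^+ m / m`!%:R.
have US m : (n <= m)%N -> U m.+1 <= U m.
  move=> nm; rewrite /U /exp_sum big_ord_recr /= -addrA lerD2l.
  rewrite factS natrM invfM exprS.
  have -> : x ^+ m / m`!%:R + c * (x * x ^+ m) * (m.+1%:R^-1 * m`!%:R^-1) =
    (1 + c * x / m.+1%:R) * (x ^+ m / m`!%:R) by ring.
  rewrite -[leRHS]mulrA; apply: ler_wpM2r; first by rewrite divr_ge0 // exprn_ge0.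
  apply: le_trans hc; rewrite lerD2l ler_wpM2l ?mulr_ge0 // lef_pV2 ?posrE //.
  by rewrite ler_nat ltnS.
have UU m : (n <= m)%N -> U m <= U n.
  elim: m => [|m IH]; first by rewrite leqn0 => /eqP->.
  rewrite leq_eqVlt => /orP[/eqP-> //|]; rewrite ltnS => nm.
  exact: le_trans (US m nm) (IH nm).
apply: limr_le; first exact: is_cvg_series_exp_coeff.
exists n => // m nm; rewrite -exp_sumE; apply: le_trans (UU m nm).
by rewrite /U lerDl divr_ge0 // mulr_ge0 // exprn_ge0.
Qed.

Lemma sinhR_ge S x : 0 < S -> S <= expR x -> (S - S^-1) / 2 <= sinhR x.
Proof.
move=> S0 Sx; rewrite /sinhR expRN ler_pM2r // lerB //.
by rewrite lef_pV2 ?posrE ?expR_gt0.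
Qed.

Lemma sinhR_le U x : expR x <= U -> sinhR x <= (U - U^-1) / 2.
Proof.
move=> Ux; have U0 := lt_le_trans (expR_gt0 x) Ux.
rewrite /sinhR expRN ler_pM2r // lerB //.
by rewrite lef_pV2 ?posrE ?expR_gt0.
Qed.

Lemma coshR_le S U x : 0 < S -> S <= expR x <= U -> coshR x <= (U + S^-1) / 2.
Proof.
move=> S0 /andP[Sx xU]; rewrite /coshR expRN ler_pM2r // lerD //.
by rewrite lef_pV2 ?posrE ?expR_gt0.
Qed.

Lemma sinhR_gt x : 0 < x -> x < sinhR x.
Proof.
move=> x0; have := @exp_sum_le 3 x (ltW x0).
rewrite /exp_sum !big_ord_recl big_ord0 /= !factS fact0 /bump /= => hS.
set S := _ + _ in hS; have SE : S = 1 + x + x ^+ 2 / 2 by rewrite /S; field.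
have S0 : 0 < S by rewrite SE; nra.
apply: lt_le_trans (sinhR_ge S0 hS).
rewrite ltr_pdivlMr // ltrBrDr -(ltr_pM2r S0) mulrDl mulVf ?gt_eqF //.
have := exprn_gt0 4 x0; rewrite SE; nra.
Qed.

End ExponentialBounds.

Section Numerics.
Variable R : realType.
Implicit Types (x S U V : R).

Lemma exp_sum7 x : exp_sum 7 x =
  1 + x + x ^+ 2 / 2 + x ^+ 3 / 6 + x ^+ 4 / 24 + x ^+ 5 / 120 + x ^+ 6 / 720.
Proof. by rewrite /exp_sum !big_ord_recl big_ord0 /= !factS fact0 /bump /=; field. Qed.

Lemma expR_bounds7 x : 0 <= x <= 2 ->
  exp_sum 7 x <= expR x <= exp_sum 7 x + x ^+ 7 / 3780.
Proof.
move=> /andP[x0 x2]; rewrite exp_sum_le //=.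
(* For [x <= 2] the condition [1 + c * x / 8 <= c] holds with [c = 4/3]; then [c / 7!] is
   [1 / 3780]. *)
have := @le_exp_sum R 7 (4 / 3) x x0; rewrite !factS fact0 => h.
apply: le_trans (h _ _) _; [lra| |].
- have : 4 / 3 * x / 8 <= 1 / 3 by lra.
  lra.
- by rewrite lerD2l le_eqVlt; apply/orP; left; apply/eqP; field.
Qed.

Lemma sinhR_ge_num S V x : 0 < S -> 1 <= S * V -> S <= expR x ->
  (S - V) / 2 <= sinhR x.
Proof.
move=> S0 SV Sx; apply: le_trans (sinhR_ge S0 Sx).
by rewrite ler_pM2r // lerB // -(ler_pM2l S0) mulfV ?gt_eqF.
Qed.

Lemma sinhR_le_num U V x : U * V <= 1 -> expR x <= U -> sinhR x <= (U - V) / 2.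
Proof.
move=> UV xU; have U0 := lt_le_trans (expR_gt0 x) xU.
apply: le_trans (sinhR_le xU) _.
by rewrite ler_pM2r // lerB // -(ler_pM2l U0) mulfV ?gt_eqF.
Qed.

Lemma coshR_eps_lt : coshR (905 / 1000 : R) < 1442 / 1000.
Proof.
have [lo up] := andP (@expR_bounds7 (905 / 1000) ltac:(lra)).
apply: (@le_lt_trans _ _ ((2473 / 1000 + (2471 / 1000)^-1) / 2)); last by lra.
apply: coshR_le; first by lra.
by apply/andP; split; [apply: le_trans lo|apply: le_trans up _]; rewrite exp_sum7; lra.
Qed.

Lemma coshR_edge_le : coshR (182 / 100 : R) <= 32 / 10.
Proof.
have [lo up] := andP (@expR_bounds7 (182 / 100) ltac:(lra)).
apply: (@le_trans _ _ ((62 / 10 + (6 : R)^-1) / 2)); last by lra.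
apply: coshR_le; first by lra.
by apply/andP; split; [apply: le_trans lo|apply: le_trans up _]; rewrite exp_sum7; lra.
Qed.

Lemma sinhR_eps_ge : 1282 / 1000 / 10 <= sinhR (905 / 1000 : R) - 905 / 1000.
Proof.
have [lo _] := andP (@expR_bounds7 (905 / 1000) ltac:(lra)).
rewrite exp_sum7 in lo; have S : 2471 / 1000 + 7 / 1000 / 10 <= expR (905 / 1000 : R) by lra.
move: S => {lo} S.
have := @sinhR_ge_num (2471 / 1000 + 7 / 1000 / 10) (404 / 1000 + 59 / 100 / 1000) _ ltac:(lra) ltac:(lra) S.
lra.
Qed.

(** [0.174] is twice [0.087] and [0.674] is twice [1/4 + 0.087]: fewer than [60] disjoint balls of
    radius [0.087] fit with their centres within [1/4] of a point. *)
Lemma packing_ratio :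
  sinhR (674 / 1000 : R) - 674 / 1000 < 60 * (sinhR (174 / 1000) - 174 / 1000).
Proof.
have [lo _] := andP (@expR_bounds7 (174 / 1000) ltac:(lra)).
have [_ up] := andP (@expR_bounds7 (674 / 1000) ltac:(lra)).
rewrite !exp_sum7 in lo up.
(* Written as sums of small fractions, the two bounds are the decimals [1.190055] and [1.96208]. *)
have S : 1190 / 1000 + 55 / 1000 / 1000 <= expR (174 / 1000 : R) by lra.
have U : expR (674 / 1000 : R) <= 1962 / 1000 + 8 / 100 / 1000 by lra.
move: S U => {lo up} S U.
have := @sinhR_ge_num (1190 / 1000 + 55 / 1000 / 1000) (840 / 1000 + 298 / 1000 / 1000) _ ltac:(lra) ltac:(lra) S.
have := @sinhR_le_num (1962 / 1000 + 8 / 100 / 1000) (509 / 1000 + 662 / 1000 / 1000) _ ltac:(lra) U.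
lra.
Qed.

(** [8 * (42 / 40)] is [2 * (3.2 + 1)], where [3.2] bounds [hcosh] of the edges. The radius [0.087]
    is just below the largest one that this inequality allows for points at distance [1/4]. *)
Lemma angle_packing : 8 * sinhR (87 / 1000 : R) ^+ 2 * (42 / 40) <= sinhR (4^-1) ^+ 2.
Proof.
have s0 : 0 <= sinhR (87 / 1000 : R) := sinhR_ge0 (divr_ge0 (ler0n _ _) (ler0n _ _)).
have [lo _] := andP (@expR_bounds7 (4^-1) ltac:(lra)).
have [_ up] := andP (@expR_bounds7 (87 / 1000) ltac:(lra)).
rewrite !exp_sum7 in lo up.
have S : 1284 / 1000 + 25 / 1000 / 1000 <= expR (4^-1 : R) by lra.
have U : expR (87 / 1000 : R) <= 1090 / 1000 + 897 / 1000 / 1000 by lra.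
move: S U => {lo up} S U.
have a := @sinhR_ge_num (1284 / 1000 + 25 / 1000 / 1000) (778 / 1000 + 802 / 1000 / 1000) _ ltac:(lra) ltac:(lra) S.
have b := @sinhR_le_num (1090 / 1000 + 897 / 1000 / 1000) (916 / 1000 + 676 / 1000 / 1000) _ ltac:(lra) U.
move: s0 a b => {S U}; move: (sinhR (87 / 1000)) (sinhR 4^-1) => u v u0 a b.
have {}a : 2526 / 1000 / 10 <= v by clear u0 b u; lra.
have {}b : u <= 87 / 1000 + 111 / 1000 / 1000 by clear a v; lra.
have : u * u <= (87 / 1000 + 111 / 1000 / 1000) * (87 / 1000 + 111 / 1000 / 1000).
  exact: (ler_pM u0 u0 b b).
have : (2526 / 1000 / 10) * (2526 / 1000 / 10) <= v * v by apply: (ler_pM _ _ a a); clear; lra.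
rewrite !expr2; move: (u * u) (v * v) => U V; clear; lra.
Qed.

End Numerics.

(** * Displacements under a free isometric action *)

Definition free_isometric_action (R : realType) (G : groupType)
    (act : G -> hyp3 R -> hyp3 R) : Prop :=
  [/\ forall a, hisometry (act a), forall a b p, act (a * b)%g p = act a (act b p),
      forall a p, act a p = p -> a = 1%g
    & forall p r, finite_set [set a | hdist p (act a p) <= r]%classic].

Section Action.
Variables (R : realType) (G : groupType) (act : G -> hyp3 R -> hyp3 R).
Hypothesis actP : free_isometric_action act.
Local Notation B := (@lorentz R).
Implicit Types (a b c : G) (p q : hyp3 R) (u v : 'rV[R]_4).

Lemma hdist_act a p q : hdist (act a p) (act a q) = hdist p q.
Proof. by case: actP => isom _ _ _; case: (isom a). Qed.

Lemma act_inj a : injective (act a).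
Proof. by move=> p q e; apply: hdist_eq0; rewrite -(hdist_act a) e hdistxx. Qed.

Lemma actM a b p : act (a * b)%g p = act a (act b p).
Proof. by case: actP. Qed.

Lemma act1 p : act 1%g p = p.
Proof. by apply: (@act_inj 1%g); rewrite -actM mulg1. Qed.

Lemma actK a : cancel (act a) (act a^-1%g).
Proof. by move=> p; rewrite -actM mulVg act1. Qed.

Lemma actVK a : cancel (act a^-1%g) (act a).
Proof. by move=> p; rewrite -actM mulgV act1. Qed.

Lemma act_free a p : act a p = p -> a = 1%g.
Proof. by case: actP => _ _ fr _; exact: fr. Qed.

Lemma hdist_act2 a b p q : hdist (act a p) (act b q) = hdist p (act (a^-1 * b)%g q).
Proof. by rewrite -(hdist_act a^-1%g) actK actM. Qed.

Lemma act_displacement p : exists2 d : R, 0 < d & forall a, a != 1%g -> d <= hdist p (act a p).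
Proof.
case: (actP) => _ _ _ /(_ p 1) fin.
have finD : finite_set [set a | a != 1%g /\ hdist p (act a p) <= 1]%classic.
  by apply: sub_finite_set fin => a [].
have [a [a1 _]|r r0 rP] := @finite_pos_lower _ _ _ (fun a => hdist p (act a p)) finD.
  rewrite lt_def hdist_ge0 andbT; apply/eqP => /hdist_eq0 e.
  by case/eqP: a1; exact: act_free (esym e).
exists (Num.min 1 r) => [|a a1]; first by rewrite lt_min ltr01.
rewrite ge_min; have [//|h] := leP 1 (hdist p (act a p)).
by rewrite rP //; split=> //; exact: ltW.
Qed.

(** Matrices act on row vectors from the right, so the inverse makes [act_mx] multiplicative in the
    given order. *)
Definition act_mx a : 'M[R]_4 := isometry_mx (act a^-1%g).

Let isomP a : hisometry (act a). Proof. by case: actP. Qed.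

Lemma act_mx_iota a p : iota3 p *m act_mx a = iota3 (act a^-1%g p).
Proof. exact: isometry_mx_iota. Qed.

Lemma act_mxM a b : act_mx (a * b)%g = act_mx a *m act_mx b.
Proof.
by apply: iota3_span => p; rewrite mulmxA !act_mx_iota invgM actM.
Qed.

Lemma act_mx1 : act_mx 1%g = 1%:M.
Proof. by apply: iota3_span => p; rewrite act_mx_iota mulmx1 invg1 act1. Qed.

Lemma act_mx_lorentz a u v : B (u *m act_mx a) (v *m act_mx a) = B u v.
Proof. exact: isometry_mx_lorentz. Qed.

Lemma act_mxV a u v : B (u *m act_mx a) v = B u (v *m act_mx a^-1%g).
Proof.
rewrite -(act_mx_lorentz a u) -mulmxA -act_mxM mulVg act_mx1 mulmx1 //.
Qed.

Lemma act_mx_disp a p : B (iota3 p) (iota3 p *m act_mx a) = hcosh p (act a p).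
Proof.
by rewrite act_mx_iota -[LHS]/(hcosh _ _) -!coshR_hdist hdistC -(hdist_act a) actVK hdistC hdistC.
Qed.

(** Orbit points are at least [d] apart, so the balls of radius [d / 2] about them are disjoint.
    They fit into a ball of radius [arcosh X + d / 2], whose volume grows like [exp (2 * arcosh X)],
    that is, like [X ^+ 2]. *)
Lemma orbit_growth p : exists2 C : R, 0 < C & forall (s : seq G) X, uniq s ->
  {in s, forall a, hcosh p (act a p) <= X} -> (size s)%:R <= C * X ^+ 2.
Proof.
have [d d0 dP] := act_displacement p.
have sd : 0 < sinhR d - d by rewrite subr_gt0 sinhR_gt.
exists (4 * expR d / (sinhR d - d)) => [|s X us sX].
  by rewrite divr_gt0 // mulr_gt0 // expR_gt0.
have [->|s0] := eqVneq s [::].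
  by rewrite /= mulr_ge0 ?sqr_ge0 // divr_ge0 ?(ltW sd) // mulr_ge0 // expR_ge0.
have X1 : 1 <= X.
  by case: s s0 sX {us} => // a s _ /(_ a (mem_head _ _)); apply: le_trans; exact: hcosh_ge1.
pose t := arcosh X; have t0 : 0 <= t by exact: arcosh_ge0.
have d2 : 0 < d / 2 by lra.
have dd : 2 * (d / 2) = d by lra.
have := @hball_packing R G s (act^~ p) p (d / 2) t d2 t0 us; rewrite dd.
have -> : 2 * (t + d / 2) = 2 * t + d by lra.
move=> /(_ _ _) h; rewrite mulrAC ler_pdivlMr //; apply: le_trans (h _ _) _.
- by move=> a b _ _ ab; rewrite hdist_act2 dP //; apply: contra_neq ab => e;
  rewrite -[b]mul1g -(mulgV a) -mulgA e mulg1.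
- by move=> a /sX aX; rewrite hdist_leP // /t cosh_arcosh.
have et : expR t <= 2 * X.
  rewrite -(cosh_arcosh X1) -/t /coshR; have := expR_gt0 (- t); lra.
apply: (@le_trans _ _ (expR (2 * t + d))).
  have := expR_gt0 (2 * t + d); have := expR_gt0 (- (2 * t + d)); rewrite /sinhR; lra.
rewrite expRD mulrAC ler_wpM2r ?expR_ge0 // expRM_natl.
have -> : 4 * X ^+ 2 = (2 * X) ^+ 2 by ring.
by rewrite ler_pXn2r ?nnegrE ?expR_ge0 // mulr_ge0 //; lra.
Qed.

Lemma lorentz_sumr v I (r : seq I) (P : pred I) (F : I -> 'rV[R]_4) :
  B v (\sum_(i <- r | P i) F i) = \sum_(i <- r | P i) B v (F i).
Proof. by rewrite lorentzC lorentz_suml; under eq_bigr do rewrite lorentzC. Qed.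

Section Growth.
Local Open Scope classical_set_scope.
(** [s3] stands for a lower approximation of the square root of 3, and [tau] is [q + 3 / q]. The
    condition [3 * tau <= 4 * q] covers the first step of the sphere recursion, where the
    coefficient is [4] instead of [3]. *)
Variables (x y : G) (p : hyp3 R) (s3 q tau : R).
Hypotheses (xy : free_pair x y) (s30 : 0 < s3) (s3le : s3 ^+ 2 <= 3).
Hypotheses (qE : q = 3 * s3) (tauE : tau * q = q ^+ 2 + 3) (tau_le : 3 * tau <= 4 * q).

Let c (l : letter) : 'M[R]_4 := act_mx (lval x y l).
Let T : 'M[R]_4 := \sum_(l <- letters) c l.
Let v := iota3 p.

Let q0 : 0 < q. Proof. by rewrite qE mulr_gt0. Qed.

Let tau_gt0 : 0 < tau.
Proof. by rewrite -(pmulr_lgt0 _ q0) tauE addr_gt0 ?exprn_gt0. Qed.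

Let q_le : q <= tau.
Proof. by rewrite -(ler_pM2r q0) tauE -expr2 lerDl. Qed.

Let cV l : c l * c (linv l) = 1.
Proof. by rewrite /c lval_inv -[LHS]act_mxM mulgV act_mx1. Qed.

Let cE w : \prod_(l <- w) c l = act_mx (wval x y w).
Proof.
elim: w => [|l w IH]; first by rewrite big_nil /wval big_nil act_mx1.
by rewrite big_cons IH wval_cons act_mxM.
Qed.

Let S j : R := B v (v *m sphere_sum c j).

Let SE j : S j = \sum_(w <- rwords j) hcosh p (act (wval x y w) p).
Proof.
rewrite /S /sphere_sum mulmx_sumr lorentz_sumr; apply: eq_bigr => w _.
by rewrite cE act_mx_disp.
Qed.

(* Packing leaves at most a third of the [4 3^j] words with displacement below
   a constant multiple of [s3^j]. *)
Let sphere_growth : exists2 k : R, 0 < k <= 1 & forall j, k * q ^+ j.+1 <= S j.+1.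
Proof.
have [C C0 CP] := orbit_growth p.
(* Chosen so that [k <= 1] and [C * k ^+ 2 <= 1 / 3]. *)
pose k := (3 * C + 1)^-1; have k0 : 0 < k by rewrite invr_gt0; lra.
have k1 : k <= 1 by rewrite invf_le1; lra.
have Ck : C * k ^+ 2 <= 3^-1.
  have : k * (3 * C + 1) = 1 by rewrite mulVf // gt_eqF //; lra.
  by nra.
exists k => [|j]; [by rewrite k0|]; pose X := k * s3 ^+ j.+1.
have X0 : 0 < X by rewrite mulr_gt0 // exprn_gt0.
pose short := [seq w <- rwords j.+1 | hcosh p (act (wval x y w) p) <= X].
have shortP w : w \in short -> w \in rwords j.+1 /\ hcosh p (act (wval x y w) p) <= X.
  by rewrite /short mem_filter => /andP[].
have shortN : (size short)%:R <= 3 ^+ j.+1 / 3 :> R.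
  have := CP (map (wval x y) short) X; rewrite size_map => /(_ _ _)/le_trans; apply.
  - rewrite map_inj_in_uniq ?(filter_uniq _ (rwords_uniq _)) // => w w'.
    move=> /shortP[/rwordsP[rw sw] _] /shortP[/rwordsP[rw' sw'] _].
    by apply: wval_reduced_inj => //; rewrite sw sw'.
  - by move=> _ /mapP[w /shortP[_ h] ->].
  - have -> : C * X ^+ 2 = C * k ^+ 2 * (s3 ^+ 2) ^+ j.+1.
      by rewrite /X -exprM mulnC exprM; ring.
    rewrite [leLHS]mulrC.
    apply: (ler_pM (exprn_ge0 _ (sqr_ge0 _)) (mulr_ge0 (ltW C0) (sqr_ge0 _)) _ Ck).
    by apply: lerXn2r; rewrite ?nnegrE ?sqr_ge0.
rewrite SE (bigID (fun w => hcosh p (act (wval x y w) p) <= X)) /=.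
have long : (size (rwords j.+1))%:R - (size short)%:R =
    (count (fun w => ~~ (hcosh p (act (wval x y w) p) <= X)) (rwords j.+1))%:R :> R.
  rewrite -(count_predC (fun w => hcosh p (act (wval x y w) p) <= X)).
  by rewrite natrD size_filter addrC addKr.
apply: (@le_trans _ _ (0 + X * (count (fun w => ~~ (hcosh p (act (wval x y w) p) <= X)) (rwords j.+1))%:R)).
  rewrite add0r -long size_rwords natrM natrX /X -mulrA ler_pM2l //.
  have -> : q ^+ j.+1 = s3 ^+ j.+1 * 3 ^+ j.+1 :> R.
    by rewrite -exprMn qE mulrC.
  rewrite ler_pM2l ?exprn_gt0 //.
  by move: shortN; rewrite exprS; lra.
apply: lerD; first by apply: sumr_ge0 => w _; exact: le_trans (hcosh_ge1 _ _).
rewrite mulr_natr -iter_addr_0 -big_const_seq.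
by apply: ler_sum => w; rewrite -ltNge => /ltW.
Qed.

Let s n j : R := B v (v *m (T ^+ n * sphere_sum c j)).

Let s_step n : [/\ s n.+1 0 = s n 1, s n.+1 1 = s n 2 + 4 * s n 0 &
  forall j, s n.+1 j.+2 = s n j.+3 + 3 * s n j.+1].
Proof.
have lin k (X Y : 'M[R]_4) :
    B v (v *m (T ^+ n * (X + k%:R * Y))) = B v (v *m (T ^+ n * X)) + k%:R * B v (v *m (T ^+ n * Y)).
  by rewrite mulrDr mulmxDr lorentzDr mulr_natl -scaler_nat -!mulmxE -!scalemxAr lorentzZr.
split=> [|| j]; rewrite /s exprSr -mulrA.
- by rewrite sphere_sum0 mulr1 sphere_sum1.
- by rewrite letters_sphere1 // lin.
- by rewrite letters_sphereS // lin.
Qed.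

(** The weights [q ^+ j] form an eigenvector of the sphere recursion, with eigenvalue
    [q + 3 / q = tau], so the induction on [n] treats all radii at once. The weight [k * q / tau] at
    radius [0] makes the boundary steps work. *)
Let growth_lower : exists2 l : R, 0 < l & forall n, tau ^+ n * l <= B v (v *m T ^+ n).
Proof.
have [k /andP[k0 k1] kP] := sphere_growth.
exists (k * q / tau) => [|n]; first exact: divr_gt0 (mulr_gt0 k0 q0) tau_gt0.
suff /(_ n)[+ _] : forall n, tau ^+ n * (k * q / tau) <= s n 0 /\
    forall j, tau ^+ n * (k * q ^+ j.+1) <= s n j.+1.
  by rewrite /s sphere_sum0 mulr1.
elim=> [|m [IH0 IH]].
  split=> [|j]; last by rewrite /s !expr0 !mul1r.
  rewrite /s expr0 !mul1r sphere_sum0 mulmx1 -[leRHS]/(hcosh p p) hcoshxx.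
  rewrite ler_pdivrMr // mul1r; apply: le_trans q_le.
  by rewrite -[leRHS]mul1r ler_pM2r.
have [e0 e1 e] := s_step m; have tm : 0 <= tau ^+ m by rewrite exprn_ge0 // ltW.
have up (a b a' b' : R) (i : nat) : a' <= a -> b' <= b -> a' + i%:R * b' <= a + i%:R * b.
  by move=> ca db; rewrite lerD // ler_wpM2l.
split=> [|[|j]].
- rewrite e0; apply: le_trans (IH 0); rewrite exprSr expr1 -mulrA ler_wpM2l // mulrC divfK //.
  by rewrite gt_eqF.
- rewrite e1; apply: le_trans (up _ _ _ _ 4 (IH 1) IH0).
  have -> : tau ^+ m * (k * q ^+ 2) + 4 * (tau ^+ m * (k * q / tau)) =
      tau ^+ m * (k * (q ^+ 2 + 4 * q / tau)) by ring.
  have -> : tau ^+ m.+1 * (k * q ^+ 1) = tau ^+ m * (k * (tau * q)).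
    by rewrite exprSr expr1; ring.
  by rewrite ler_wpM2l // tauE ler_pM2l // lerD2l ler_pdivlMr.
- rewrite e; apply: le_trans (up _ _ _ _ 3 (IH j.+2) (IH j)).
  have -> : tau ^+ m.+1 * (k * q ^+ j.+2) = tau ^+ m * (k * q ^+ j.+1) * (tau * q).
    by rewrite exprSr [q ^+ j.+2]exprSr; ring.
  by rewrite tauE !exprSr le_eqVlt; apply/orP; left; apply/eqP; ring.
Qed.

Let T_adj u w : B (u *m T) w = B u (w *m T).
Proof.
rewrite /T /letters !big_cons big_nil addr0 !mulmxDr !lorentzE /c !act_mxV -!lval_inv /linv /=.
by ring.
Qed.

Let T_upper k : B v (v *m T ^+ (2 ^ k)) <= B v (v *m T) ^+ (2 ^ k).
Proof.
elim: k => [|k IH]; first by rewrite expn0 !expr1.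
have adj n u w : B (u *m T ^+ n) w = B u (w *m T ^+ n).
  elim: n u w => [|n IHn] u w; first by rewrite expr0 !mulmx1.
  by rewrite [in LHS]exprS -mulmxE mulmxA IHn T_adj -mulmxA mulmxE -exprSr.
have -> : (2 ^ k.+1 = 2 ^ k + 2 ^ k)%N by rewrite expnS mul2n addnn.
rewrite exprD -mulmxE mulmxA -adj exprD -expr2.
apply: le_trans (reverse_CS _ (iota3_sheet p)) _.
have h n : 0 <= B v (v *m T ^+ n).
  have [l l0 /(_ n)] := growth_lower; apply: le_trans.
  exact: mulr_ge0 (exprn_ge0 _ (ltW tau_gt0)) (ltW l0).
by rewrite ler_pXn2r ?nnegrE // exprn_ge0 // -[T]expr1.
Qed.

(* Otherwise the displacements would force [B v (v T^n)] to grow slower than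
   the number and the spread of the reduced words allow. *)
Lemma displacement_sum_ge :
  tau <= 2 * (hcosh p (act x p) + hcosh p (act y p)).
Proof.
have bE : B v (v *m T) = 2 * (hcosh p (act x p) + hcosh p (act y p)).
  rewrite /T mulmx_sumr lorentz_sumr; under eq_bigr do rewrite act_mx_disp.
  rewrite /letters !big_cons big_nil addr0 /lval /=.
  have hV a : hcosh p (act a^-1%g p) = hcosh p (act a p).
    by rewrite hcoshC -!coshR_hdist -(hdist_act a) actVK.
  by rewrite !hV; ring.
rewrite -bE leNgt; apply/negP => lt.
have [l l0 lP] := growth_lower.
have b0 : 0 <= B v (v *m T).
  by have := hcosh_ge1 p (act x p); have := hcosh_ge1 p (act y p); rewrite bE; lra.
pose z := B v (v *m T) / tau; have z0 : 0 <= z by rewrite divr_ge0 // ltW.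
have z1 : z < 1 by rewrite ltr_pdivrMr // mul1r.
have /cvgr_lt /(_ l l0) [k _ /(_ k (leqnn k)) /= zk] : (fun n => z ^+ n) @ \oo --> (0 : R).
  by apply: cvg_expr; rewrite ger0_norm.
have := le_trans (lP (2 ^ k)%N) (T_upper k).
apply/negP; rewrite -ltNge mulrC -ltr_pdivrMr ?exprn_gt0 // -exprVn -exprMn.
by apply: le_lt_trans zk; rewrite ler_wiXn2l // ?(ltW z1) // ltnW // ltn_expl.
Qed.

End Growth.
End Action.

Lemma margulis (R : realType) (G : groupType) (act : G -> hyp3 R -> hyp3 R)
    (a b : G) p e : free_isometric_action act -> semifree G 2 ->
  0 <= e -> coshR e < 1442 / 1000 ->
  hdist p (act a p) <= e -> hdist p (act b p) <= e -> commute a b.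
Proof.
move=> actP sf e0 lt pa pb; apply: contrapT => nab.
rewrite hdist_leP // in pa; rewrite hdist_leP // in pb.
(* [1.73] lies below the square root of 3, [5.19] is three times it, and [5.19 + 3 / 5.19] exceeds
   [4 * 1.442]. *)
have := @displacement_sum_ge R G act actP a b p (173 / 100) (519 / 100)
  (519 / 100 + 3 / (519 / 100)) (semifree_free_pair sf nab).
move: (hcosh p (act a p)) (hcosh p (act b p)) (coshR e) lt pa pb => u v w lt pa pb h.
suff : 519 / 100 + 3 / (519 / 100) <= 2 * (u + v) by clear h; lra.
by apply: h; clear; lra.
Qed.

(** * The thick part *)

Section NullVectors.
Variable R : realType.
Local Notation V := 'rV[R]_4.
Local Notation B := (@lorentz R).
Implicit Types (n x y P Q : V) (w k l : R).

(** A nonzero null vector in the closure of the future cone, representing an ideal point. *)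
Definition null_vec n : Prop := [/\ B n n = 0, 0 <= n 0 2, 0 <= n 0 3 & 0 < n 0 2 + n 0 3].

Lemma lorentz_null_gt0 n x : null_vec n -> sheet x -> 0 < B n x.
Proof.
move=> [nn n2 n3 n23] [xx x2].
have nE : n 0 2 * n 0 3 = n 0 0 ^+ 2 + n 0 1 ^+ 2 by move: nn; rewrite /lorentz; lra.
have xE : x 0 2 * x 0 3 = 1 + x 0 0 ^+ 2 + x 0 1 ^+ 2 by move: xx; rewrite /lorentz; lra.
rewrite /lorentz; move: (x 0 0) (x 0 1) (x 0 2) (x 0 3) (n 0 0) (n 0 1) (n 0 2) (n 0 3)
  n2 n3 n23 x2 nE xE => a b c d a' b' c' d' c0 d0 cd0 c1 nE xE.
have [ce|cn] := eqVneq c' 0.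
  move: nE; rewrite ce mul0r => /eqP; rewrite eq_sym paddr_eq0 ?sqr_ge0 // !sqrf_eq0.
  move=> /andP[/eqP-> /eqP->]; have : 0 < d' * c by rewrite mulr_gt0 //; lra.
  lra.
have cp : 0 < c' by rewrite lt_def cn.
have : 0 < c' * c * (c' * d + d' * c - 2 * (a' * a + b' * b)).
  have -> : c' * c * (c' * d + d' * c - 2 * (a' * a + b' * b)) =
    c' ^+ 2 * (c * d) + (c' * d') * c ^+ 2 - 2 * (c' * c) * (a' * a + b' * b) by ring.
  rewrite nE xE.
  have -> : c' ^+ 2 * (1 + a ^+ 2 + b ^+ 2) + (a' ^+ 2 + b' ^+ 2) * c ^+ 2 -
    2 * (c' * c) * (a' * a + b' * b) =
    c' ^+ 2 + (c' * a - c * a') ^+ 2 + (c' * b - c * b') ^+ 2 by ring.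
  by rewrite ltr_wpDr ?sqr_ge0 // ltr_wpDr ?sqr_ge0 // exprn_gt0.
rewrite pmulr_rgt0 ?mulr_gt0 //; lra.
Qed.

Lemma null_orthogonal x y : x != 0 -> B x x = 0 -> B y y = 0 -> B x y = 0 ->
  exists k, y = k *: x.
Proof.
move=> x0 xx yy xy.
have xE : x 0 2 * x 0 3 = x 0 0 ^+ 2 + x 0 1 ^+ 2 by move: xx; rewrite /lorentz; lra.
have yE : y 0 2 * y 0 3 = y 0 0 ^+ 2 + y 0 1 ^+ 2 by move: yy; rewrite /lorentz; lra.
have sq0 (a b : R) : a ^+ 2 + b ^+ 2 = 0 -> a = 0 /\ b = 0.
  by move/eqP; rewrite paddr_eq0 ?sqr_ge0 // !sqrf_eq0 => /andP[/eqP-> /eqP->].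
have [x2|x2] := eqVneq (x 0 2) 0.
  move: (xE); rewrite x2 mul0r => /esym/sq0[e0 e1].
  have x3 : x 0 3 != 0.
    by apply: contraNneq x0 => x3; apply/eqP/vec4P; rewrite !mxE.
  move: xy; rewrite /lorentz x2 e0 e1 !mul0r !subr0 add0r => /eqP.
  rewrite mulf_eq0 invr_eq0 pnatr_eq0 orbF mulf_eq0 (negbTE x3) /= => /eqP y2.
  move: (yE); rewrite y2 mul0r => /esym/sq0[e0' e1'].
  by exists (y 0 3 / x 0 3); apply: vec4P; rewrite !mxE ?e0 ?e1 ?x2 ?e0' ?e1' ?y2 ?mulr0 ?divfK.
have : (x 0 2 * y 0 0 - y 0 2 * x 0 0) ^+ 2 + (x 0 2 * y 0 1 - y 0 2 * x 0 1) ^+ 2 = 0.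
  have -> : (x 0 2 * y 0 0 - y 0 2 * x 0 0) ^+ 2 + (x 0 2 * y 0 1 - y 0 2 * x 0 1) ^+ 2 =
    x 0 2 ^+ 2 * (y 0 0 ^+ 2 + y 0 1 ^+ 2) + y 0 2 ^+ 2 * (x 0 0 ^+ 2 + x 0 1 ^+ 2) -
    2 * x 0 2 * y 0 2 * (x 0 0 * y 0 0 + x 0 1 * y 0 1) by ring.
  rewrite -xE -yE.
  have -> : x 0 0 * y 0 0 + x 0 1 * y 0 1 = (x 0 2 * y 0 3 + x 0 3 * y 0 2) / 2 - B x y.
    by rewrite /lorentz; ring.
  by rewrite xy; field.
move=> /sq0[/eqP + /eqP]; rewrite !subr_eq0 => /eqP e0 /eqP e1.
have [y2|y2] := eqVneq (y 0 2) 0.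
  rewrite y2 !mul0r in e0 e1 yE; have [f0 f1] := sq0 _ _ (esym yE).
  move: xy; rewrite /lorentz y2 f0 f1 !mulr0 !subr0 addr0 => /eqP.
  rewrite mulf_eq0 invr_eq0 pnatr_eq0 orbF mulf_eq0 (negbTE x2) /= => /eqP f3.
  by exists 0; rewrite scale0r; apply: vec4P; rewrite !mxE.
exists (y 0 2 / x 0 2); apply: vec4P; rewrite !mxE.
- by apply: (mulfI x2); rewrite e0; field.
- by apply: (mulfI x2); rewrite e1; field.
- by field.
- apply: (mulfI y2); rewrite yE; apply: (mulfI (expf_neq0 2 x2)).
  have -> : x 0 2 ^+ 2 * (y 0 0 ^+ 2 + y 0 1 ^+ 2) =
    (x 0 2 * y 0 0) ^+ 2 + (x 0 2 * y 0 1) ^+ 2 by ring.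
  rewrite e0 e1.
  have -> : x 0 2 ^+ 2 * (y 0 2 * (y 0 2 / x 0 2 * x 0 3)) = y 0 2 ^+ 2 * (x 0 2 * x 0 3).
    by field.
  by rewrite xE; ring.
Qed.

Lemma sheet_ge1 x y : sheet x -> sheet y -> 1 <= B x y.
Proof.
by move=> /sheet_iota3[p <-] /sheet_iota3[q <-]; exact: hcosh_ge1.
Qed.

Lemma sheet_future x P : B x x = 1 -> sheet P -> 0 < B x P -> sheet x.
Proof.
move=> xx sP xP; split=> //; rewrite ltNge; apply/negP; rewrite le_eqVlt => /orP[/eqP x2|x2].
  by have := sqr_ge0 (x 0 0); have := sqr_ge0 (x 0 1); move: xx; rewrite /lorentz x2; lra.
have sN : sheet (- x) by split; rewrite ?mxE ?lorentzE; lra.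
by have := sheet_ge1 sN sP; rewrite lorentzE; lra.
Qed.

(* The point obtained from [P] by moving along the geodesic issuing from the
   ideal point [n], away from [n], over the distance [ln w]. *)
Definition push n w P : V := w *: P + ((w^-1 - w) / (2 * B n P)) *: n.

Lemma push1 n P : push n 1 P = P.
Proof. by rewrite /push invr1 subrr mul0r scale0r addr0 scale1r. Qed.

Lemma push_sheet n w P : null_vec n -> sheet P -> 0 < w -> sheet (push n w P).
Proof.
move=> nn sP w0; have nP := lorentz_null_gt0 nn sP; case: (nn) => n0 _ _ _.
case: (sP) => PP _; have bn : B n P != 0 by rewrite gt_eqF.
apply: (sheet_future (P := P)) => //; rewrite /push !lorentzE ?n0 PP ?(lorentzC P n).
  by field; rewrite bn gt_eqF.
have -> : w * 1 + (w^-1 - w) / (2 * B n P) * B n P = (w + w^-1) / 2.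
  by field; rewrite bn gt_eqF.
by rewrite divr_gt0 // addr_gt0 // invr_gt0.
Qed.

(** For [l > 0] this is [cosh (ln l)]; it bounds from below the displacements of an isometry that
    scales a null vector by [l]. *)
Definition half_trace l : R := (l + l^-1) / 2.

(** The factor [w ^+ 2] is the same for every isometry fixing the ideal point [n], so a single push
    controls all of them. *)
Lemma push_displacement n w P (A A' : 'M[R]_4) l : null_vec n -> sheet P -> 0 < w ->
  (forall x y, B (x *m A) y = B x (y *m A')) -> l != 0 ->
  n *m A = l *: n -> n *m A' = l^-1 *: n ->
  B (push n w P) (push n w P *m A) =
  half_trace l + w ^+ 2 * (B P (P *m A) - half_trace l).
Proof.
move=> nn sP w0 adj l0 nA nA'; have nP := lorentz_null_gt0 nn sP; case: (nn) => n0 _ _ _.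
have bn : B n P != 0 by rewrite gt_eqF.
have e1 : B n (P *m A) = l^-1 * B n P.
  by rewrite lorentzC adj nA' lorentzE lorentzC.
rewrite /push mulmxDl -!scalemxAl nA !lorentzE n0 e1 (lorentzC P n).
rewrite /half_trace; field; rewrite bn l0 gt_eqF //.
Qed.

(** The null vector of the other endpoint of the geodesic issuing from [n] through [P]. *)
Definition null_part n P : V := P - (2 * B n P)^-1 *: n.

Section Axis.
Variables (n : V) (A A' : 'M[R]_4) (l : R).
Hypotheses (nn : null_vec n) (l0 : 0 < l).
Hypothesis adj : forall x y, B (x *m A) y = B x (y *m A').
Hypothesis isoA : forall x y, B (x *m A) (y *m A) = B x y.
Hypothesis sheetA : forall x, sheet x -> sheet (x *m A).
Hypotheses (nA : n *m A = l *: n) (nA' : n *m A' = l^-1 *: n).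

Let ln0 : l != 0. Proof. by rewrite gt_eqF. Qed.
Let n0 : B n n = 0. Proof. by case: nn. Qed.

(** A displacement below [half_trace l] would decrease without bound under pushing; with the [w]
    chosen here it becomes nonpositive, although it is at least [1] on the sheet. *)
Lemma half_trace_le P : sheet P -> half_trace l <= B P (P *m A).
Proof.
move=> sP; rewrite leNgt; apply/negP => lt.
have C0 : 0 < half_trace l by rewrite divr_gt0 // addr_gt0 // invr_gt0.
set f := B P _ in lt; set C := half_trace l in lt C0.
have d0 : 0 < C - f by rewrite subr_gt0.
pose w := 1 + C / (C - f); have w1 : 1 <= w by rewrite lerDl divr_ge0 // ltW.
have w0 : 0 < w by exact: lt_le_trans w1.
have sw := push_sheet nn sP w0.
have := sheet_ge1 sw (sheetA sw).
rewrite (push_displacement nn sP w0 adj ln0 nA nA') -/C -/f.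
have : C <= w ^+ 2 * (C - f).
  apply: (@le_trans _ _ (w * (C - f))).
    by rewrite /w mulrDl mul1r divfK ?gt_eqF // lerDr ltW.
  by rewrite ler_pM2r // expr2 -[leLHS]mulr1 ler_pM2l.
move: (w ^+ 2) => W; lra.
Qed.

Lemma null_part_null P : sheet P ->
  [/\ B (null_part n P) (null_part n P) = 0, B n (null_part n P) = B n P &
      B P (P *m A) = half_trace l + B (null_part n P) (null_part n P *m A)].
Proof.
move=> sP; have nP := lorentz_null_gt0 nn sP; case: (sP) => PP _.
have bn : B n P != 0 by rewrite gt_eqF.
have e1 : B n (P *m A) = l^-1 * B n P.
  by rewrite lorentzC adj nA' lorentzE lorentzC.
rewrite /null_part; split.
- by rewrite !lorentzE n0 PP (lorentzC P n); field.
- by rewrite !lorentzE n0; ring.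
- rewrite mulmxBl -scalemxAl nA !lorentzE n0 e1 (lorentzC P n) /half_trace.
  by field; rewrite bn.
Qed.

(** At the minimum the null part is orthogonal to its image, hence proportional to it; invariance of
    the product with [n] gives the factor [l^-1]. *)
Lemma axis_eigen P : sheet P -> B P (P *m A) = half_trace l ->
  null_part n P *m A = l^-1 *: null_part n P.
Proof.
move=> sP; case: (null_part_null sP); move: (null_part n P) => m mm nm ->.
have nP := lorentz_null_gt0 nn sP.
move/eqP; rewrite -subr_eq0 addrAC subrr add0r => /eqP mA.
have m0 : m != 0 by apply: contraTneq nP => m0; rewrite -nm m0 lorentzC lorentz0l ltxx.
have [k kE] : exists k, m *m A = k *: m by apply: null_orthogonal; rewrite ?isoA.
have : B (n *m A) (m *m A) = B n m by rewrite isoA.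
rewrite kE nA !lorentzE nm mulrA => /eqP; rewrite -[X in _ == X]mul1r.
have bn : B n P != 0 by rewrite gt_eqF.
rewrite (inj_eq (mulIf bn)) => /eqP lk; congr (_ *: _).
by apply: (mulfI ln0); rewrite lk divff.
Qed.

(** The null parts of [P] and [Q] are null eigenvectors for [l^-1]. By invariance of [B] and
    [l != 1] they are orthogonal, hence proportional. *)
Lemma axis_span P Q : sheet P -> sheet Q -> l != 1 ->
  B P (P *m A) = half_trace l -> B Q (Q *m A) = half_trace l ->
  exists s t, Q = s *: n + t *: null_part n P.
Proof.
move=> sP sQ l1 aP aQ; have [mm nm _] := null_part_null sP.
have [mm' nm' _] := null_part_null sQ; have nP := lorentz_null_gt0 nn sP.
have [eP eQ] := (axis_eigen sP aP, axis_eigen sQ aQ).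
have m0 : null_part n P != 0.
  by apply: contraTneq nP => m0; rewrite -nm m0 lorentzC lorentz0l ltxx.
have QE : Q = (2 * B n Q)^-1 *: n + null_part n Q by rewrite addrC subrK.
move: (null_part n P) (null_part n Q) mm mm' eP eQ m0 QE {nm nm'} => m m' mm mm' mA mA' m0 QE.
have mo : B m m' = 0.
  have := isoA m m'; rewrite mA mA' !lorentzE mulrA => /eqP.
  rewrite -subr_eq0 -[X in _ - X]mul1r -mulrBl mulf_eq0 => /orP[|/eqP //].
  rewrite subr_eq0 -expr2 sqrf_eq1 => /orP[/eqP e|/eqP e].
    by move: l1; rewrite -[l]invrK e invr1 eqxx.
  have : 0 < l^-1 by rewrite invr_gt0.
  by rewrite e oppr_gt0 ltNge ler01.
have [k kE] := null_orthogonal m0 mm mm' mo.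
by exists (2 * B n Q)^-1, k; rewrite -kE.
Qed.

End Axis.

Lemma common_orthogonal x y z : exists2 u : V, u != 0 & [/\ B u x = 0, B u y = 0 & B u z = 0].
Proof.
pose J (v : V) : 'cV[R]_4 := \col_i nth 0 [:: - v 0 0; - v 0 1; v 0 3 / 2; v 0 2 / 2] i.
have JE (u v : V) : u *m J v = (B u v)%:M.
  apply/matrixP => i j; rewrite !ord1 !mxE sum4 !mxE /= /lorentz.
  by field.
pose M : 'M[R]_(4, 1 + (1 + 1)) := row_mx (J x) (row_mx (J y) (J z)).
have : kermx M != 0.
  rewrite kermx_eq0; apply/negP => /eqP rM; have := rank_leq_col M.
  by rewrite rM.
move=> /rowV0Pn[u /sub_kermxP uM u0]; exists u => //.
move: uM; rewrite /M !mul_mx_row !JE -row_mx0 => /eq_row_mx[e1].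
rewrite -row_mx0 => /eq_row_mx[e2 e3].
have sc (a : R) : a%:M = 0 :> 'M[R]_1 -> a = 0.
  by move=> /matrixP/(_ 0 0); rewrite !mxE eqxx.
by split; apply: sc.
Qed.

End NullVectors.

Section VectorContinuity.
Variables (R : realType) (T : topologicalType).
Local Notation V := 'rV[R]_4.
Local Notation B := (@lorentz R).
Implicit Types (t : T) (F G : T -> V).

Definition vcontinuous t F : Prop := forall i, continuous_at t (fun s => F s 0 i : R).

Lemma vcontinuous_cst t (v : V) : vcontinuous t (fun=> v).
Proof. by move=> i; exact: continuous_at_cst. Qed.

Lemma vcontinuous_mulmx t F (A : 'M[R]_4) : vcontinuous t F ->
  vcontinuous t (fun s => F s *m A).
Proof.
move=> cF i; rewrite (_ : (fun s => _) = fun s => F s 0 0 * A 0 i + F s 0 1 * A 1 i +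
  F s 0 2 * A 2 i + F s 0 3 * A 3 i); last by apply/funext => s; rewrite mxE sum4.
by do ![apply: continuous_at_add|apply: continuous_at_mul|exact: continuous_at_cst|exact: cF].
Qed.

Lemma vcontinuous_add t F G : vcontinuous t F -> vcontinuous t G ->
  vcontinuous t (fun s => F s + G s).
Proof.
move=> cF cG i; under [fun s => _]funext do rewrite mxE.
exact: continuous_at_add.
Qed.

Lemma vcontinuous_scale t (k : T -> R) F : continuous_at t k -> vcontinuous t F ->
  vcontinuous t (fun s => k s *: F s).
Proof.
move=> ck cF i; under [fun s => _]funext do rewrite mxE.
exact: continuous_at_mul.
Qed.

Lemma lorentz_continuous t F G : vcontinuous t F -> vcontinuous t G ->
  continuous_at t (fun s => B (F s) (G s)).
Proof.
move=> cF cG; rewrite /lorentz.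
apply: continuous_at_sub; last exact: continuous_at_mul.
apply: continuous_at_sub; last exact: continuous_at_mul.
apply: continuous_at_mul; last exact: continuous_at_cst.
by apply: continuous_at_add; exact: continuous_at_mul.
Qed.

End VectorContinuity.

Lemma ord4_ind (P : 'I_4 -> Prop) : P 0 -> P 1 -> P 2 -> P 3 -> forall i, P i.
Proof.
move=> P0 P1 P2 P3 [[|[|[|[|//]]]] i4].
- by rewrite (_ : Ordinal i4 = 0) //; exact: val_inj.
- by rewrite (_ : Ordinal i4 = 1) //; exact: val_inj.
- by rewrite (_ : Ordinal i4 = 2) //; exact: val_inj.
- by rewrite (_ : Ordinal i4 = 3) //; exact: val_inj.
Qed.

Section ClusterPoint.
Local Open Scope classical_set_scope.
Variable R : realType.

(** Replaces the passage to a convergent subsequence. *)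
Lemma cluster_limit0 (T : topologicalType) (F : set_system T) {FF : Filter F}
    (phi : T -> R) n : cluster F n -> continuous_at n phi ->
  (forall e : R, 0 < e -> F [set v | `|phi v| < e]) -> phi n = 0.
Proof.
move=> cl cphi lim; apply/eqP; rewrite -normr_le0 leNgt; apply/negP => e0.
have e2 : 0 < `|phi n| / 2 by rewrite divr_gt0.
have nb : nbhs n [set v | `|phi n - phi v| < `|phi n| / 2].
  exact: (cphi _ (nbhsx_ballx (phi n) _ e2)).
have [v [/= v1 v2]] := cl _ _ (lim _ e2) nb.
by have := ler_normD (phi n - phi v) (phi v); rewrite subrK; lra.
Qed.

Lemma finite_nat_bounded (S : set nat) : finite_set S ->
  exists N, forall m, S m -> (m < N)%N.
Proof.
move=> /finite_seqP[l ->]; exists (\max_(i <- l) i).+1 => m /= ml.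
by rewrite ltnS; exact: leq_bigmax_seq.
Qed.

End ClusterPoint.

(** * Ideal points fixed by centralizers *)

Section IdealFixedPoint.
Local Open Scope classical_set_scope.
Variables (R : realType) (G : groupType) (act : G -> hyp3 R -> hyp3 R).
Hypothesis actP : free_isometric_action act.
Hypothesis torsion_free : forall (a : G) k, (0 < k)%N -> (a ^+ k = 1)%g -> (a = 1)%g.
Local Notation B := (@lorentz R).
Local Notation V := 'rV[R]_4.
Let O : hyp3 R := base_pt R 0.
Let e : V := iota3 O.

Let eB (v : V) : B e v = (v 0 2 + v 0 3) / 2.
Proof. by rewrite /e base_ptE /base_vec /= /lorentz !vec4E; lra. Qed.

Lemma act_mx_sheet (a : G) (v : V) : sheet v -> sheet (v *m act_mx act a).
Proof. by move=> /sheet_iota3[p <-]; rewrite act_mx_iota //; exact: iota3_sheet. Qed.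

Lemma expg_inj (a : G) i j : a != 1%g -> (a ^+ i = a ^+ j)%g -> i = j.
Proof.
move=> a1; wlog ij : i j / (i <= j)%N => [th|].
  by case/orP: (leq_total i j) => [/th//|/th h] /esym/h/esym.
move=> e1; apply/eqP; rewrite eqn_leq ij /= -subn_eq0; apply: contraNT a1.
rewrite -lt0n => /torsion_free h; apply/eqP/h.
by apply: (mulgI (a ^+ i)%g); rewrite -expgnDr subnKC // mulg1 e1.
Qed.

(** The images of [e] under the powers of [a] leave every ball, and [n] is a cluster point of their
    rescalings [v m]. If [b] commutes with [a], then [B (v m *m act_mx act b) (v m)] is a constant
    over [th m ^+ 2], so in the limit the null vector [n] is orthogonal to its image and therefore
    proportional to it. The construction depends on [a] alone, so one [n] serves the whole
    centralizer. *)
Lemma ideal_fixed_point (a : G) : a != 1%g -> exists n : V, [/\ null_vec n, B e n = 1 &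
  forall b, commute a b -> exists2 l, 0 < l & n *m act_mx act b = l *: n].
Proof.
move=> a1; pose A m := act_mx act (a ^+ m)%g; pose th m : R := B e (e *m A m).
have thE m : th m = hcosh O (act (a ^+ m)%g O) by rewrite /th act_mx_disp.
have th1 m : 1 <= th m by rewrite thE hcosh_ge1.
have thoo (K : R) : \forall m \near \oo, K < th m.
  pose K' := Num.max 1 K; have K1 : 1 <= K' by rewrite le_max lexx.
  case: (actP) => _ _ _ /(_ O (arcosh K')) fin.
  have [N NP] := finite_nat_bounded (@finite_preimage _ _ _ (fun m => a ^+ m)%g
    (fun i j _ _ => @expg_inj a i j a1) fin).
  exists N => // m /= Nm; apply: (@le_lt_trans _ _ K'); first by rewrite le_max lexx orbT.
  rewrite ltNge thE; apply/negP => h; suff /NP : [set m | hdist O (act (a ^+ m)%g O) <= arcosh K'] m.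
    by rewrite ltnNge Nm.
  by rewrite /= hdist_leP ?arcosh_ge0 // cosh_arcosh.
pose v m : V := (th m)^-1 *: (e *m A m).
have th0 m : 0 < th m by exact: lt_le_trans (th1 m).
have vsheet m : sheet (e *m A m) by apply/act_mx_sheet/iota3_sheet.
have ev m : B e (v m) = 1 by rewrite lorentzZr mulVf // gt_eqF.
have v2 m : 0 <= v m 0 2 by case: (vsheet m) => _ h; rewrite mxE mulr_ge0 ?invr_ge0 ?ltW.
have v3 m : 0 <= v m 0 3.
  rewrite mxE mulr_ge0 ?invr_ge0 ?(ltW (th0 m)) //; case: (vsheet m).
  move: (e *m _) => u; rewrite /lorentz => uu u2; rewrite -(pmulr_rge0 _ u2).
  by have := sqr_ge0 (u 0 0); have := sqr_ge0 (u 0 1); lra.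
have vv m : B (v m) (v m) = (th m)^-1 ^+ 2.
  by rewrite !lorentzE; case: (vsheet m) => -> _; ring.
(* [B e (v m) = 1] says that the two nonnegative null coordinates add up to [2];
   [B (v m) (v m) >= 0] then bounds the others. *)
pose box := [set u : V | forall i, `[(-2)%R, 2%R]%classic (u ord0 i)].
have vbox m : box (v m).
  have e1 := ev m; rewrite eB in e1; have w := vv m; have w0 := sqr_ge0 (th m)^-1.
  have := (v2 m, v3 m); rewrite -w in w0; clear w; move: (v m) e1 w0 => u e1 w0 [u2 u3].
  have h : u 0 0 ^+ 2 + u 0 1 ^+ 2 <= 4 by move: w0; rewrite /lorentz; nra.
  have lo (x y : R) : x ^+ 2 + y ^+ 2 <= 4 -> -2 <= x <= 2.
    by move=> xy; have := sqr_ge0 y => y0; apply/andP; split; nra.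
  have u00 := sqr_ge0 (u 0 0); have u11 := sqr_ge0 (u 0 1).
  rewrite /box /=; apply: ord4_ind; rewrite /= in_itv /=.
  - exact: lo h.
  - by apply: (lo _ (u 0 0)); lra.
  - by apply/andP; split; lra.
  - by apply/andP; split; lra.
have cbox := @rV_compact R 4 (fun=> `[(-2)%R, 2%R]%classic) (fun=> @segment_compact R _ _).
have FB : (v @ \oo) box by exists 0%N => // m _; exact: vbox.
have [n [_ cl]] := cbox (v @ \oo) _ FB.
have cn : vcontinuous n (fun u : V => u) by move=> i; exact: coord_continuous.
have lim0 (phi : V -> R) : continuous_at n phi ->
    (forall eps : R, 0 < eps -> \forall m \near \oo, `|phi (v m)| < eps) -> phi n = 0.
  exact: cluster_limit0 cl.
have neg (phi : V -> R) : continuous_at n phi -> (forall m, 0 <= phi (v m)) -> 0 <= phi n.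
  move=> cphi p0; have : Num.max 0 (0 - phi n) = 0.
    apply: (lim0 (fun u => Num.max 0 (0 - phi u))).
      by apply: continuous_at_max; [|apply: continuous_at_sub => //]; exact: continuous_at_cst.
    by move=> eps eps0; near=> m; rewrite max_l ?normr0 // sub0r oppr_le0.
  by move/eqP; rewrite sub0r eq_le ge_max lexx oppr_le0 => /andP[].
have en : B e n = 1.
  apply/eqP; rewrite -subr_eq0; apply/eqP; apply: (lim0 (fun u => B e u - 1)).
    apply: continuous_at_sub; last exact: continuous_at_cst.
    by apply: lorentz_continuous => //; exact: vcontinuous_cst.
  by move=> eps eps0; near=> m; rewrite ev subrr normr0.
have nb b : commute a b -> B (n *m act_mx act b) n = 0.
  move=> ab; apply: (lim0 (fun u => B (u *m act_mx act b) u)).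
    by apply: lorentz_continuous => //; exact: vcontinuous_mulmx.
  move=> eps eps0; pose K := B (e *m act_mx act b) e.
  have vE m : B (v m *m act_mx act b) (v m) = K * (th m)^-1 ^+ 2.
    rewrite -scalemxAl !lorentzE -mulmxA -act_mxM // (_ : (_ * b)%g = (b * a ^+ m)%g).
      by rewrite act_mxM // mulmxA act_mx_lorentz // -/K; ring.
    by apply/esym/commuteX/commute_sym.
  near=> m; rewrite vE.
  have thm : `|K| / eps < th m by near: m; exact: thoo.
  rewrite normrM [X in _ * X]ger0_norm ?sqr_ge0 //.
  apply: (@le_lt_trans _ _ (`|K| * (th m)^-1)).
    rewrite ler_wpM2l // expr2 -[leRHS]mulr1 ler_pM2l ?invr_gt0 //.
    by rewrite invf_le1.
  by rewrite ltr_pdivrMr // mulrC -ltr_pdivrMr.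
have nn : B n n = 0.
  by have := nb 1%g (commute1 _); rewrite act_mx1 // mulmx1.
have null : null_vec n.
  split=> //; [exact: (neg (fun u => u 0 2))|exact: (neg (fun u => u 0 3))|].
  by move: en; rewrite eB; lra.
exists n; split=> // b ab.
have n0 : n != 0 by apply: contra_eqN en => /eqP->; rewrite lorentzC lorentz0l eq_sym oner_eq0.
have [k kE] : exists k, n *m act_mx act b = k *: n.
  apply: null_orthogonal => //; first by rewrite act_mx_lorentz.
  by rewrite lorentzC; exact: nb.
exists k => //; have : 0 < B (n *m act_mx act b) e.
  by rewrite act_mxV // lorentz_null_gt0 //; apply/act_mx_sheet/iota3_sheet.
by rewrite kE lorentzE lorentzC en mulr1.
Unshelve. all: by end_near.
Qed.

End IdealFixedPoint.

Lemma near_seq (T : topologicalType) (I : eqType) (t : T) (s : seq I) (P : I -> T -> Prop) :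
  {in s, forall i, \forall x \near t, P i x} -> \forall x \near t, {in s, forall i, P i x}.
Proof.
elim: s => [|i s IH] h; first by near=> x => j.
have h1 : \forall x \near t, P i x by apply: h; rewrite mem_head.
have h2 : \forall x \near t, {in s, forall i, P i x}.
  by apply: IH => j js; apply: h; rewrite inE js orbT.
near=> x => j; rewrite inE => /orP[/eqP->|]; first by near: x.
by move: j; near: x.
Unshelve. all: by end_near.
Qed.

Lemma bigmax_seq_le (R : realType) (I : eqType) (s : seq I) (f : I -> R) m :
  1 <= m -> {in s, forall i, f i <= m} -> \big[Num.max/1]_(i <- s) f i <= m.
Proof.
move=> m1; elim: s => [|i s IH] fm; first by rewrite big_nil.
rewrite big_cons ge_max fm ?mem_head //= IH // => j js.
by apply: fm; rewrite inE js orbT.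
Qed.

Lemma continuous_at_bigmax (R : realType) (T : topologicalType) (t : T) (I : eqType)
    (s : seq I) (f : I -> T -> R) : {in s, forall i, continuous_at t (f i)} ->
  continuous_at t (fun x => \big[Num.max/1]_(i <- s) f i x).
Proof.
elim: s => [|i s IH] h.
  rewrite (_ : (fun _ => _) = fun=> 1); first exact: continuous_at_cst.
  by apply/funext => x; rewrite big_nil.
rewrite (_ : (fun _ => _) = fun x => Num.max (f i x) (\big[Num.max/1]_(i <- s) f i x)).
  apply: continuous_at_max; first by apply: h; rewrite mem_head.
  by apply: IH => j js; apply: h; rewrite inE js orbT.
by apply/funext => x; rewrite big_cons.
Qed.

Lemma continuous_at_gt (R : realType) (T : topologicalType) (t : T) (f : T -> R) a :
  continuous_at t f -> a < f t -> \forall x \near t, a < f x.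
Proof. by move=> cf ft; apply: (cvgr_gt _ cf). Qed.

Lemma continuous_at_lt (R : realType) (T : topologicalType) (t : T) (f : T -> R) a :
  continuous_at t f -> f t < a -> \forall x \near t, f x < a.
Proof. by move=> cf ft; apply: (cvgr_lt _ cf). Qed.

Lemma hdist_near (R : realType) (T : topologicalType) (t : T) (g : T -> hyp3 R) d :
  vcontinuous t (fun s => iota3 (g s)) -> 0 < d ->
  \forall s \near t, hdist (g t) (g s) < d.
Proof.
move=> cg d0; have c : continuous_at t (fun s => lorentz (iota3 (g t)) (iota3 (g s))).
  by apply: lorentz_continuous => //; exact: vcontinuous_cst.
have := @continuous_at_lt _ _ _ _ (coshR d) c.
rewrite -[X in X < _]/(hcosh _ _) hcoshxx -(coshR0 R) ltr_coshR ?nnegrE // ?ltW //.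
move=> /(_ d0) h; near=> s; rewrite hdist_ltP ?(ltW d0) //; near: s; exact: h.
Unshelve. all: by end_near.
Qed.

Lemma timelike_pt (R : realType) (v : 'rV[R]_4) : 0 < lorentz v v -> 0 < v 0 2 ->
  exists p, iota3 p = (Num.sqrt (lorentz v v))^-1 *: v.
Proof.
move=> vv v2; have s0 : 0 < Num.sqrt (lorentz v v) by rewrite sqrtr_gt0.
apply: sheet_iota3; split; last by rewrite mxE mulr_gt0 // invr_gt0.
rewrite !lorentzE mulrA -invfM -expr2 sqr_sqrtr ?(ltW vv) // mulVf //.
by rewrite gt_eqF.
Qed.

(** * Geodesic segments *)

Section Segments.
Variable R : realType.
Local Notation B := (@lorentz R).
Implicit Types (p q : hyp3 R) (t : R).

(** Clamping makes segments paths over the whole real line; written with maxima, it is continuous by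
    [continuous_at_max]. *)
Definition unit_clamp t : R := Num.max 0 (1 - Num.max 0 (1 - t)).

Lemma unit_clamp_itv t : 0 <= unit_clamp t <= 1.
Proof.
rewrite /unit_clamp le_max lexx /= ge_max ler01 /= lerBlDr lerDl le_max lexx //.
Qed.

Lemma unit_clamp0 : unit_clamp 0 = 0.
Proof. by rewrite /unit_clamp subr0 [X in 1 - X]max_r // subrr max_l. Qed.

Lemma unit_clamp1 : unit_clamp 1 = 1.
Proof. by rewrite /unit_clamp subrr maxxx subr0 max_r. Qed.

Lemma unit_clamp_continuous t : continuous_at t unit_clamp.
Proof.
apply: continuous_at_max; first exact: continuous_at_cst.
apply: continuous_at_sub; first exact: continuous_at_cst.
apply: continuous_at_max; first exact: continuous_at_cst.
by apply: continuous_at_sub; [exact: continuous_at_cst|exact: cvg_id].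
Qed.

Definition seg_vec p q t := (1 - t) *: iota3 p + t *: iota3 q.

Lemma seg_vec_ge1 p q t : 0 <= t <= 1 -> 1 <= B (seg_vec p q t) (seg_vec p q t).
Proof.
move=> /andP[t0 t1]; have pq := hcosh_ge1 p q; rewrite /hcosh in pq.
have [[pp _] [qq _]] := (iota3_sheet p, iota3_sheet q).
rewrite /seg_vec !lorentzE pp qq (lorentzC (iota3 q)).
have : 0 <= t * (1 - t) * (B (iota3 p) (iota3 q) - 1).
  by rewrite !mulr_ge0 ?subr_ge0.
lra.
Qed.

Lemma seg_exists p q t : exists x, iota3 x =
  (Num.sqrt (B (seg_vec p q (unit_clamp t)) (seg_vec p q (unit_clamp t))))^-1 *:
    seg_vec p q (unit_clamp t).
Proof.
have /andP[u0 u1] := unit_clamp_itv t; apply: timelike_pt.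
  by apply: lt_le_trans (seg_vec_ge1 p q (unit_clamp_itv t)).
have [[_ p2] [_ q2]] := (iota3_sheet p, iota3_sheet q).
rewrite /seg_vec; move: (iota3 p) (iota3 q) p2 q2 => x y x2 y2; rewrite !mxE.
have [->|un] := eqVneq (unit_clamp t) 0; first by rewrite subr0 mul1r mul0r addr0.
have a : 0 <= (1 - unit_clamp t) * x 0 2 by apply: mulr_ge0 (ltW x2); rewrite subr_ge0.
have b : 0 < unit_clamp t * y 0 2 by rewrite mulr_gt0 // lt_def un.
exact: ltr_wpDl a b.
Qed.

Definition seg p q t : hyp3 R := sval (cid (seg_exists p q t)).

Lemma segE p q t : exists2 k, 0 < k <= 1 & iota3 (seg p q t) = k *: seg_vec p q (unit_clamp t).
Proof.
rewrite /seg; case: (cid _) => x /= ->; eexists; last reflexivity.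
have h := seg_vec_ge1 p q (unit_clamp_itv t).
have s1 : 1 <= Num.sqrt (B (seg_vec p q (unit_clamp t)) (seg_vec p q (unit_clamp t))).
  by rewrite -[leLHS]sqrtr1 ler_sqrt // (le_trans ler01).
by rewrite invr_gt0 (lt_le_trans ltr01) //= invf_le1 // (lt_le_trans ltr01).
Qed.

Lemma seg_eq p q t x k : 0 < k -> iota3 x = k *: seg_vec p q (unit_clamp t) -> seg p q t = x.
Proof.
move=> k0 xE; have [l /andP[l0 _] sE] := segE p q t; apply: iota3_inj.
have [xx _] := iota3_sheet x; have [ss _] := iota3_sheet (seg p q t).
rewrite xE sE in xx ss *; congr (_ *: _).
have c0 : 0 < B (seg_vec p q (unit_clamp t)) (seg_vec p q (unit_clamp t)).
  by apply: lt_le_trans (seg_vec_ge1 p q (unit_clamp_itv t)).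
rewrite !(lorentzZl, lorentzZr) !mulrA in xx ss; have /eqP := mulIf (lt0r_neq0 c0) (etrans xx (esym ss)).
by rewrite -!expr2 eqrXn2 ?(ltW k0) ?(ltW l0) // => /eqP.
Qed.

Lemma seg0 p q : seg p q 0 = p.
Proof.
by apply: (@seg_eq _ _ _ _ 1) => //; rewrite unit_clamp0 /seg_vec subr0 scale0r addr0 !scale1r.
Qed.

Lemma seg1 p q : seg p q 1 = q.
Proof.
by apply: (@seg_eq _ _ _ _ 1) => //; rewrite unit_clamp1 /seg_vec subrr scale0r add0r !scale1r.
Qed.

Lemma seg_hcosh p q t : hcosh p (seg p q t) <= hcosh p q.
Proof.
have [k /andP[k0 k1] sE] := segE p q t; have /andP[u0 u1] := unit_clamp_itv t.
rewrite {1}/hcosh sE /seg_vec !lorentzE; have := hcosh_ge1 p q; rewrite /hcosh.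
case: (iota3_sheet p) => -> _; set c := B _ _ => c1; rewrite mulr1.
apply: (@le_trans _ _ (1 * ((1 - unit_clamp t) + unit_clamp t * c))).
  rewrite ler_wpM2r // addr_ge0 ?subr_ge0 // mulr_ge0 //; lra.
move: (unit_clamp t) u0 u1 => u u0 u1; rewrite mul1r; nra.
Qed.

Lemma seg_vcontinuous p q t : vcontinuous t (fun s => iota3 (seg p q s)).
Proof.
have cu := @unit_clamp_continuous t.
have cv : vcontinuous t (fun s => seg_vec p q (unit_clamp s)).
  apply: vcontinuous_add; apply: vcontinuous_scale; try exact: vcontinuous_cst => //.
    by apply: continuous_at_sub => //; exact: continuous_at_cst.
  exact: cu.
rewrite (_ : (fun s => _) = fun s =>
  (Num.sqrt (B (seg_vec p q (unit_clamp s)) (seg_vec p q (unit_clamp s))))^-1 *: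
    seg_vec p q (unit_clamp s)); last first.
  by apply/funext => s; rewrite /seg; case: (cid _).
apply: vcontinuous_scale => //; apply: continuous_at_inv.
  rewrite gt_eqF // sqrtr_gt0; apply: lt_le_trans (seg_vec_ge1 p q (unit_clamp_itv t)).
  exact: ltr01.
by apply: continuous_at_sqrt; exact: lorentz_continuous.
Qed.

End Segments.

Lemma locally_constant (R : realType) (P : R -> Prop) :
  (forall t : R, \forall s \near t, P s <-> P t) -> P 0 -> P 1.
Proof.
move=> loc P0.
have op (Q : R -> Prop) : (forall t : R, \forall s \near t, Q s <-> Q t) -> open [set t | Q t]%classic.
  move=> locQ; rewrite openE => t /= Qt; have h := locQ t.
  by rewrite /interior /=; near=> s; apply/(near h s) => //.
have conn : connected [set: R] by apply/connected_intervalP => ? ? _ _ ? _.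
suff e : [set t | P t]%classic = setT by have : [set: R]%classic 1 by []; rewrite -e.
apply: conn; first by exists 0.
  by exists [set t | P t]%classic; [exact: op|rewrite setTI].
exists [set t | P t]%classic; last by rewrite setTI.
rewrite -openC; apply: (op (fun t => ~ P t)) => t.
near=> s; have h : P s <-> P t by near: s; exact: loc.
by split=> n ?; apply: n; apply/h.
Unshelve. all: by end_near.
Qed.

(** Among the points [1 / (k + 1)] there are more candidates than the polynomial can have roots. *)
Lemma poly_nonroot (R : realType) (p : {poly R}) : p != 0 ->
  exists2 s, 0 < s <= 1 & p.[s] != 0.
Proof.
move=> p0; apply: contrapT => no.
pose r := [seq (k.+1%:R : R)^-1 | k <- iota 0 (size p)].
have ur : uniq r.
  rewrite map_inj_uniq ?iota_uniq // => i j /invr_inj /eqP.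
  by rewrite eqr_nat eqSS => /eqP.
have := max_poly_roots p0 _ ur; rewrite size_map size_iota ltnn => h.
suff /h : all (root p) r by [].
apply/allP => _ /mapP[k _ ->]; apply/eqP/eqP; apply: contrapT => /negP pk; apply: no.
by exists k.+1%:R^-1; rewrite ?invr_gt0 ?ltr0Sn ?invf_le1 ?ltr0Sn ?ler1n.
Qed.

(** * Generic points from a moment curve *)

Section MomentCurve.
Variable R : realType.
Local Notation V := 'rV[R]_4.
Local Notation B := (@lorentz R).
Implicit Types (s : R) (u : V).

(* A timelike curve contained in no finite union of hyperplanes. *)
Definition moment_vec s : V := vec4 s (s ^+ 2) 1 (1 + s ^+ 2 + s ^+ 3 + s ^+ 4).

Definition moment_poly u : {poly R} := ((u 0 2 + u 0 3) / 2)%:P - (u 0 0)%:P * 'X +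
  (u 0 2 / 2 - u 0 1)%:P * 'X^2 + (u 0 2 / 2)%:P * 'X^3 + (u 0 2 / 2)%:P * 'X^4.

Lemma moment_polyE u s : (moment_poly u).[s] = B u (moment_vec s).
Proof. by rewrite /moment_poly !(hornerE, hornerXn) /lorentz /moment_vec !vec4E /=; field. Qed.

Lemma moment_poly_neq0 u : u != 0 -> moment_poly u != 0.
Proof.
move=> u0; apply: contraNneq u0 => /polyP e; apply/eqP.
have := (e 0, e 1, e 2, e 3)%N; rewrite /moment_poly !coefE /= => -[[[e0 e1] e2] e3].
by apply: vec4P; rewrite !mxE; lra.
Qed.

Lemma moment_generic (l : seq V) : {in l, forall u, u != 0} ->
  exists2 s, 0 < s <= 1 & {in l, forall u, B u (moment_vec s) != 0}.
Proof.
move=> l0; have [|s s01] := @poly_nonroot R (\prod_(u <- l) moment_poly u).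
  by rewrite prodf_seq_neq0; apply/allP => u ul /=; apply/moment_poly_neq0/l0.
rewrite horner_prod prodf_seq_neq0 => /allP h; exists s => // u ul.
by rewrite -moment_polyE; exact: h.
Qed.

Lemma moment_timelike s : 0 < s -> 1 <= B (moment_vec s) (moment_vec s).
Proof.
move=> s0; rewrite /lorentz /moment_vec !vec4E; have := exprn_gt0 3 s0; lra.
Qed.

Lemma moment_pt s : 0 < s -> exists2 k, 0 < k <= 1 & exists r, iota3 r = k *: moment_vec s.
Proof.
move=> s0; have m1 := moment_timelike s0.
have [|r rE] := @timelike_pt R (moment_vec s) (lt_le_trans ltr01 m1).
  by rewrite /moment_vec vec4E.
exists (Num.sqrt (B (moment_vec s) (moment_vec s)))^-1; last by exists r.
have s1 : 1 <= Num.sqrt (B (moment_vec s) (moment_vec s)).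
  by rewrite -[leLHS]sqrtr1 ler_sqrt // (le_trans ler01).
by rewrite invr_gt0 (lt_le_trans ltr01) //= invf_le1 // (lt_le_trans ltr01).
Qed.

(** The bound is uniform in [s], so the finitely many hyperplanes to be avoided are known before [s]
    is chosen. *)
Lemma moment_bounded u : exists M, forall s, 0 < s <= 1 -> B u (moment_vec s) <= M.
Proof.
exists (`|u 0 0| + `|u 0 1| + `|u 0 2| * 3 + `|u 0 3|) => s /andP[s0 s1].
rewrite /lorentz /moment_vec !vec4E.
have h (a c : R) : 0 <= c <= 1 -> a * c <= `|a| /\ - `|a| <= a * c.
  move=> /andP[c0 c1]; have := ler_norm a; have := ler_norm (- a); rewrite normrN.
  have := normr_ge0 a; move: `|a| => b b0 a1 a2; nra.
have p k : 0 <= s ^+ k <= 1 by rewrite exprn_ge0 ?(ltW s0) // exprn_ile1 ?(ltW s0).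
have p1 : 0 <= s <= 1 by rewrite (ltW s0).
have [_ h0] := h (u 0 0) _ p1; have [_ h1] := h (u 0 1) _ (p 2%N).
have [h2 _] := h (u 0 2) _ (p 2%N); have [h3 _] := h (u 0 2) _ (p 3%N).
have [h4 _] := h (u 0 2) _ (p 4%N).
have := ler_norm (u 0 2); have := ler_norm (u 0 3); have := normr_ge0 (u 0 2).
have := normr_ge0 (u 0 3).
move: `|u 0 0| `|u 0 1| `|u 0 2| `|u 0 3| h0 h1 h2 h3 h4 => a b c d; lra.
Qed.

End MomentCurve.

(** * Retraction onto the thick part *)

Section ThickPart.
Local Open Scope classical_set_scope.
Variables (R : realType) (G : groupType) (act : G -> hyp3 R -> hyp3 R) (eps : R).
Hypothesis actP : free_isometric_action act.
Hypothesis torsion_free : forall (a : G) k, (0 < k)%N -> (a ^+ k = 1)%g -> (a = 1)%g.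
Hypothesis commute_trans : forall a b c : G, b != 1%g -> commute a b ->
  commute b c -> commute a c.
Hypothesis eps0 : 0 < eps.
Hypothesis short_commute : forall (p : hyp3 R) (a b : G), hdist p (act a p) <= eps ->
  hdist p (act b p) <= eps -> commute a b.
Local Notation B := (@lorentz R).
Local Notation V := 'rV[R]_4.
Local Notation K := (coshR eps).
Local Notation mx := (act_mx act).
Implicit Types (a b c : G) (p q : hyp3 R) (P Q n : V) (E : seq G).

Let fixes a : set V := [set n | [/\ null_vec n, B (iota3 (base_pt R 0)) n = 1 &
  forall b, commute a b -> exists2 l, 0 < l & n *m mx b = l *: n]].

(* The chosen fixed ideal point depends only on the centralizer of [a]. *)
Definition ideal a : V := xget (vec4 0 0 0 2) (fixes a).

Lemma ideal_null a : null_vec (ideal a).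
Proof.
rewrite /ideal; case: xgetP => [n -> []//|_].
by split; rewrite ?/lorentz ?vec4E //; lra.
Qed.

Let idealP a : a != 1%g -> fixes a (ideal a).
Proof.
move=> a1; have [n nP] := ideal_fixed_point actP torsion_free a1.
by rewrite /ideal; apply: (@xgetPex _ _ (fixes a)); exists n.
Qed.

Lemma ideal_commute a b : a != 1%g -> b != 1%g -> commute a b -> ideal a = ideal b.
Proof.
move=> a1 b1 ab; rewrite /ideal; congr (xget _ _); apply/seteqP.
by split=> n [nn en h]; split=> // c cc; apply: h;
  [apply: commute_trans b1 ab cc|apply: commute_trans a1 (commute_sym ab) cc].
Qed.

(** The eigenvalue of [ideal a], read off through the normalisation of its product with the base
    point. *)
Definition multiplier a : R := B (iota3 (base_pt R 0)) (ideal a *m mx a).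

Lemma multiplierP a : a != 1%g ->
  [/\ 0 < multiplier a, ideal a *m mx a = multiplier a *: ideal a &
      ideal a *m mx a^-1%g = (multiplier a)^-1 *: ideal a].
Proof.
move=> a1; have [_ en /(_ a (commute_refl a))[l l0 lE]] := idealP a1.
have mE : multiplier a = l by rewrite /multiplier lE lorentzZr en mulr1.
rewrite mE; split=> //; apply: (scalerI (lt0r_neq0 l0)).
rewrite scalerA mulfV ?gt_eqF // scale1r scalemxAl -lE -mulmxA -act_mxM //.
by rewrite mulgV act_mx1 // mulmx1.
Qed.

Definition min_displacement a : R := half_trace (multiplier a).
Local Notation C := min_displacement.
Definition displacement a P : R := B P (P *m mx a).
Local Notation f := displacement.

Lemma displacementE a p : f a (iota3 p) = hcosh p (act a p).
Proof. exact: act_mx_disp. Qed.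

Lemma min_displacement_le a p : a != 1%g -> C a <= f a (iota3 p).
Proof.
move=> a1; have [l0 nA nA'] := multiplierP a1.
apply: (@half_trace_le R (ideal a) (mx a) (mx a^-1%g)) => //.
- exact: ideal_null.
- by move=> x y; rewrite act_mxV.
- exact: act_mx_sheet.
- exact: iota3_sheet.
Qed.

Lemma displacement_push a w p : a != 1%g -> 0 < w ->
  f a (push (ideal a) w (iota3 p)) = C a + w ^+ 2 * (f a (iota3 p) - C a).
Proof.
move=> a1 w0; have [l0 nA nA'] := multiplierP a1.
apply: (@push_displacement R _ _ _ (mx a) (mx a^-1%g)) => //.
- exact: ideal_null.
- exact: iota3_sheet.
- by move=> x y; rewrite act_mxV.
- by rewrite gt_eqF.
Qed.

Definition thick p : Prop := forall a, a != 1%g -> K <= hcosh p (act a p).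

(** Excludes the points where a short element attains its least displacement, which pushing leaves
    unchanged. *)
Definition off_axis p : Prop := forall a, a != 1%g -> f a (iota3 p) < K -> C a < f a (iota3 p).

(** By [displacement_push], the value of [w ^+ 2] that brings the displacement of [a] to [K]. In
    [scale] the maximum with [1] ensures that points only move away from the ideal point. *)
Definition ratio a P : R := (K - C a) / (f a P - C a).
Definition scale E P : R := Num.sqrt (\big[Num.max/1]_(a <- E) ratio a P).

Lemma scale_sqr E P : scale E P ^+ 2 = \big[Num.max/1]_(a <- E) ratio a P.
Proof. by rewrite sqr_sqrtr // (le_trans ler01) // bigmax_ge_id. Qed.

Lemma scale_ge1 E P : 1 <= scale E P.
Proof. by rewrite -[leLHS]sqrtr1 ler_sqrt ?bigmax_ge_id // (le_trans ler01) // bigmax_ge_id. Qed.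

(* [q] is the point of the thick part obtained by pushing [p] away from the ideal
   point fixed by the elements with small displacement at [p]; enlarging [E] by
   elements with displacement at least [eps] has no effect. *)
Definition retract p q : Prop := exists E n,
  [/\ null_vec n,
      {in E, forall a, [/\ a != 1%g, ideal a = n, C a < K & C a < f a (iota3 p)]},
      forall a, a != 1%g -> f a (iota3 p) < K -> a \in E
    & iota3 q = push n (scale E (iota3 p)) (iota3 p)].

Lemma retract_thick_id p : thick p -> retract p p.
Proof.
move=> tp; exists [::], (ideal 1%g); split=> //; first exact: ideal_null.
  by move=> a a1; rewrite displacementE ltNge tp.
by rewrite /scale big_nil sqrtr1 push1.
Qed.

Lemma ratio_le1 a p : C a < K -> K <= f a (iota3 p) -> ratio a (iota3 p) <= 1.
Proof.
by move=> CK Kf; rewrite ler_pdivrMr ?subr_gt0 ?(lt_le_trans CK) // mul1r lerB.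
Qed.

Lemma ratio_gt1 a p : C a < f a (iota3 p) -> f a (iota3 p) < K -> 1 < ratio a (iota3 p).
Proof. by move=> Cf fK; rewrite ltr_pdivlMr ?subr_gt0 // mul1r ltrBlDr subrK. Qed.

(** Elements that are not short at [p] have ratio at most [1] and do not affect the scale. A short
    element determines the ideal point; if there is none, the scale is [1] and any ideal point gives
    [p] itself. *)
Lemma retract_functional p q q' : retract p q -> retract p q' -> q = q'.
Proof.
move=> [E [n [nn EP Eall qE]]] [E' [n' [nn' EP' Eall' qE']]].
have le F F' : {in F, forall a, [/\ a != 1%g, C a < K & C a < f a (iota3 p)]} ->
    (forall a, a != 1%g -> f a (iota3 p) < K -> a \in F') ->
    scale F (iota3 p) <= scale F' (iota3 p).
  move=> FP FP'; rewrite ler_sqrt ?(le_trans ler01) ?bigmax_ge_id //.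
  apply: bigmax_seq_le => [|a aF]; first exact: bigmax_ge_id.
  have [a1 CK Cf] := FP _ aF; have [Kf|fK] := leP K (f a (iota3 p)).
    by apply: le_trans (ratio_le1 CK Kf) _; exact: bigmax_ge_id.
  exact: le_bigmax_seq (FP' _ a1 fK) _.
have sE : scale E (iota3 p) = scale E' (iota3 p).
  by apply/eqP; rewrite eq_le !le // => a => [/EP'[]|/EP[]].
apply: iota3_inj; rewrite qE qE' -sE.
have [[a [a1 fK]]|no] := pselect (exists a, a != 1%g /\ f a (iota3 p) < K).
  by have [_ <- _ _] := EP _ (Eall _ a1 fK); have [_ <- _ _] := EP' _ (Eall' _ a1 fK).
suff -> : scale E (iota3 p) = 1 by rewrite !push1.
apply/eqP; rewrite eq_le scale_ge1 andbT -[leRHS]sqrtr1 ler_sqrt //.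
apply: bigmax_seq_le => // a aE; have [a1 _ CK Cf] := EP _ aE.
by apply: ratio_le1 => //; rewrite leNgt; apply/negP => fK; apply: no; exists a.
Qed.

(** An element [b] attaining the maximal ratio has displacement exactly [K] at [q]. An element [c]
    short at [q] therefore commutes with [b], shares its ideal point and was pushed by the same
    factor, which is at least its own ratio. *)
Lemma retract_thick p q : retract p q -> thick q.
Proof.
move=> [E [n [nn EP Eall qE]]] c c1; rewrite -displacementE leNgt; apply/negP => cK.
have w1 := scale_ge1 E (iota3 p); have w2 := scale_sqr E (iota3 p).
set w := scale E (iota3 p) in qE w1 w2; have w0 : 0 < w by exact: lt_le_trans w1.
have rw a : a \in E -> ratio a (iota3 p) <= w ^+ 2.
  by move=> aE; rewrite w2; exact: le_bigmax_seq aE _.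
have fq a : a != 1%g -> ideal a = n ->
    f a (iota3 q) = C a + w ^+ 2 * (f a (iota3 p) - C a).
  by move=> a1 an; rewrite qE -an displacement_push.
have [we|wn] := eqVneq w 1.
  have qp : q = p by apply: iota3_inj; rewrite qE we push1.
  rewrite qp in cK; have cE := Eall _ c1 cK; have [_ _ _ Cf] := EP _ cE.
  by have := ratio_gt1 Cf cK; rewrite ltNge (le_trans (rw _ cE)) // we expr1n.
have w21 : 1 < w ^+ 2 by rewrite exprn_egt1 // lt_def wn.
have [b bE bw] : exists2 b, b \in E & ratio b (iota3 p) = w ^+ 2.
  move: w21; rewrite w2; elim: (E) => [|a s IH]; first by rewrite big_nil ltxx.
  rewrite big_cons; case: (leP (ratio a (iota3 p)) (\big[Num.max/1]_(j <- s) ratio j (iota3 p))).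
    by move=> _ /IH[b bs <-]; exists b => //; rewrite inE bs orbT.
  by move=> _ _; exists a => //; rewrite mem_head.
have [b1 bn bK bf] := EP _ bE.
have fbq : f b (iota3 q) = K.
  by rewrite (fq _ b1 bn) -bw /ratio divfK ?gt_eqF ?subr_gt0 // addrC subrK.
have eps_ge0 := ltW eps0.
have bc : commute b c.
  by apply: (@short_commute q); rewrite hdist_leP // -displacementE ?fbq // ltW.
have cn : ideal c = n by rewrite -bn; apply/esym/ideal_commute.
have Cc := min_displacement_le p c1.
move: cK; rewrite (fq _ c1 cn); apply/negP; rewrite -leNgt.
have [Kf|fK] := leP K (f c (iota3 p)).
  apply: le_trans Kf _; rewrite -lerBlDl -[leLHS]mul1r ler_wpM2r ?subr_ge0 //.
  exact: ltW.
have cE := Eall _ c1 fK; have [_ _ cK cf] := EP _ cE.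
by have := rw _ cE; rewrite /ratio ler_pdivrMr ?subr_gt0 // lerBlDl.
Qed.

(** Near [t] one set [E] and one ideal point suffice: [E] also contains elements of displacement
    exactly [K] at [y t], which may become short nearby. With both fixed, pushing is continuous. *)
Lemma retract_local (T : topologicalType) (y : T -> hyp3 R) t :
  vcontinuous t (fun s => iota3 (y s)) -> off_axis (y t) ->
  exists g : T -> hyp3 R, (\forall s \near t, retract (y s) (g s)) /\
    forall d, 0 < d -> \forall s \near t, hdist (g t) (g s) < d.
Proof.
move=> cy oy; have e0 := ltW eps0.
have cf a : continuous_at t (fun s => f a (iota3 (y s))).
  by apply: lorentz_continuous => //; exact: vcontinuous_mulmx.
(* An element short at a point within distance [1] of [y t] has displacement at most [eps + 2] at
   [y t]. *)
case: (actP) => _ _ _ /(_ (y t) (eps + 2)) /finite_seqP[L LE].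
pose E := [seq b <- L | [&& b != 1%g, f b (iota3 (y t)) <= K & C b < K]].
have EP a : a \in E -> [/\ a != 1%g, f a (iota3 (y t)) <= K, C a < K & C a < f a (iota3 (y t))].
  rewrite mem_filter => /andP[/and3P[a1 fK CK] _]; split=> //.
  by move: fK; rewrite le_eqVlt => /orP[/eqP-> //|]; exact: oy.
pose n := ideal (head 1%g E).
have nE a : a \in E -> ideal a = n.
  move=> aE; have [a1 fK _ _] := EP _ aE; rewrite /n.
  have hE : head 1%g E \in E by move: aE; case: (E) => // b s _; rewrite mem_head.
  have [b1 fbK _ _] := EP _ hE.
  by apply: ideal_commute => //; apply: (@short_commute (y t)); rewrite hdist_leP // -displacementE.
have nn : null_vec n by exact: ideal_null.
pose H s : V := push n (scale E (iota3 (y s))) (iota3 (y s)).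
have sH s : sheet (H s).
  by apply: push_sheet => //; [exact: iota3_sheet|exact: lt_le_trans (scale_ge1 _ _)].
pose g s := sval (cid (sheet_iota3 (sH s))).
have gE s : iota3 (g s) = H s by rewrite /g; case: cid.
have cscale : continuous_at t (fun s => scale E (iota3 (y s))).
  apply: continuous_at_sqrt; apply: continuous_at_bigmax => a /EP[_ _ _ Cf].
  apply: continuous_at_mul; first exact: continuous_at_cst.
  apply: continuous_at_inv; first by rewrite gt_eqF ?subr_gt0.
  by apply: continuous_at_sub => //; exact: continuous_at_cst.
have cH : vcontinuous t (fun s => iota3 (g s)).
  rewrite (_ : (fun s => _) = H); last exact/funext.
  apply: vcontinuous_add; first exact: vcontinuous_scale.
  apply: vcontinuous_scale; last exact: vcontinuous_cst.
  have w0 : scale E (iota3 (y t)) != 0 by rewrite gt_eqF // (lt_le_trans ltr01 (scale_ge1 _ _)).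
  apply: continuous_at_mul.
    by apply: continuous_at_sub => //; exact: continuous_at_inv.
  apply: continuous_at_inv.
    by rewrite mulf_neq0 // gt_eqF // lorentz_null_gt0 //; exact: iota3_sheet.
  apply: continuous_at_mul; first exact: continuous_at_cst.
  by apply: lorentz_continuous => //; exact: vcontinuous_cst.
exists g; split; last by move=> d d0; exact: hdist_near.
have n1 : \forall s \near t, hdist (y t) (y s) < 1 by exact: hdist_near.
have n2 : \forall s \near t, {in E, forall a, C a < f a (iota3 (y s))}.
  by apply: near_seq => a /EP[_ _ _ Cf]; exact: continuous_at_gt.
have n3 : \forall s \near t, {in [seq b <- L | K < f b (iota3 (y t))],
    forall a, K < f a (iota3 (y s))}.
  by apply: near_seq => a; rewrite mem_filter => /andP[fK _]; exact: continuous_at_gt.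
near=> s; exists E, n; split=> //.
- move=> a aE; have [a1 _ CK _] := EP _ aE; split=> //; first exact: nE.
  by move: a aE {a1 CK}; near: s.
- move=> a a1 fK.
  have aL : a \in L.
    suff : [set` L] a by []. rewrite -LE /=.
    have h1 : hdist (y t) (y s) < 1 by near: s.
    have h2 : hdist (y s) (act a (y s)) <= eps by rewrite hdist_leP // -displacementE ltW.
    have := hdist_triangle (y s) (y t) (act a (y t)).
    have := hdist_triangle (act a (y s)) (y s) (act a (y t)).
    rewrite hdist_act // (hdistC (y s) (y t)); move: h1 h2.
    by do !move: (hdist _ _) => ?; lra.
  rewrite mem_filter aL a1 andbT /=; apply/andP; split.
    rewrite leNgt; apply/negP => h; move: fK; apply/negP; rewrite -leNgt ltW //.
    have : a \in [seq b <- L | K < f b (iota3 (y t))] by rewrite mem_filter h.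
    by move: a {a1 aL h}; near: s.
  exact: le_lt_trans (min_displacement_le _ a1) fK.
Unshelve. all: by end_near.
Qed.

(** Since retraction is functional and locally continuous, the condition that the retract of [y t]
    satisfies [S] is locally constant in [t]. *)
Lemma path_reach (S : hyp3 R -> Prop) d (y : R -> hyp3 R) q0 q1 : 0 < d ->
  (forall u v, thick u -> thick v -> hdist u v < d -> S u -> S v) ->
  (forall t, vcontinuous t (fun s => iota3 (y s))) -> (forall t, off_axis (y t)) ->
  retract (y 0) q0 -> retract (y 1) q1 -> S q0 -> S q1.
Proof.
move=> d0 SP cy oy r0 r1 S0.
have [||q [rq Sq]] := @locally_constant R (fun t => exists q, retract (y t) q /\ S q).
- move=> t; have [g [rg gc]] := @retract_local _ y t (cy t) (oy t).
  have rt := nbhs_singleton rg.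
  near=> s; have rs : retract (y s) (g s) by near: s.
  have ts : hdist (g t) (g s) < d by near: s; exact: gc.
  split=> -[q [rq Sq]].
    exists (g t); split=> //; apply: SP (retract_thick rs) (retract_thick rt) _ _.
      by rewrite hdistC.
    by rewrite -(retract_functional rq rs).
  exists (g s); split=> //; apply: SP (retract_thick rt) (retract_thick rs) ts _.
  by rewrite -(retract_functional rq rt).
- by exists q0.
- by rewrite (retract_functional r1 rq).
Unshelve. all: by end_near.
Qed.

(** The axis of [a], if there is one, spans a plane, so a hyperplane contains it together with [z].
    A segment from [z] to a point off this hyperplane meets the axis at most in [z]. *)
Lemma axis_covector a z : exists2 u : V, u != 0 & B u (iota3 z) = 0 /\
  forall x, a != 1%g -> f a (iota3 x) = C a -> B u (iota3 x) = 0.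
Proof.
have [[x0 [a1 x0a]]|no] := pselect (exists x, a != 1%g /\ f a (iota3 x) = C a); last first.
  have [u u0 [uz _ _]] := common_orthogonal (iota3 z) 0 0.
  by exists u => //; split=> // x a1 xa; case: no; exists x.
have [l0 nA nA'] := multiplierP a1.
have [u u0 [uz un um]] := common_orthogonal (iota3 z) (ideal a) (null_part (ideal a) (iota3 x0)).
exists u => //; split=> // x _ xa.
(* Multiplier [1] gives least displacement [cosh 0]; attained at [x0], it would make [x0] a fixed
   point. *)
have l1 : multiplier a != 1.
  apply: contraNneq a1 => l1; apply/eqP/(act_free actP (p := x0))/esym/hcosh_eq1.
  by rewrite -displacementE x0a /min_displacement l1 /half_trace invr1; lra.
have adj y y' : B (y *m mx a) y' = B y (y' *m mx a^-1%g) by rewrite act_mxV.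
have iso y y' : B (y *m mx a) (y' *m mx a) = B y y' by rewrite act_mx_lorentz.
have [k1 [k2 ->]] := axis_span (ideal_null a) l0 adj iso nA nA' (iota3_sheet x0)
  (iota3_sheet x) l1 x0a xa.
by rewrite lorentzDr !lorentzZr un um; ring.
Qed.

(** Points of the segments to [r] stay within [arcosh M] of [p] or [q], so by properness only
    finitely many elements can be short on them; [r] is taken on the moment curve off all their
    hyperplanes from [axis_covector]. *)
Lemma generic_pt p q : exists r, forall z t x k, z = p \/ z = q -> 0 < t -> 0 < k ->
  hcosh z x <= hcosh z r -> iota3 x = k *: ((1 - t) *: iota3 z + t *: iota3 r) ->
  off_axis x.
Proof.
have [Mp MpP] := moment_bounded (iota3 p); have [Mq MqP] := moment_bounded (iota3 q).
pose M := Num.max 1 (Num.max Mp Mq).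
have M1 : 1 <= M by rewrite le_max lexx.
have fin z : finite_set [set a | hdist z (act a z) <= eps + 2 * arcosh M].
  by case: actP.
have /finite_seqP[Lp LpE] := fin p; have /finite_seqP[Lq LqE] := fin q.
have /choice[u uP] : forall az : G * hyp3 R, exists u : V, u != 0 /\ B u (iota3 az.2) = 0 /\
    forall x, az.1 != 1%g -> f az.1 (iota3 x) = C az.1 -> B u (iota3 x) = 0.
  by move=> [a z]; have [u u0 h] := axis_covector a z; exists u.
have [|s s01 sP] := @moment_generic R ([seq u (a, p) | a <- Lp] ++ [seq u (a, q) | a <- Lq]).
  by move=> v; rewrite mem_cat => /orP[] /mapP[a _ ->];
    [case: (uP (a, p))|case: (uP (a, q))].
have [s0 s1] := andP s01; have [k /andP[k0 k1] [r rE]] := moment_pt s0.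
have bound z m : B (iota3 z) (moment_vec s) <= m -> m <= M -> hcosh z r <= M.
  move=> zm mM; rewrite /hcosh rE lorentzZr.
  have [h|h] := leP 0 (B (iota3 z) (moment_vec s)).
    by apply: le_trans (le_trans zm mM); rewrite -[leRHS]mul1r ler_wpM2r.
  apply: le_trans (le_trans ler01 M1); rewrite pmulr_rle0 // ltW //.
exists r => z t x l zpq t0 l0 zx xE a a1 fK.
have zM : hcosh z r <= M.
  case: zpq => ->; [apply: bound (MpP _ s01) _|apply: bound (MqP _ s01) _];
  by rewrite /M !le_max lexx !orbT.
rewrite lt_def min_displacement_le // andbT; apply/negP => /eqP fa.
have [u0 [uz ux]] := uP (a, z); have := ux x a1 fa.
rewrite xE lorentzZr lorentzDr !lorentzZr uz rE lorentzZr mulr0 add0r => /eqP.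
rewrite !mulf_eq0 (gt_eqF l0) (gt_eqF t0) (gt_eqF k0) /=; apply/negP; apply: sP.
have az : hdist z (act a z) <= eps + 2 * arcosh M.
  have h1 : hdist z x <= arcosh M.
    by rewrite hdist_leP ?arcosh_ge0 // cosh_arcosh // (le_trans zx).
  have h2 : hdist x (act a x) <= eps by rewrite hdist_leP ?(ltW eps0) // -displacementE ltW.
  have := hdist_triangle x z (act a z); have := hdist_triangle (act a x) x (act a z).
  rewrite hdist_act // (hdistC x z); move: h1 h2.
  by move: (arcosh M) => ?; do !move: (hdist _ _) => ?; lra.
rewrite mem_cat; case: zpq => zE; rewrite zE in az *.
  by rewrite map_f //; suff : [set` Lp] a by []; rewrite -LpE.
by rewrite orbC map_f //; suff : [set` Lq] a by []; rewrite -LqE.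
Qed.

Lemma thick_off_axis p : thick p -> off_axis p.
Proof. by move=> tp a a1; rewrite displacementE ltNge tp. Qed.

Let seg_off_axis z r : off_axis z ->
  (forall t x k, 0 < t -> 0 < k -> hcosh z x <= hcosh z r ->
     iota3 x = k *: ((1 - t) *: iota3 z + t *: iota3 r) -> off_axis x) ->
  forall t, off_axis (seg z r t).
Proof.
move=> oz h t; have [k /andP[k0 _] sE] := segE z r t.
have /andP[u0 _] := unit_clamp_itv t.
move: u0; rewrite le_eqVlt => /orP[/eqP u0|u0].
  rewrite -[seg z r t]/(seg z r t) (@seg_eq _ z r t z 1) //.
  by rewrite -u0 /seg_vec subr0 scale0r addr0 !scale1r.
exact: h u0 k0 (seg_hcosh _ _ _) sE.
Qed.

(* Chain connectedness of the thick part. *)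
Lemma thick_connected (S : hyp3 R -> Prop) d p q : 0 < d ->
  (forall u v, thick u -> thick v -> hdist u v < d -> S u -> S v) ->
  thick p -> thick q -> S p -> S q.
Proof.
move=> d0 SP tp tq Sp; have [r rP] := generic_pt p q.
have sc (t x : R) := @seg_vcontinuous R.
have op := @seg_off_axis p r (thick_off_axis tp) (fun t x k => rP p t x k (or_introl erefl)).
have oq := @seg_off_axis q r (thick_off_axis tq) (fun t x k => rP q t x k (or_intror erefl)).
have or_ : off_axis r by have := op 1; rewrite seg1.
have [g [gr _]] := @retract_local _ (fun t : R => seg p r t) 1 (@seg_vcontinuous _ _ _ _) (op 1).
have {gr} := nbhs_singleton gr; rewrite seg1; move: (g 1) => r' rr'.
have Sr : S r'.
  apply: (@path_reach S d (seg p r) p r' d0 SP (@seg_vcontinuous _ _ _) op) => //.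
    by rewrite seg0; exact: retract_thick_id.
  by rewrite seg1.
have back x y : off_axis (seg q r x) -> vcontinuous y (fun s : R => iota3 (seg q r (1 - s))).
  move=> _; have := @seg_vcontinuous R q r (1 - y) => h i.
  have c1 : continuous_at y (fun s : R => 1 - s).
    by apply: continuous_at_sub; [exact: continuous_at_cst|exact: cvg_id].
  exact: (@continuous_comp _ _ _ (fun s : R => 1 - s) (fun s => iota3 (seg q r s) 0 i) y c1 (h i)).
apply: (@path_reach S d (fun s => seg q r (1 - s)) r' q d0 SP (fun y => back 1 y (oq 1))) => //.
  by rewrite subr0 seg1.
by rewrite subrr seg0; exact: retract_thick_id.
Qed.

Lemma thick_exists : exists p, thick p.
Proof.
have [r rP] := generic_pt (base_pt R 0) (base_pt R 0).
have o : off_axis r.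
  apply: (rP (base_pt R 0) 1 r 1) => //; first by left.
  by rewrite subrr scale0r add0r !scale1r.
have [g [gr _]] := @retract_local R (fun=> r) 0 (@vcontinuous_cst _ _ _ _) o.
by exists (g 0); exact: retract_thick (nbhs_singleton gr).
Qed.

End ThickPart.

(** * Nets in the thick part *)

Section Directions.
Variable R : realType.
Local Notation H3 := (hyp3 R).
Local Notation B := (@lorentz R).
Implicit Types (p q : H3) (c d k : R).

(* The bound on the cosine at [p] of a hyperbolic triangle with vertices
   [p], [q], [q'] in which the side opposite to [p] is the longest. *)
Lemma angle_bound c d k : 1 < c -> 1 < d -> c <= k -> d <= k ->
  c * d - Num.max c d <= k / (k + 1) * (Num.sqrt (c ^+ 2 - 1) * Num.sqrt (d ^+ 2 - 1)).
Proof.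
wlog cd : c d / c <= d => [th c1 d1 ck dk|c1 d1 ck dk].
  case/orP: (le_total c d) => [/th|/th]; first exact.
  by rewrite maxC (mulrC c) (mulrC (Num.sqrt (c ^+ 2 - 1))); exact.
rewrite max_r //; apply: (@le_trans _ _ (c / (c + 1) * (Num.sqrt (c ^+ 2 - 1) * Num.sqrt (d ^+ 2 - 1)))).
  have c0 : 0 <= c ^+ 2 - 1 by nra.
  have d0 : 0 <= d ^+ 2 - 1 by nra.
  have u0 : 0 <= c / (c + 1) by rewrite divr_ge0 //; lra.
  have -> : c * d - d = (c - 1) * d by ring.
  rewrite -sqrtrM // -[c / (c + 1)]ger0_norm // -sqrtr_sqr -sqrtrM ?sqr_ge0 //.
  have v0 : 0 <= (c - 1) * d by rewrite mulr_ge0 //; lra.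
  rewrite -[leLHS]ger0_norm // -sqrtr_sqr ler_sqrt; last first.
    exact: mulr_ge0 (sqr_ge0 _) (mulr_ge0 c0 d0).
  have -> : (c / (c + 1)) ^+ 2 * ((c ^+ 2 - 1) * (d ^+ 2 - 1)) =
      ((c - 1) / (c + 1)) * (c ^+ 2 * (d ^+ 2 - 1)) by field; lra.
  have -> : ((c - 1) * d) ^+ 2 = ((c - 1) / (c + 1)) * ((c ^+ 2 - 1) * d ^+ 2) by field; lra.
  rewrite ler_wpM2l ?divr_ge0 //; try lra.
  have : c ^+ 2 <= d ^+ 2 by rewrite ler_pXn2r ?nnegrE //; lra.
  lra.
rewrite ler_wpM2r ?mulr_ge0 ?sqrtr_ge0 // ler_pdivrMr; last by lra.
rewrite mulrAC ler_pdivlMr; last by lra.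
lra.
Qed.

(** The point at distance [r] from [p] on the ray from [p] through [q]. *)
Definition toward p q (r : R) : 'rV[R]_4 :=
  let c := hcosh p q in
  coshR r *: iota3 p + (sinhR r / Num.sqrt (c ^+ 2 - 1)) *: (iota3 q - c *: iota3 p).

Lemma toward_p p q r : B (iota3 p) (toward p q r) = coshR r.
Proof.
rewrite /toward /hcosh /=; case: (iota3_sheet p) => pp _.
move: (sinhR r / _) => k; move: (iota3 p) (iota3 q) pp => P Q pp.
by rewrite !lorentzE pp; ring.
Qed.

Lemma toward_toward p q q' r : 1 < hcosh p q -> 1 < hcosh p q' ->
  B (toward p q r) (toward p q' r) = coshR r ^+ 2 - sinhR r ^+ 2 *
    ((hcosh p q * hcosh p q' - hcosh q q') /
     (Num.sqrt (hcosh p q ^+ 2 - 1) * Num.sqrt (hcosh p q' ^+ 2 - 1))).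
Proof.
rewrite /toward /hcosh /=; case: (iota3_sheet p) => pp _.
move: (iota3 p) (iota3 q) (iota3 q') pp => P Q Q' pp c1 d1.
have s0 (c : R) : 1 < c -> Num.sqrt (c ^+ 2 - 1) != 0.
  by move=> h; rewrite gt_eqF // sqrtr_gt0; nra.
have := s0 _ c1; have := s0 _ d1.
move: (Num.sqrt (B P Q ^+ 2 - 1)) (Num.sqrt (B P Q' ^+ 2 - 1)) => u v v0 u0.
rewrite !lorentzE pp (lorentzC Q P); field.
by rewrite v0 u0.
Qed.

Lemma toward_sheet p q r : 1 < hcosh p q -> sheet (toward p q r).
Proof.
move=> c1; apply: (sheet_future (P := iota3 p)); last first.
- by rewrite lorentzC toward_p coshR_gt0.
- exact: iota3_sheet.
rewrite toward_toward // hcoshxx -!expr2 sqr_sqrtr; last by nra.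
rewrite divff ?mulr1 ?coshR2B // gt_eqF //; nra.
Qed.

(** By [angle_bound] the cosine of the angle between two directions is at most [k / (k + 1)]. The
    points at distance [r] in these directions then have [hcosh] at least
    [1 + sinhR r ^+ 2 / (k + 1)], hence at least [cosh (2 * t)], and balls of radius [t] about them
    are disjoint. *)
Lemma directions_packing (I : choiceType) (s : seq I) (c : I -> H3) p k r t :
  0 < t -> 0 <= r -> 0 < k -> 2 * sinhR t ^+ 2 * (k + 1) <= sinhR r ^+ 2 -> uniq s ->
  {in s, forall i, 1 < hcosh p (c i) <= k} ->
  {in s &, forall i j, i != j ->
     Num.max (hcosh p (c i)) (hcosh p (c j)) <= hcosh (c i) (c j)} ->
  (size s)%:R * (sinhR (2 * t) - 2 * t) <= sinhR (2 * (r + t)) - 2 * (r + t).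
Proof.
move=> t0 r0 k0 ang us sc sep.
have : forall i, exists x : H3, i \in s -> iota3 x = toward p (c i) r.
  move=> i; have [si|] := boolP (i \in s); last by exists p.
  have [] := @sheet_iota3 R (toward p (c i) r).
    by apply: toward_sheet; case/andP: (sc _ si).
  by move=> x xE; exists x.
move=> /choice[x xE].
apply: (@hball_packing R I s x p) => // [i j si sj ij|i si].
  have [/andP[ci ck] /andP[cj ck']] := (sc _ si, sc _ sj).
  rewrite leNgt hdist_ltP; last by rewrite mulr_ge0 // ltW.
  rewrite -leNgt coshR_double /hcosh !xE // toward_toward //.
  have := angle_bound ci cj ck ck'; have := sep _ _ si sj ij.
  have cs := coshR2B r.
  have s0 (e : R) : 1 < e -> 0 < Num.sqrt (e ^+ 2 - 1) by move=> e1; rewrite sqrtr_gt0; nra.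
  have := mulr_gt0 (s0 _ ci) (s0 _ cj).
  move: (Num.sqrt _ * Num.sqrt _) (hcosh p (c i) * hcosh p (c j)) (Num.max _ _) => uv cc m uv0.
  move: (hcosh (c i) (c j)) => cij mc an.
  have z1 : (cc - cij) / uv <= k / (k + 1).
    by rewrite ler_pdivrMr //; apply: le_trans an; rewrite lerB.
  apply: (@le_trans _ _ (coshR r ^+ 2 - sinhR r ^+ 2 * (k / (k + 1)))); last first.
    by rewrite lerD2l lerN2 ler_wpM2l // sqr_ge0.
  have -> : coshR r ^+ 2 = 1 + sinhR r ^+ 2 by rewrite -cs subrK.
  have -> : k / (k + 1) = 1 - (k + 1)^-1 by field; lra.
  rewrite mulrBr mulr1 -addrA lerD2l opprB addrCA subrr addr0.
  by rewrite ler_pdivlMr //; lra.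
by rewrite hdist_leP // /hcosh xE // toward_p.
Qed.

Lemma directions_le59 (I : choiceType) (s : seq I) (c : I -> H3) p : uniq s ->
  {in s, forall i, 1 < hcosh p (c i) <= 32 / 10} ->
  {in s &, forall i j, i != j ->
     Num.max (hcosh p (c i)) (hcosh p (c j)) <= hcosh (c i) (c j)} ->
  (size s <= 59)%N.
Proof.
move=> us sc sep.
(* [ltr0Sn R n] concerns [n.+1]: these terms are positivity proofs for [87 / 1000] and, below,
   [32 / 10]. *)
have r0 := divr_gt0 (ltr0Sn R 86) (ltr0Sn R 999).
have t0 : 0 <= 4^-1 :> R by clear; lra.
have k0 := divr_gt0 (ltr0Sn R 31) (ltr0Sn R 9).
have ang : 2 * sinhR (87 / 1000 : R) ^+ 2 * (32 / 10 + 1) <= sinhR (4^-1) ^+ 2.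
  apply: le_trans (angle_packing R); move: (sinhR _ ^+ 2) => u; clear; lra.
have := directions_packing r0 t0 k0 ang us sc sep; clear.
have -> : 2 * (87 / 1000) = 174 / 1000 :> R by field.
have -> : 2 * (4^-1 + 87 / 1000) = 674 / 1000 :> R by field.
have pos : 0 < sinhR (174 / 1000 : R) - 174 / 1000.
  rewrite subr_gt0; apply: sinhR_gt; exact: (divr_gt0 (ltr0Sn R 173) (ltr0Sn R 999)).
move=> /le_lt_trans/(_ (packing_ratio R)).
by rewrite (ltr_pM2r pos) ltr_nat ltnS.
Qed.

End Directions.

Lemma size_le_sum_count (I J : eqType) (f : I -> J) (s : seq J) (l : seq I) :
  {in l, forall x, f x \in s} ->
  (size l <= \sum_(p <- s) count (fun x => f x == p) l)%N.
Proof.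
elim: l => [|x l IH] // h; rewrite /= big_split /= -add1n leq_add //; last first.
  by apply: IH => y yl; apply: h; rewrite inE yl orbT.
rewrite (big_rem (f x)) /=; last by apply: h; rewrite mem_head.
by rewrite eqxx.
Qed.

(** * Minimal connected graphs on a net *)

Section NetGraph.
Local Open Scope classical_set_scope.
Variables (R : realType) (G : groupType) (act : G -> hyp3 R -> hyp3 R) (eps t : R).
Hypothesis actP : free_isometric_action act.
Hypotheses (eps0 : 0 < eps) (t0 : 0 <= t) (cosh_t : coshR t <= 32 / 10).
Local Notation H3 := (hyp3 R).
Variables (s : seq H3) (p0 : H3).
Hypothesis separated : {in s &, forall p q, forall a, hdist p (act a q) < eps ->
  p = q /\ a = 1%g}.

Local Notation edge := (H3 * G * H3)%type.
Implicit Types (e : edge).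

(* [(p, a, q)] joins [b p] to [b a q] for every [b]. *)
Definition tip e : H3 := act e.1.2 e.2.
Definition edge_length e : R := hdist e.1.1 (tip e).
Definition is_edge e : bool :=
  [&& e.1.1 \in s, e.2 \in s, edge_length e <= t & e.1.1 != tip e].

(* The graph on [G * s] with the translates of the edges in [E] is connected. *)
Definition connecting (E : set edge) : Prop := forall S : G -> H3 -> Prop,
  (forall e b, E e -> (S b e.1.1 <-> S (b * e.1.2)%g e.2)) -> S 1%g p0 ->
  forall b p, p \in s -> S b p.

Hypothesis p0s : p0 \in s.
Hypothesis all_connecting : connecting [set` is_edge].

Lemma edges_finite : exists A : seq edge, forall e, is_edge e -> e \in A.
Proof.
pose D := \sum_(p <- s) hdist p0 p.
have leD p : p \in s -> hdist p0 p <= D.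
  move=> ps; rewrite /D (big_rem p) //= lerDl sumr_ge0 // => q _; exact: hdist_ge0.
case: (actP) => _ _ _ /(_ p0 (t + 2 * D)) /finite_seqP[L LE].
exists [seq (pa, q) | pa <- [seq (p, a) | p <- s, a <- L], q <- s].
move=> [[p a] q] /and4P[/= ps qs pq _].
apply/allpairsP; exists ((p, a), q); split=> //=.
apply/allpairsP; exists (p, a); split=> //=.
suff : [set` L] a by []. rewrite -LE /=.
have := leD _ ps; have := leD _ qs; move: pq; rewrite /edge_length /tip /=.
have := hdist_triangle p p0 (act a p0); have := hdist_triangle (act a q) p (act a p0).
rewrite hdist_act // (hdistC q p0).
clear LE leD; move: D (hdist p0 (act a p0)) (hdist p (act a p0)) (hdist p (act a q)) => ? ? ? ?.
by do !move: (hdist _ _) => ?; lra.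
Qed.

Lemma generators_of_net : exists l : seq G,
  (size l <= 59 * size s)%N /\ Defs.generated [set` l] = [set: G].
Proof.
have [A0 A0P] := edges_finite; pose A := [seq e <- A0 | is_edge e].
have AP e : (e \in A) = is_edge e.
  by rewrite mem_filter; case: (boolP (is_edge e)) => //= /A0P.
(* Sets of edges become subsets of a finite type, so a connecting one of least total length
   exists. *)
pose T := seq_sub A; pose val_edges (F : {set T}) := [set e | exists2 x, x \in F & ssval x = e].
pose weight (F : {set T}) : R := \sum_(x in F) edge_length (ssval x).
have cT : `[< connecting (val_edges [set: T]%SET) >].
  apply/asboolP => S h; apply: all_connecting => e b ee; apply: h.
  have eA : e \in A by rewrite AP.
  by exists (SeqSub eA) => //; rewrite inE.
case: (@Order.TotalTheory.arg_minP _ _ _ [set: T]%SET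
  (fun F => `[< connecting (val_edges F) >]) weight cT) => F /asboolP cF Fmin.
have ok (x : T) : is_edge (ssval x) by rewrite -AP; exact: ssvalP.
(* If the side joining the tips were shorter than [x], it could replace [x]: together with [y] it
   still joins the ends of [x], and the total length drops. Separation ensures that the tips of
   distinct edges differ. *)
have exchange (x y : T) : x \in F -> y \in F -> x != y -> (ssval x).1.1 = (ssval y).1.1 ->
    edge_length (ssval x) <= hdist (tip (ssval x)) (tip (ssval y)).
  move=> xF yF xy st; rewrite leNgt; apply/negP => lt.
  have [/and4P[xs xs' xt xn] /and4P[ys ys' yt yn]] := (ok x, ok y).
  pose e : edge := ((ssval x).2, ((ssval x).1.2^-1 * (ssval y).1.2)%g, (ssval y).2).
  have eL : edge_length e = hdist (tip (ssval x)) (tip (ssval y)).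
    by rewrite /edge_length /tip /= hdist_act2.
  have ee : e \in A.
    rewrite AP /is_edge xs' ys' eL (le_trans (ltW lt) xt) /=; apply/eqP => h.
    have := separated xs' ys' (a := ((ssval x).1.2^-1 * (ssval y).1.2)%g).
    rewrite -[act _ _]/(tip e) -h hdistxx => /(_ eps0)[qq aa].
    have ab : (ssval x).1.2 = (ssval y).1.2.
      by rewrite -[LHS]mulg1 -aa mulgA mulgV mul1g.
    case/eqP: xy; apply: val_inj => /=.
    by move: st qq ab; case: (ssval x) => [[? ?] ?]; case: (ssval y) => [[? ?] ?] /= -> -> ->.
  pose z : T := SeqSub ee; pose F' : {set T} := (z |: (F :\ x))%SET.
  have cF' : connecting (val_edges F').
    move=> S h S1; apply: cF => // _ b [w wF <-].
    have [->|wx] := eqVneq w x; last by apply: h; exists w => //; rewrite !inE wx wF orbT.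
    have hy : S b (ssval y).1.1 <-> S (b * (ssval y).1.2)%g (ssval y).2.
      by apply: h; exists y => //; rewrite !inE yF [y == x]eq_sym xy orbT.
    have hz : S (b * (ssval x).1.2)%g e.1.1 <-> S (b * (ssval x).1.2 * e.1.2)%g e.2.
      by apply: h; exists z => //; rewrite !inE eqxx.
    rewrite st hy; move: hz; rewrite /e /= -mulgA (mulgA (ssval x).1.2) mulgV mul1g.
    by move=> ->.
  have := Fmin F' (asboolT cF'); rewrite leNgt => /negP; apply.
  apply: (@le_lt_trans _ _ (edge_length e + \sum_(w in (F :\ x)%SET) edge_length (ssval w))).
    (* If the new edge already belongs to the graph, the length drops merely by removing [x]. *)
    rewrite /weight /F'; have [zF|zF] := boolP (z \in (F :\ x)%SET); last by rewrite big_setU1.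
    rewrite (_ : (z |: (F :\ x))%SET = (F :\ x)%SET) ?lerDr ?hdist_ge0 //.
    by apply/finset.setUidPr; rewrite finset.sub1set.
  by rewrite /weight [ltRHS](big_setD1 x) //= ltrD2r eL.
exists [seq (ssval x).1.2 | x <- enum F]; split.
  rewrite size_map; apply: leq_trans (@size_le_sum_count T H3 (fun x => (ssval x).1.1) s _ _) _.
    by move=> x _; case/and4P: (ok x).
  have -> : (59 * size s = \sum_(p <- s) 59)%N.
    by rewrite big_const_seq count_predT iter_addn_0.
  apply: leq_sum => p _.
  rewrite -size_filter; apply: (@directions_le59 R T _ (fun x => tip (ssval x)) p).
  - by rewrite filter_uniq // enum_uniq.
  - move=> x; rewrite mem_filter => /andP[/eqP xp _]; have /and4P[_ _ xt xn] := ok x.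
    rewrite -xp; apply/andP; split.
      by rewrite lt_def hcosh_ge1 andbT; apply: contra_neq xn => /hcosh_eq1.
    by apply: le_trans cosh_t; rewrite -hdist_leP.
  - move=> x y; rewrite (mem_filter _ x) (mem_filter _ y) !mem_enum => /andP[/eqP xp xF] /andP[/eqP yp yF] xy.
    have st : (ssval x).1.1 = (ssval y).1.1 by rewrite xp yp.
    rewrite ge_max -!coshR_hdist !ler_coshR ?nnegrE ?hdist_ge0 //.
    have := exchange x y xF yF xy st; rewrite /edge_length xp => -> /=.
    have yx : y != x by rewrite eq_sym.
    by have := exchange y x yF xF yx (esym st); rewrite /edge_length yp hdistC [X in _ <= X]hdistC.
apply/seteqP; split=> // b _.
have sG := generated_subgroup [set` [seq (ssval x).1.2 | x <- enum F]].
(* The predicate ignores the vertex: passing an edge multiplies the group element by its label, so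
   connectedness puts every [b] in the subgroup of labels. *)
apply: (cF (fun b _ => Defs.generated [set` [seq (ssval x).1.2 | x <- enum F]] b) _ _ b p0 p0s).
- move=> _ c [x xF <-].
  have gx : Defs.generated [set` [seq (ssval x).1.2 | x <- enum F]] (ssval x).1.2.
    apply: sub_generated => /=; apply: (map_f (fun x : T => (ssval x).1.2)).
    by rewrite mem_enum.
  split=> gc; first exact: (subgroupM sG).
  rewrite -[c]mulg1 -(mulgV (ssval x).1.2) mulgA.
  by apply: (subgroupM sG) => //; exact: (subgroupV sG).
- exact: (subgroup1 sG).
Qed.

End NetGraph.

(** * Maximal nets *)

Section Net.
Local Open Scope classical_set_scope.
Variables (R : realType) (G : groupType) (act : G -> hyp3 R -> hyp3 R) (eps t : R).
Hypothesis actP : free_isometric_action act.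
Hypothesis torsion_free : forall (a : G) k, (0 < k)%N -> (a ^+ k = 1)%g -> (a = 1)%g.
Hypothesis commute_trans : forall a b c : G, b != 1%g -> commute a b ->
  commute b c -> commute a c.
Hypothesis eps0 : 0 < eps.
Hypothesis short_commute : forall (p : hyp3 R) (a b : G), hdist p (act a p) <= eps ->
  hdist p (act b p) <= eps -> commute a b.
Hypotheses (epst : 2 * eps < t) (cosh_t : coshR t <= 32 / 10).
Implicit Types (s : seq (hyp3 R)) (p q : hyp3 R) (a b : G).
Local Notation thick := (thick act eps).

Definition is_net s : Prop := [/\ uniq s, {in s, forall p, thick p} &
  {in s &, forall p q, forall a, hdist p (act a q) < eps -> p = q /\ a = 1%g}].

Lemma thick_separated p a : thick p -> hdist p (act a p) < eps -> a = 1%g.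
Proof.
move=> tp h; apply: contrapT => /eqP a1.
by move: h; rewrite hdist_ltP ?(ltW eps0) // ltNge tp.
Qed.

Lemma thick_act a p : thick p -> thick (act a p).
Proof.
move=> tp b b1; have c1 : (a^-1 * (b * a) != 1)%g.
  apply: contra_neq b1 => e; apply: (mulIg a); rewrite mul1g.
  by apply: (mulgI a^-1%g); rewrite e mulVg.
by apply: le_trans (tp _ c1) _; rewrite -!coshR_hdist -hdist_act2 // -actM.
Qed.

Lemma maximal_net s x : is_net s -> (forall s', is_net s' -> (size s' <= size s)%N) ->
  thick x -> exists p a, p \in s /\ hdist x (act a p) < eps.
Proof.
move=> [us ts ss] smax tx; apply: contrapT => no.
have xs : x \notin s.
  apply/negP => h; apply: no; exists x, 1%g; split=> //.
  by rewrite act1 // hdistxx.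
suff /smax : is_net (x :: s) by rewrite /= ltnn.
split=> [|p|p q]; first by rewrite /= xs.
- by rewrite inE => /orP[/eqP->|/ts].
rewrite !inE => /orP[/eqP->|ps] /orP[/eqP->|qs] a h.
- by split=> //; exact: thick_separated h.
- by case: no; exists q, a.
- case: no; exists p, a^-1%g; split=> //; move: h.
  by rewrite hdistC -(hdist_act actP a^-1%g) actK.
- exact: ss.
Qed.

(** Two points of the thick part at distance less than [t - 2 * eps] are within [eps] of orbit
    points of the net, which are then at distance less than [t] and joined by an edge. Thus chain
    connectedness of the thick part becomes connectedness of the graph. *)
Lemma net_generators s : is_net s -> (forall s', is_net s' -> (size s' <= size s)%N) ->
  exists l : seq G, (size l <= 59 * size s)%N /\ Defs.generated [set` l] = [set: G].
Proof.
move=> ns smax; have [us ts ss] := ns.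
have [x0 tx0] := thick_exists actP torsion_free commute_trans eps0 short_commute.
have [p0 [_ [p0s _]]] := maximal_net ns smax tx0.
have t0 : 0 <= t by apply: le_trans (ltW epst); rewrite mulr_ge0 // ltW.
apply: (@generators_of_net R G act eps t actP eps0 t0 cosh_t s p0 ss p0s).
move=> S Sinv S1 b p ps.
pose Q x := exists a q, [/\ q \in s, hdist x (act a q) < eps & S a q].
suff [a [q [qs pq Sq]]] : Q (act b p).
  move: pq; rewrite hdist_act2 // => /(ss _ _ ps qs)[-> ab].
  by rewrite -[b]mulg1 -ab mulgA mulgV mul1g.
have d0 : 0 < t - 2 * eps by rewrite subr_gt0.
apply: (@thick_connected R G act eps actP torsion_free commute_trans eps0 short_commute
  Q (t - 2 * eps) p0 (act b p) d0) => [u v tu tv uv [a [q [qs uq Sq]]]|||].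
- have [q' [a' [qs' vq]]] := maximal_net ns smax tv.
  exists a', q'; split=> //; pose e : hyp3 R * G * hyp3 R := (q, (a^-1 * a')%g, q').
  have aa : (a * (a^-1 * a') = a')%g by rewrite mulgA mulgV mul1g.
  have le : edge_length act e <= t.
    rewrite /edge_length /tip /= -hdist_act2 //.
    have := hdist_triangle u (act a q) (act a' q'); have := hdist_triangle v u (act a' q').
    rewrite (hdistC (act a q) u); move: uv uq vq.
    by do !move: (hdist _ _) => ?; lra.
  (* Edges have distinct ends; if the ends coincide, separation gives [q = q'] and [a = a']. *)
  have [qq|qq] := eqVneq q (act (a^-1 * a')%g q').
    have [|qE a1] := ss _ _ qs qs' (a^-1 * a')%g; first by rewrite -qq hdistxx.
    by rewrite -qE -aa a1 mulg1.
  have ee : is_edge act t s e by apply/and4P; split.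
  by have [h _] := Sinv e a ee; rewrite /e /= aa in h; exact: h.
- exact: ts.
- exact/thick_act/ts.
- by exists 1%g, p0; split=> //; rewrite act1 // hdistxx.
Qed.

End Net.

(** * Net size and the volume of the manifold *)

Section Volume.
Local Open Scope classical_set_scope.
Variables (R : realType) (M : hyperbolic_3manifold R).

(** Balls of radius [eps / 2] about the net project injectively: if a deck transformation carries
    one of their points to another, the centres are within [eps] up to that transformation, which is
    therefore the identity. *)
Lemma net_volume (s : seq (hyp3 R)) eps : 0 < eps -> uniq s ->
  (forall p q g, p \in s -> q \in s -> deck M g -> hdist p (g q) < eps -> p = q /\ g = id) ->
  (((size s)%:R * ball_vol (eps / 2))%:E <= vol M)%E.
Proof.
move=> e0 us sep; have e2 : 0 < eps / 2 by rewrite divr_gt0.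
have sepd : {in s &, forall i j : hyp3 R, i != j -> 2 * (eps / 2) <= hdist i j}.
  move=> i j si sj ij; rewrite mulrC divfK // leNgt; apply/negP => h.
  by case/eqP: ij; have [] := sep i j id si sj (deck_id M) h.
have [mA <-] := @hballs_vol R (hyp3 R) s id (eps / 2) e2 us sepd.
apply: ereal_sup_ubound; eexists; last reflexivity; split=> //.
move=> u v; rewrite !inE => -[p ps pu] [q qs qv] /prjP[g Mg gu].
have [_ iso] := deck_isometry Mg.
have [|_ gid] := sep q p g qs ps Mg; last by rewrite -gu gid.
have h1 := hdist_triangle v q (g p); have h2 := iso p u; rewrite gu in h2.
move: h1 pu qv; rewrite /hball /= (hdistC v) h2.
by do !move: (hdist _ _) => ?; lra.
Qed.

End Volume.

Theorem theorem7p7 (R : realType) (M : hyperbolic_3manifold R) (x : points M)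
  (hor : orientable M)
  (hvolM : (vol M < +oo)%E)
  (hsf : semifree (fundamental_group R x) 9) :
  exists2 n : nat, has_rank [set: fundamental_group R x] n
    & n%:R < 1 + (157 + 766 / 1000) * fine (vol M) :> R.
Proof.
have sfk k : (k <= 9)%N -> semifree (fundamental_group R x) k.
  by move=> k9 H n sH rH nk; exact: hsf H n sH rH (leq_trans nk k9).
have [act [Mact actS actM' act_id]] := pi1_action x.
have act1' : act 1%g = id.
  have [_ iso] := deck_isometry (Mact 1%g); apply/funext => p /=.
  apply: hdist_eq0; rewrite -iso.
  have := congr1 (fun f => f p) (actM' 1%g 1%g); rewrite mulg1 /= => <-.
  exact: hdistxx.
have act_inj' a b : act a = act b -> a = b.
  move=> e; have : (a * b^-1 = 1)%g by apply: act_id; rewrite actM' e -actM' mulgV.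
  by move=> e1; rewrite -[a]mulg1 -(mulVg b) mulgA e1 mul1g.
have actP : free_isometric_action act.
  split=> [a|a b p|a p e|p r].
  - exact: deck_isometry (Mact a).
  - by rewrite actM'.
  - exact/act_id/(deck_free (p := p) (Mact a)).
  - rewrite (_ : [set a | _]%classic =
      (act @^-1` [set h | deck M h /\ hdist p (h p) <= r])%classic).
      by apply: finite_preimage (deck_proper M p r) => a b _ _; exact: act_inj'.
    by apply/seteqP; split=> [a ar|a []].
have torsion_free (a : fundamental_group R x) k : (0 < k)%N -> (a ^+ k = 1)%g -> (a = 1)%g.
  move=> k0 ak; apply/act_id/funext/(deck_torsion_free (Mact a) k0) => p.
  have it m : iter m (act a) p = act (a ^+ m)%g p.
    by elim: m => [|m IH]; rewrite ?expg0 ?act1' //= IH expgS actM'.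
  by rewrite it ak act1'.
have ct := fun a b c => @semifree_commute_trans _ a b c (sfk 3 isT).
have eps0 := divr_gt0 (ltr0Sn R 904) (ltr0Sn R 999).
have mg p (a b : fundamental_group R x) : hdist p (act a p) <= 905 / 1000 ->
    hdist p (act b p) <= 905 / 1000 -> commute a b.
  exact: (margulis actP (sfk 2 isT) (ltW eps0) (coshR_eps_lt R)).
have epst : 2 * (905 / 1000) < 182 / 100 :> R by clear; lra.
(* The volume bounds the sizes of nets, so a net of maximal size exists. *)
pose P n := `[< exists s, is_net act (905 / 1000) s /\ size s = n >].
have vol0 : (0 <= vol M)%E.
  by apply: le_trans (@net_volume R M [::] _ eps0 isT _) => //; rewrite mul0r.
have volE : vol M = (fine (vol M))%:E by rewrite fineK // ge0_fin_numE.
(* [44/15 * 0.1282] is slightly more than [0.376]. *)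
have bv : 376 / 1000 <= ball_vol (905 / 1000 / 2 : R).
  have := sinhR_eps_ge R; have [_] := disc_cst_bounds R.
  rewrite /ball_vol (_ : 2 * (905 / 1000 / 2) = 905 / 1000); last by clear; field.
  move: (disc_cst R) (sinhR _ - _) => k u; clear => k1 u1.
  have d0 : 0 <= 1282 / 1000 / 10 :> R by clear; lra.
  have := ler_pM (divr_ge0 (ler0n R 44) (ler0n R 15)) d0 k1 u1.
  by apply: le_trans; clear; lra.
have bound s : is_net act (905 / 1000) s ->
    (size s)%:R * ball_vol (905 / 1000 / 2) <= fine (vol M).
  move=> [us ts ss]; rewrite -lee_fin -volE; apply: net_volume => // p q g ps qs Mg.
  have [a <-] := actS g Mg; move=> /(ss p q ps qs)[-> ->]; by rewrite act1'.
have exP : exists n, P n.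
  by exists 0%N; apply/asboolP; exists [::]; split=> //; split.
have [N NP] : exists N, forall n, P n -> (n <= N)%N.
  exists (Num.trunc (fine (vol M) / (376 / 1000))) => n /asboolP[s [ns <-]].
  have b0 : 0 < 376 / 1000 :> R by clear; lra.
  rewrite -ltnS -(ltr_nat R); apply: le_lt_trans (truncnS_gt _).
  by rewrite ler_pdivlMr //; apply: le_trans (bound s ns); rewrite ler_wpM2l.
case: (ex_maxnP exP NP) => n /asboolP[s [ns sn]] nmax.
have smax s' : is_net act (905 / 1000) s' -> (size s' <= size s)%N.
  by move=> ns'; rewrite sn; apply: nmax; apply/asboolP; exists s'.
have [l [ls gl]] := net_generators actP torsion_free ct eps0 mg epst (coshR_edge_le R) ns smax.
have [m ml rk] := rank_exists l; rewrite gl in rk; exists m => //.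
have h1 : m%:R <= 59 * (size s)%:R :> R.
  by rewrite -natrM ler_nat; exact: leq_trans ls.
have h2 : (size s)%:R * (376 / 1000) <= fine (vol M).
  by apply: le_trans (bound s ns); rewrite ler_wpM2l.
have v0 : 0 <= fine (vol M) by rewrite fine_ge0.
(* The slope [59 / 0.376] is below [157]; the summand [1] makes the inequality strict for every
   nonnegative volume. *)
move: (fine _) (size s)%:R m%:R h1 h2 v0; clear => v S m h1 h2 v0; lra.
Qed.
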